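(* Let $d,D\ge 1$, let $(X,\mu,T)$ be a free ergodic $\mathbf{Z}^d$-system and let $(Y,\nu,S)$ be a free ergodic $\mathbf{Z}^D$-system. If there is an SOE$_\infty$ between them, then there is an SSOE$_1$ between them. If there is an SSOE$_1$ between them, then $d=D$ and the two systems are Kakutani equivalent.
   Context: **Systems.** A $G$-system $(X,\mu,T)$ is a standard Borel probability space with a measurable $\mu$-preserving action $T=(T^g)_{g\in G}$ of $G$. It is free if $g\mapsto T^gx$ is injective for a.e. $x$. $T^G(x)$ is the orbit of $x$. $|\cdot|_G$ is the word length of a fixed finite symmetric generating set; on $\mathbf{Z}^d$ take the $\ell^1$-norm $|\cdot|$. **Stable orbit equivalence (SOE).** An SOE $\Phi$ from a $G$-system $(X,\mu,T)$ to an $H$-system $(Y,\nu,S)$ consists of measurable sets $U=\mathrm{dom}\,\Phi\subseteq X$, $V=\mathrm{img}\,\Phi\subseteq Y$ of positive measure and a bi-measurable bijection $\Phi:U\to V$ such that $\mu(\Phi^{-1}A)/\mu(U)=\nu(A)/\nu(V)$ for all measurable $A\subseteq V$, and $\Phi(T^G(x)\cap U)=S^H(\Phi(x))\cap V$ for $\mu$-a.e. $x\in U$. For free systems it determines $\alpha(g,x)\in H$ for $x\in U\cap T^{g^{-1}}U$ and $\beta(h,y)\in G$ for $y\in V\cap S^{h^{-1}}V$ by $\Phi(T^gx)=S^{\alpha(g,x)}\Phi(x)$ and $\Phi^{-1}(S^hy)=T^{\beta(h,y)}\Phi^{-1}(y)$. A (full) cocycle $\sigma:G\times X\to H$ over $T$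 is a measurable map with $\sigma(gk,x)=\sigma(g,T^kx)\sigma(k,x)$. **SOE$_\infty$.** $\Phi$ is an SOE$_\infty$ if there is $C<\infty$ such that for all $g,h$: $|\alpha(g,x)|_H\le C|g|_G$ for a.e. $x\in U\cap T^{g^{-1}}U$, and $|\beta(h,y)|_G\le C|h|_H$ for a.e. $y\in V\cap S^{h^{-1}}V$. **SSOE$_1$.** $\Phi$ is an SSOE$_1$ if $\alpha$ extends to a full cocycle $\sigma:G\times X\to H$ over $T$ with $\int_X|\sigma(g,x)|_H\,\mu(dx)<\infty$ for all $g\in G$, and similarly $\beta$ extends to a full cocycle $H\times Y\to G$ over $S$ with the analogous integrability. **Kakutani equivalence.** Let $M$ be a real $d\times d$ matrix. $\mathbf{Z}^d$-systems $(X,\mu,T)$ and $(Y,\nu,S)$ are $M$-Kakutani equivalent if there is an SOE $\Phi$ from $(X,\mu,T)$ to $(Y,\nu,S)$ such that (i) $\mathrm{dom}\,\Phi=X$, and (ii) if $\alpha:\mathbf{Z}^d\times X\to\mathbf{Z}^d$ is the cocycle describing $\Phi$, then for every $\varepsilon>0$ there are $N_\varepsilon\in\mathbf{N}$ and a measurable $A_\varepsilon\subseteq X$ with $\mu(A_\varepsilon)>1-\varepsilon$ such that $|\alpha(v,x)-Mv|\le\varepsilon|v|$ whenever $v\in\mathbf{Z}^d$, $|v|\ge N_\varepsilon$ and $x\in A_\varepsilon\cap T^{-v}A_\varepsilon$. Two $\mathbf{Z}^d$-systems are Kakutani equivalent if for some $M$ this holds for the two systems taken in one order or the other (i.e. from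 $X$ to $Y$ or from $Y$ to $X$). *)

(* Defs.v *)
From HB Require Import structures.
From mathcomp Require Import all_boot all_order all_algebra.
From mathcomp Require Import all_classical all_reals all_analysis.
Set Implicit Arguments.
Unset Strict Implicit.
Unset Printing Implicit Defensive.
Import Order.TTheory GRing.Theory Num.Theory.
Local Open Scope classical_set_scope.
Local Open Scope ring_scope.

(* The group Z^n is the type of column vectors 'cV[int]_n, written additively.
   For the generators e_i and -e_i its word length is the l1-norm. *)
Definition l1norm (K : numDomainType) (n : nat) (w : 'cV[K]_n) : K :=
  \sum_i `|w i 0|.

Definition real_vec (R : realType) (n : nat) (v : 'cV[int]_n) : 'cV[R]_n :=
  map_mx intr v.

Definition zlen (R : realType) (n : nat) (v : 'cV[int]_n) : R :=
  l1norm (real_vec R v).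

(* Isomorphic, as a measurable space, to a complete separable metric space with
   its Borel sigma-algebra. *)
Definition standard_borel (R : realType) (d : measure_display)
    (X : measurableType d) : Prop :=
  exists (P : metricType R) (f : X -> P),
    [/\ forall u : nat -> P, cauchy (u @ \oo) -> exists l : P, u @ \oo --> l,
        exists2 Q : set P, countable Q & dense Q,
        set_bij setT setT f &
        forall A : set X, measurable A <-> <<s open >> (f @` A)].

Record zsystem (R : realType) (dX : measure_display) (X : measurableType dX)
    (mu : probability X R) (n : nat) := ZSystem {
  zact :> 'cV[int]_n -> X -> X;
  zsystem_standard : standard_borel R X;
  zact0 : forall x, zact 0 x = x;
  zactD : forall g k x, zact (g + k) x = zact g (zact k x);
  zact_measurable : forall g, measurable_fun setT (zact g);
  zact_preserving : forall g A, measurable A -> mu (zact g @^-1` A) = mu A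
}.

Definition zfree (R : realType) (dX : measure_display) (X : measurableType dX)
    (mu : probability X R) (n : nat) (T : zsystem mu n) : Prop :=
  {ae mu, forall x, injective (fun g => T g x)}.

Definition zergodic (R : realType) (dX : measure_display)
    (X : measurableType dX) (mu : probability X R) (n : nat)
    (T : zsystem mu n) : Prop :=
  forall A : set X, measurable A -> (forall g, T g @^-1` A = A) ->
    mu A = 0%E \/ mu A = 1%E.

Definition zorbit (R : realType) (dX : measure_display) (X : measurableType dX)
    (mu : probability X R) (n : nat) (T : zsystem mu n) (x : X) : set X :=
  range (fun g => T g x).

(* [soe_map] is total, but only its values on [soe_dom] are meaningful; its
   inverse is [pinv soe_dom soe_map], meaningful on [soe_img]. *)
Record soe (R : realType) (dX dY : measure_display)
    (X : measurableType dX) (Y : measurableType dY)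
    (mu : probability X R) (nu : probability Y R) (m n : nat)
    (T : zsystem mu m) (S : zsystem nu n) := SOE {
  soe_dom : set X;
  soe_img : set Y;
  soe_map : X -> Y;
  soe_dom_measurable : measurable soe_dom;
  soe_img_measurable : measurable soe_img;
  soe_dom_gt0 : (0 < mu soe_dom)%E;
  soe_img_gt0 : (0 < nu soe_img)%E;
  soe_bij : set_bij soe_dom soe_img soe_map;
  soe_map_measurable : measurable_fun soe_dom soe_map;
  soe_inv_measurable : measurable_fun soe_img (pinv soe_dom soe_map);
  soe_measure : forall A : set Y, measurable A -> A `<=` soe_img ->
    fine (mu (soe_dom `&` soe_map @^-1` A)) / fine (mu soe_dom)
      = fine (nu A) / fine (nu soe_img);
  soe_orbit : {ae mu, forall x, soe_dom x ->
    soe_map @` (zorbit T x `&` soe_dom) = zorbit S (soe_map x) `&` soe_img}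
}.

Definition soe_inv (R : realType) (dX dY : measure_display)
    (X : measurableType dX) (Y : measurableType dY)
    (mu : probability X R) (nu : probability Y R) (m n : nat)
    (T : zsystem mu m) (S : zsystem nu n) (Phi : soe T S) : Y -> X :=
  pinv (soe_dom Phi) (soe_map Phi).

(* When S is free and [f] is the map of a stable orbit equivalence, then for
   almost every x in U with T^g x in U there is exactly one h as below; the
   default value 0 is taken where there is none. *)
Definition transfer (R : realType) (dX dY : measure_display)
    (X : measurableType dX) (Y : measurableType dY)
    (mu : probability X R) (nu : probability Y R) (m n : nat)
    (T : zsystem mu m) (S : zsystem nu n) (f : X -> Y)
    (g : 'cV[int]_m) (x : X) : 'cV[int]_n :=
  xget 0 [set h | f (T g x) = S h (f x)].

Definition soe_alpha (R : realType) (dX dY : measure_display)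
    (X : measurableType dX) (Y : measurableType dY)
    (mu : probability X R) (nu : probability Y R) (m n : nat)
    (T : zsystem mu m) (S : zsystem nu n) (Phi : soe T S)
    : 'cV[int]_m -> X -> 'cV[int]_n := transfer T S (soe_map Phi).

Definition soe_beta (R : realType) (dX dY : measure_display)
    (X : measurableType dX) (Y : measurableType dY)
    (mu : probability X R) (nu : probability Y R) (m n : nat)
    (T : zsystem mu m) (S : zsystem nu n) (Phi : soe T S)
    : 'cV[int]_n -> Y -> 'cV[int]_m := transfer S T (soe_inv Phi).

Definition soe_infty (R : realType) (dX dY : measure_display)
    (X : measurableType dX) (Y : measurableType dY)
    (mu : probability X R) (nu : probability Y R) (m n : nat)
    (T : zsystem mu m) (S : zsystem nu n) (Phi : soe T S) : Prop :=
  let U := soe_dom Phi in let V := soe_img Phi in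
  exists C : R,
    (forall g, {ae mu, forall x, (U `&` T g @^-1` U) x ->
       zlen R (soe_alpha Phi g x) <= C * zlen R g}) /\
    (forall h, {ae nu, forall y, (V `&` S h @^-1` V) y ->
       zlen R (soe_beta Phi h y) <= C * zlen R h}).

(* Measurability of [sigma g] is with respect to the discrete sigma-algebra on
   the countable group Z^n. *)
Definition full_cocycle (R : realType) (dX : measure_display)
    (X : measurableType dX) (mu : probability X R) (m n : nat)
    (T : zsystem mu m) (sigma : 'cV[int]_m -> X -> 'cV[int]_n) : Prop :=
  (forall g h, measurable (sigma g @^-1` [set h])) /\
  (forall g k x, sigma (g + k) x = sigma g (T k x) + sigma k x).

Definition integrable_extension (R : realType) (dX : measure_display)
    (X : measurableType dX) (mu : probability X R) (m n : nat)
    (T : zsystem mu m) (U : set X) (a : 'cV[int]_m -> X -> 'cV[int]_n) : Prop :=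
  exists sigma : 'cV[int]_m -> X -> 'cV[int]_n,
    [/\ full_cocycle T sigma,
        forall g, {ae mu, forall x, (U `&` T g @^-1` U) x ->
          sigma g x = a g x} &
        forall g, (\int[mu]_x (zlen R (sigma g x))%:E < +oo)%E].

Definition ssoe_one (R : realType) (dX dY : measure_display)
    (X : measurableType dX) (Y : measurableType dY)
    (mu : probability X R) (nu : probability Y R) (m n : nat)
    (T : zsystem mu m) (S : zsystem nu n) (Phi : soe T S) : Prop :=
  integrable_extension T (soe_dom Phi) (soe_alpha Phi) /\
  integrable_extension S (soe_img Phi) (soe_beta Phi).

Definition M_kakutani (R : realType) (dX dY : measure_display)
    (X : measurableType dX) (Y : measurableType dY)
    (mu : probability X R) (nu : probability Y R) (n : nat) (M : 'M[R]_n)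
    (T : zsystem mu n) (S : zsystem nu n) : Prop :=
  exists Phi : soe T S,
    soe_dom Phi = setT /\
    forall eps : R, 0 < eps ->
      exists (N : nat) (A : set X),
        [/\ measurable A,
            ((1 - eps)%:E < mu A)%E &
            forall (v : 'cV[int]_n) (x : X),
              N%:R <= zlen R v -> (A `&` T v @^-1` A) x ->
              l1norm (real_vec R (soe_alpha Phi v x) - M *m real_vec R v)
                <= eps * zlen R v].

Definition kakutani_equivalent (R : realType) (dX dY : measure_display)
    (X : measurableType dX) (Y : measurableType dY)
    (mu : probability X R) (nu : probability Y R) (n : nat)
    (T : zsystem mu n) (S : zsystem nu n) : Prop :=
  exists M : 'M[R]_n, M_kakutani M T S \/ M_kakutani M S T.

(* Main.v *)
(* If Phi is Lipschitz, each coordinate of the partial cocycle alpha extends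
   along orbits by McShane's formula inf_v (alpha(v) + C |w - v|), whose
   increments form a full bounded cocycle.

   Now let sigma be an integrable cocycle over an ergodic Z^d-action, with
   mean M (a matrix).  Averaging sigma over translates changes it by a
   coboundary, and by the mean ergodic theorem the averages of its generators
   tend to M in L^1.  A cocycle gamma with small generators satisfies
   |gamma(v, x)| <= e |v| as soon as x and T^v x lie in a set where the maximal
   function of the generators is small: compare the means of gamma over dyadic
   boxes at x and at T^v x.  Hence sigma(v, x) is close to M v whenever x and
   T^v x belong to a large set.  For an SSOE_1 the two matrices so obtained are
   inverse to each other, by recurrence along each axis, whence d = D.

   Finally a greedy matching of X into Y along the countably many maps
   S^h Phi T^g is defined almost everywhere when nu(V) <= mu(U), by ergodicity;
   its cocycle is cohomologous to sigma.  The exceptional null set is sent into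
   a null Cantor set of Y, which makes the domain all of X.  When
   nu(V) > mu(U) the roles of X and Y are exchanged. *)
Require Import Defs.
From HB Require Import structures.
From mathcomp Require Import all_boot all_order all_algebra.
From mathcomp Require Import all_classical all_reals all_analysis.
From mathcomp Require Import measurable_realfun.
From mathcomp Require Import zify ring lra.
Set Implicit Arguments.
Unset Strict Implicit.
Unset Printing Implicit Defensive.
Import Order.TTheory GRing.Theory Num.Theory.
Import numFieldNormedType.Exports.
Local Open Scope classical_set_scope.
Local Open Scope ring_scope.

(** * Measurability of predicates *)

(** The Kakutani condition asks for one set A that serves all v at once and constrains only the two
    ends x and T^v x. The maximal inequality supplies such a set, but it sees absolute values: after
    subtraction of its mean, sigma has generators of mean zero, not of small L^1-norm. Averaging
    over translates makes them small, and the coboundary that this costs is measurable, hence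
    bounded off a small set and negligible against |v|. A full cocycle is essential here: the
    partial cocycle alpha is undefined where a generator leaves U, so it cannot be averaged. Two
    other points shape the proof. The domain has to be all of X, not a conull set, and the map a
    bijection with measurable inverse; so the exceptional points need a measurable injection into an
    S-invariant null set that generic orbits never meet. And an equivalence scales measure by a
    fixed ratio, which must be at most 1 if the whole of X is to fit into Y; this decides the
    direction of the Kakutani equivalence. *)

Section measurable_predicates.
Context d (X : measurableType d).
Implicit Types P Q : X -> Prop.

Definition mpred P := measurable [set x | P x].

Lemma mpred_ext P Q : (forall x, P x <-> Q x) -> mpred P -> mpred Q.
Proof.
rewrite /mpred => PQ mP.
by have <- : [set x | P x] = [set x | Q x] by apply/seteqP; split=> x /PQ.
Qed.

Lemma mpred_and P Q : mpred P -> mpred Q -> mpred (fun x => P x /\ Q x).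
Proof. exact: measurableI. Qed.

Lemma mpred_or P Q : mpred P -> mpred Q -> mpred (fun x => P x \/ Q x).
Proof. exact: measurableU. Qed.

Lemma mpred_not P : mpred P -> mpred (fun x => ~ P x).
Proof. exact: measurableC. Qed.

Lemma mpred_cst (p : Prop) : mpred (fun _ => p).
Proof.
have [hp|hp] := pselect p.
  by apply: (mpred_ext _ (measurableT : mpred (fun=> True))).
by apply: (mpred_ext _ (measurable0 : mpred (fun=> False))).
Qed.

Lemma mpred_imp P Q : mpred P -> mpred Q -> mpred (fun x => P x -> Q x).
Proof.
move=> mP mQ; apply: (mpred_ext _ (mpred_or (mpred_not mP) mQ)) => x.
by split=> [[]// nP /nP//|PQ]; have [/PQ|] := pselect (P x); [right|left].
Qed.

Lemma mpred_ex (I : countType) (P : I -> X -> Prop) :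
  (forall i, mpred (P i)) -> mpred (fun x => exists i, P i x).
Proof.
move=> mP.
pose F n := [set x | if unpickle n is Some i then P i x else False].
have mF n : measurable (F n).
  by rewrite /F; case: unpickle => [i|]; [exact: mP|exact: mpred_cst].
suff : mpred (fun x => (\bigcup_n F n) x).
  apply: mpred_ext => x; split=> [[n _]|[i Pi]].
    by rewrite /F/=; case: unpickle => // i Pi; exists i.
  by exists (pickle i) => //; rewrite /F/= pickleK.
exact: bigcupT_measurable.
Qed.

Lemma mpred_all (I : countType) (P : I -> X -> Prop) :
  (forall i, mpred (P i)) -> mpred (fun x => forall i, P i x).
Proof.
move=> mP.
apply: (mpred_ext _ (mpred_not (mpred_ex (fun i => mpred_not (mP i))))) => x.
by split=> [h i|h [i]//]; apply: contrapT => nP; apply: h; exists i.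
Qed.

(** Measurability for a discrete target, stated by fibres as in [full_cocycle]. *)
Definition mdisc (I : Type) (f : X -> I) := forall i, mpred (fun x => f x = i).

(** Reduces a statement with a random index to its countably many values. *)
Lemma mpred_disc (I : countType) (f : X -> I) (Q : I -> X -> Prop) :
  mdisc f -> (forall i, mpred (Q i)) -> mpred (fun x => Q (f x) x).
Proof.
move=> mf mQ.
apply: (mpred_ext _ (mpred_ex (fun i => mpred_and (mf i) (mQ i)))) => x.
by split=> [[i [<-]]//|Qx]; exists (f x).
Qed.

Lemma mdisc_cst (I : Type) (i : I) : mdisc (fun=> i).
Proof. by move=> j; exact: mpred_cst. Qed.

Lemma mdisc_ex (I : countType) (J : Type) (f : X -> I) (F : I -> X -> J) :
  mdisc f -> (forall i, mdisc (F i)) -> mdisc (fun x => F (f x) x).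
Proof.
move=> mf mF j.
exact: (@mpred_disc I f (fun i x => F i x = j) mf (fun i => mF i j)).
Qed.

Lemma mdisc_comp (I : countType) (J : Type) (f : X -> I) (F : I -> J) :
  mdisc f -> mdisc (fun x => F (f x)).
Proof.
by move=> mf; apply: (mdisc_ex (F := fun i _ => F i) mf) => i; exact: mdisc_cst.
Qed.

Lemma mpred_preimage d' (Y : measurableType d') (f : X -> Y) (P : Y -> Prop) :
  measurable_fun setT f -> measurable [set y | P y] -> mpred (fun x => P (f x)).
Proof. by move=> mf mP; rewrite /mpred -[X in measurable X]setTI; exact: mf. Qed.

Lemma measurable_funTP d' (Y : measurableType d') (f : X -> Y) :
  (forall A, measurable A -> mpred (fun x => A (f x))) -> measurable_fun setT f.
Proof. by move=> mf _ A mA; rewrite setTI; exact: mf. Qed.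

Lemma measurable_fun_disc d' (Y : measurableType d') (I : countType) (f : X -> I)
    (F : I -> X -> Y) : mdisc f -> (forall i, measurable_fun setT (F i)) ->
  measurable_fun setT (fun x => F (f x) x).
Proof.
move=> mf mF; apply: measurable_funTP => A mA.
apply: (mpred_disc (Q := fun i x => A (F i x)) mf) => i.
exact: mpred_preimage (mF i) mA.
Qed.

Lemma measurable_fun_discE d' (Y : measurableType d') (I : countType) (f : X -> I)
    (F : I -> Y) : mdisc f -> measurable_fun setT (fun x => F (f x)).
Proof.
move=> mf; apply: (measurable_fun_disc (F := fun i _ => F i) mf) => i.
exact: measurable_cst.
Qed.

Lemma mpred_le (R : realType) (f g : X -> R) :
  measurable_fun setT f -> measurable_fun setT g -> mpred (fun x => f x <= g x).
Proof.
move=> mf mg; have := measurable_fun_le measurableT mf mg; rewrite setTI; exact.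
Qed.

Lemma mpred_lt (R : realType) (f g : X -> R) :
  measurable_fun setT f -> measurable_fun setT g -> mpred (fun x => f x < g x).
Proof.
move=> mf mg; apply: (mpred_ext _ (mpred_not (mpred_le mg mf))) => x.
by rewrite ltNge; split=> /negP.
Qed.

End measurable_predicates.

(** * Null and conull sets *)

Section almost_everywhere.
Context d (X : measurableType d) (R : realType) (mu : probability X R).

Lemma ae_all (I : countType) (P : I -> X -> Prop) :
  (forall i, {ae mu, forall x, P i x}) -> {ae mu, forall x, forall i, P i x}.
Proof.
move=> aeP.
have : {ae mu, forall x, forall n, if unpickle n is Some i then P i x else True}.
  by apply: ae_foralln => n; case: unpickle => [i|]; [exact: aeP|exact: aeW].
by apply: filterS => x h i; have := h (pickle i); rewrite pickleK.
Qed.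

Lemma ae_and (P Q : X -> Prop) : {ae mu, forall x, P x} ->
  {ae mu, forall x, Q x} -> {ae mu, forall x, P x /\ Q x}.
Proof. by apply: filterS2 => x. Qed.

Lemma ae_conull (P : X -> Prop) : {ae mu, forall x, P x} ->
  exists A, [/\ measurable A, mu (~` A) = 0%E & A `<=` P].
Proof.
move=> [N [mN N0 sN]]; exists (~` N); split; first exact: measurableC.
  by rewrite setCK.
by move=> x Nx; apply: contrapT => Px; apply: Nx; apply: sN.
Qed.

Lemma conull_ae (A : set X) (P : X -> Prop) : measurable A -> mu (~` A) = 0%E ->
  A `<=` P -> {ae mu, forall x, P x}.
Proof.
move=> mA A0 AP; exists (~` A); split => //; first exact: measurableC.
by move=> x Px Ax; apply: Px; exact: AP.
Qed.

Lemma measure0S (A B : set X) : measurable A -> measurable B -> A `<=` B ->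
  mu B = 0%E -> mu A = 0%E.
Proof.
by move=> mA mB AB B0; apply/eqP; rewrite -measure_le0 -B0 le_measure ?inE.
Qed.

Lemma measure0U (A B : set X) : measurable A -> measurable B ->
  mu A = 0%E -> mu B = 0%E -> mu (A `|` B) = 0%E.
Proof.
move=> mA mB A0 B0; apply/negligibleP; first exact: measurableU.
by apply: negligibleU; exact/negligibleP.
Qed.

Lemma measure_bigsetU_le (I : Type) (r : seq I) (F : I -> set X) (c : R) :
  (forall i, measurable (F i)) -> (forall i, (mu (F i) <= c%:E)%E) ->
  (mu (\big[setU/set0]_(i <- r) F i) <= ((size r)%:R * c)%:E)%E.
Proof.
move=> mF Fc; elim: r => [|i r IH]; first by rewrite big_nil measure0 mul0r.
rewrite big_cons; apply: le_trans (measureU2 _ _ _) _ => //.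
  by apply: bigsetU_measurable => j _; exact: mF.
by rewrite /= -natr1 mulrDl mul1r addrC EFinD leeD.
Qed.

Lemma measure0_bigcup (I : countType) (A : I -> set X) :
  (forall i, measurable (A i)) -> (forall i, mu (A i) = 0%E) ->
  mu [set x | exists i, A i x] = 0%E.
Proof.
move=> mA A0.
have mU : measurable [set x | exists i, A i x] by apply: mpred_ex.
apply/negligibleP => //; have : {ae mu, forall x, forall i, ~ A i x}.
  apply: ae_all => i; exists (A i); split => //.
  by move=> x /=; rewrite notK.
apply: negligibleS => x /= [i Ai]; by move/(_ i).
Qed.

Lemma conull1 (A : set X) : measurable A -> mu (~` A) = 0%E -> mu A = 1%E.
Proof.
move=> mA A0; rewrite -[A]setCK probability_setC; last exact: measurableC.
by rewrite A0 sube0.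
Qed.

Lemma nonnull_meets_conull (A B : set X) : measurable A -> measurable B ->
  (0 < mu A)%E -> mu (~` B) = 0%E -> exists x, A x /\ B x.
Proof.
move=> mA mB A0 B0; apply: contrapT => h.
suff : mu A = 0%E by move=> A0'; rewrite A0' ltxx in A0.
apply: (measure0S mA (measurableC mB)) => // x Ax Bx.
by apply: h; exists x.
Qed.

End almost_everywhere.

(* A metric transported to the space itself: balls are measurable and they
   suffice to test measurability of maps into [X]. *)
Section standard_borel_metric.
Context (R : realType) d (X : measurableType d).

Record sbmetric := SBMetric {
  sdist :> X -> X -> R;
  sseq : nat -> X;
  sdist_ge0 : forall x y, 0 <= sdist x y;
  sdistxx : forall x, sdist x x = 0;
  sdist0 : forall x y, sdist x y = 0 -> x = y;
  sdistC : forall x y, sdist x y = sdist y x;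
  sdistD : forall y x z, sdist x z <= sdist x y + sdist y z;
  sdist_dense : forall x e, 0 < e -> exists n, sdist (sseq n) x < e;
  sdist_complete : forall u : nat -> X,
    (forall e, 0 < e -> exists N, forall m n, (N <= m)%N -> (N <= n)%N ->
       sdist (u m) (u n) < e) ->
    exists l, forall e, 0 < e -> exists N, forall n, (N <= n)%N ->
       sdist (u n) l < e;
  sdist_ball : forall x r, measurable [set y | sdist x y < r];
  sdist_measurable_fun : forall d' (W : measurableType d') (F : W -> X),
    (forall n r, mpred (fun w => sdist (sseq n) (F w) < r)) ->
    measurable_fun setT F
}.

Import metricType_numDomainType.

Lemma standard_borelP (x0 : X) : standard_borel R X -> inhabited sbmetric.
Proof.
move=> [P [f [Pc [Q cQ dQ] fbij mE]]].
have finj : injective f by move=> x y fxy; apply: (set_bij_inj fbij); rewrite ?inE.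
have fsurj p : exists x, f x = p.
  by have [x _ <-] := set_bij_surj fbij (I : setT p); exists x.
pose g p := sval (cid (fsurj p)).
have gK p : f (g p) = p by rewrite /g; case: cid.
have fK x : g (f x) = x by apply: finj; rewrite gK.
have Q0 : Q !=set0.
  have [p [_ Qp]] := dQ setT (ex_intro _ (f x0) I) openT.
  by exists p.
have [q0 Qq0] := Q0.
have [q qQ] : exists q : nat -> P, forall p, Q p -> exists n, q n = p.
  have /pfcard_geP[Q00|[h]] := cQ; first by rewrite Q00 in Qq0.
  exists h => p Qp; have [n _ <-] := @surj _ _ _ _ h p Qp.
  by exists n.
have ballm (x : X) r : measurable [set y | mdist (f x) (f y) < r].
  apply/mE; apply: sub_sigma_algebra.
  have -> : f @` [set y | mdist (f x) (f y) < r] = ball (f x) r.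
    rewrite ballEmdist; apply/seteqP; split=> [p [y /= h <-]//|p /= h].
    by exists (g p); rewrite ?gK.
  rewrite openE ballEmdist => p /= xp; rewrite /interior/= -nbhs_nbhs_mdist.
  exists (r - mdist (f x) p) => /=; first by rewrite subr_gt0.
  move=> y /= py; apply: le_lt_trans (metric_triangle _ p _) _.
  by rewrite addrC -ltrBrDr.
have dense (p : P) (e : R) : 0 < e -> exists n, mdist (q n) p < e.
  move=> e0; have [] := dQ (ball p e).
  - by exists p; exact: ballxx.
  - rewrite openE ballEmdist => y /= xy; rewrite /interior/= -nbhs_nbhs_mdist.
    exists (e - mdist p y) => /=; first by rewrite subr_gt0.
    move=> z /= yz; apply: le_lt_trans (metric_triangle _ y _) _.
    by rewrite addrC -ltrBrDr.
  move=> y; rewrite ballEmdist /= => -[py /qQ[n qny]].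
  by exists n; rewrite qny metric_sym.
split; apply: (@SBMetric (fun x y => mdist (f x) (f y)) (g \o q)).
- by move=> x y; exact: mdist_ge0.
- by move=> x; exact: mdistxx.
- by move=> x y /mdist_positivity /finj.
- by move=> x y; exact: metric_sym.
- by move=> x y z; exact: metric_triangle.
- by move=> x e /(dense (f x))[n qx]; exists n; rewrite /= gK.
- move=> u cu; have [] := Pc (f \o u).
    apply/cauchy_ballP => e e0; have [N hN] := cu e e0.
    pose S := [set p | exists2 n, (N <= n)%N & p = f (u n)].
    exists (S, S); first by split; exists N => // n Nn; exists n.
    by move=> [? ?] [/= [m Nm ->] [n Nn ->]]; rewrite ballEmdist /=; exact: hN.
  move=> l /cvgrPdist_lt ul; exists (g l) => e e0.
  have [N _ hN] := ul e e0; exists N => n Nn.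
  by rewrite gK metric_sym; exact: hN.
- by move=> x r; exact: ballm.
move=> d' W F mF; apply: measurable_funTP => A /mE mA.
(* The sets with measurable preimage form a sigma-algebra, so open sets suffice. *)
pose S := [set B : set P | mpred (fun w => B (f (F w)))].
suff : <<s open >> `<=` S.
  move=> /(_ _ mA); apply: mpred_ext => w.
  by split=> [[y Ay /finj <-]//|AF]; exists (F w).
apply: smallest_sub.
  split; first exact: mpred_cst.
  - move=> B SB; apply: (mpred_ext _ (mpred_not SB)) => w.
    by split=> [nB|[_ nB]]//; split.
  - move=> B SB; apply: (mpred_ext _ (mpred_ex SB)) => w.
    by split=> [[n Bn]|[n _ Bn]]; [exists n|exists n].
move=> B oB.
(* An open set is the union of the countably many balls, centred on the dense sequence and of radius
   1/(k+1), that it contains. *)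
apply: (mpred_ext (P := fun w => exists nk : nat * nat,
  (ball (q nk.1) (nk.2.+1%:R^-1 : R) `<=` B) /\
  mdist (f (g (q nk.1))) (f (F w)) < nk.2.+1%:R^-1)); last first.
  apply: mpred_ex => -[n k]; apply: mpred_and; first exact: mpred_cst.
  exact: mF.
move=> w; split=> [[[n k] /= [+]]|].
  by rewrite gK ballEmdist => + h; apply.
move: oB; rewrite openE => /[apply]; rewrite /interior/= -nbhs_nbhs_mdist => -[e /= e0 eB].
have [k ke] : exists k, k.+1%:R^-1 < e / 2.
  have e20 : 0 < e / 2 by rewrite divr_gt0.
  have [k _ hk] := near_infty_natSinv_lt (PosNum e20).
  by exists k; exact: (hk k (leqnn k)).
have [n hn] := dense (f (F w)) (k.+1%:R^-1) ltac:(by rewrite invr_gt0).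
exists (n, k) => /=; rewrite gK; split=> // p; rewrite ballEmdist /= => np.
apply: eB => /=; apply: le_lt_trans (metric_triangle _ (q n) _) _.
rewrite [e]splitr ltrD//; last exact: lt_trans ke.
by rewrite metric_sym; exact: lt_trans ke.
Qed.
End standard_borel_metric.

(** * Standard Borel spaces and null Cantor sets *)

Lemma ex_natinv_lt (R : realType) (e : R) : 0 < e -> exists k : nat, k.+1%:R^-1 < e.
Proof.
move=> e0; have [k _ hk] := near_infty_natSinv_lt (PosNum e0).
by exists k; exact: (hk k (leqnn k)).
Qed.

Lemma ex_geo_lt (R : realType) (e : R) : 0 < e -> exists k : nat, 2^-1 ^+ k < e.
Proof.
move=> /ex_natinv_lt[k ke]; exists k; apply: le_lt_trans ke.
rewrite exprVn lef_pV2 ?posrE ?exprn_gt0// -natrX ler_nat.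
exact: ltn_expl.
Qed.

Lemma geo_anti (R : realType) (m n : nat) : (m <= n)%N -> 2^-1 ^+ n <= 2^-1 ^+ m :> R.
Proof. by move=> mn; apply: ler_wiXn2l => //; lra. Qed.

Section sbmetric_theory.
Context (R : realType) d (X : measurableType d) (rho : sbmetric R X).

(** Two points coincide as soon as every small ball around a point of the dense sequence that
    contains the first contains the second; this replaces measurability of the diagonal. *)
Lemma mpred_eq d' (W : measurableType d') (F G : W -> X) :
  measurable_fun setT F -> measurable_fun setT G -> mpred (fun w => F w = G w).
Proof.
move=> mF mG.
apply: (mpred_ext (P := fun w => forall nk : nat * nat,
   rho (sseq rho nk.1) (F w) < nk.2.+1%:R^-1 ->
   rho (sseq rho nk.1) (G w) < nk.2.+1%:R^-1)); last first.
  apply: mpred_all => -[n k]; apply: mpred_imp.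
    exact: (mpred_preimage mF (sdist_ball _ _ _)).
  exact: (mpred_preimage mG (sdist_ball _ _ _)).
move=> w; split=> [h|-> //].
apply: (@sdist0 _ _ _ rho); apply: contrapT => /eqP ne0.
have e0 : 0 < rho (F w) (G w) / 2.
  by rewrite divr_gt0// lt_neqAle eq_sym ne0 sdist_ge0.
have [k ke] := ex_natinv_lt e0.
have k0 : (0 : R) < k.+1%:R^-1 by rewrite invr_gt0.
have [n hn] := sdist_dense rho (F w) k0.
have := h (n, k) hn => /= hG.
have := sdistD rho (sseq rho n) (F w) (G w).
rewrite (sdistC rho (F w) (sseq rho n)).
move: (_^-1) ke hn hG k0 => t; lra.
Qed.

Lemma measurable_sing (x : X) : measurable [set x].
Proof.
apply: (@mpred_eq _ _ id (cst x)); last exact: measurable_cst.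
exact: measurable_id.
Qed.

Definition sconv (u : nat -> X) (l : X) := forall e, 0 < e ->
  exists N, forall n, (N <= n)%N -> rho (u n) l < e.

Lemma sconv_uniq u l l' : sconv u l -> sconv u l' -> l = l'.
Proof.
move=> ul ul'; apply: (@sdist0 _ _ _ rho); apply: contrapT => /eqP ne0.
have e0 : 0 < rho l l' / 2 by rewrite divr_gt0// lt_neqAle eq_sym ne0 sdist_ge0.
have [N hN] := ul _ e0; have [N' hN'] := ul' _ e0.
have := hN _ (leq_maxl N N'); have := hN' _ (leq_maxr N N').
have := sdistD rho (u (maxn N N')) l l'; rewrite (sdistC rho l (u _)).
lra.
Qed.

Lemma geo_sconv (u : nat -> X) : (forall k, rho (u k) (u k.+1) <= 2 * 2^-1 ^+ k) ->
  exists l, sconv u l.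
Proof.
move=> hu; apply: (sdist_complete (s := rho)) => e e0.
(* The geometric tail in telescoped form, so that the induction on [p] is exact. *)
have hd m p : rho (u m) (u (m + p)%N) <= 4 * 2^-1 ^+ m - 4 * 2^-1 ^+ (m + p).
  elim: p => [|p IH]; first by rewrite addn0 sdistxx; lra.
  rewrite addnS; apply: le_trans (sdistD rho (u (m + p)%N) _ _) _.
  by have := hu (m + p)%N; move: IH; rewrite exprS; lra.
have e4 : 0 < e / 4 by rewrite divr_gt0.
have [N hN] := ex_geo_lt e4; exists N.
have hle m n : (N <= m)%N -> (m <= n)%N -> rho (u m) (u n) < e.
  move=> Nm mn; have := hd m (n - m)%N; rewrite subnKC//.
  have : 0 < 2^-1 ^+ n :> R by rewrite exprn_gt0.
  have := geo_anti R Nm; lra.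
move=> m n Nm Nn; have [mn|nm] := leqP m n; first exact: hle.
by rewrite sdistC; exact: hle (ltnW nm).
Qed.

(** A strict inequality passes to the limit only with a margin, whence the term [1/(j+1)] in the
    test of a ball. *)
Lemma measurable_sconv d' (W : measurableType d') (z : nat -> W -> X) (K : W -> X) :
  (forall k, measurable_fun setT (z k)) -> (forall w, sconv (z ^~ w) (K w)) ->
  measurable_fun setT K.
Proof.
move=> mz zK; apply: (sdist_measurable_fun (s := rho)) => i r.
apply: (mpred_ext (P := fun w => exists jN : nat * nat, forall k,
  (jN.2 <= k)%N -> rho (sseq rho i) (z k w) < r - jN.1.+1%:R^-1)); last first.
  apply: mpred_ex => -[j N]; apply: mpred_all => k.
  apply: mpred_imp; first exact: mpred_cst.
  exact: (mpred_preimage (mz k) (sdist_ball _ _ _)).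
move=> w; split=> [[[j N]/= h]|h].
  have j0 : (0 : R) < j.+1%:R^-1 by rewrite invr_gt0.
  have [N' hN'] := zK w _ j0.
  have := hN' _ (leq_maxr N N'); have := h _ (leq_maxl N N').
  have := sdistD rho (z (maxn N N') w) (sseq rho i) (K w).
  move: (_^-1) => t; lra.
have e0 : 0 < (r - rho (sseq rho i) (K w)) / 2 by rewrite divr_gt0// subr_gt0.
have [j hj] := ex_natinv_lt e0; have [N hN] := zK w _ e0.
exists (j, N) => k /hN; rewrite /= (sdistC rho (z k w)).
have := sdistD rho (K w) (sseq rho i) (z k w).
by move: (j.+1%:R^-1) hj => t; lra.
Qed.

End sbmetric_theory.

(** [xget] chooses arbitrarily; uniqueness of the witness makes the choice canonical and thus
    measurable. The value [i0] also collects the points without witness. *)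
Lemma mdisc_xget d (X : measurableType d) (I : countType) (i0 : I)
    (P : I -> X -> Prop) : (forall i, mpred (P i)) ->
  (forall x i j, P i x -> P j x -> i = j) ->
  mdisc (fun x => xget i0 [set i | P i x]).
Proof.
move=> mP uP i.
apply: (mpred_ext (P := fun x => P i x \/ i = i0 /\ forall j, ~ P j x)).
  move=> x; split=> [[Pi|[-> nP]]|<-].
  - by case: xgetP => [j _ Pj|/(_ i)//]; exact: uP Pj Pi.
  - by case: xgetP => // j _ /nP.
  - by case: xgetP => [j -> Pj|nP]; [left|right].
apply: mpred_or => //; apply: mpred_and; first exact: mpred_cst.
by apply: mpred_all => j; exact: mpred_not.
Qed.

(** * Coding points by binary sequences *)

Section coding.
Context (R : realType) d (X : measurableType d) (rho : sbmetric R X).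

Definition code (x : X) (j : nat) : bool :=
  if unpickle j is Some ik then
    `[< rho (sseq rho (ik : nat * nat).1) x < 2^-1 ^+ ik.2 >] else false.

Definition is_first (s : nat -> bool) (k i : nat) :=
  s (pickle (i, k)) /\ forall i', (i' < i)%N -> ~ s (pickle (i', k)).

Definition first k (s : nat -> bool) : nat := xget 0%N [set i | is_first s k i].

(** Decoding has to make sense for every bit sequence, not only for codes: a move is accepted only
    if it is short, so the centres always form a Cauchy sequence. *)
Fixpoint pindex (s : nat -> bool) k : nat :=
  if k is k'.+1 then
    let i := first k s in let j := pindex s k' in
    if rho (sseq rho j) (sseq rho i) < 2 * 2^-1 ^+ k' then i else j
  else first 0 s.

Lemma pindex_conv s : exists l, sconv rho (fun k => sseq rho (pindex s k)) l.
Proof.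
apply: geo_sconv => k /=; case: ifPn => [/ltW//|_].
by rewrite sdistxx mulr_ge0// exprn_ge0.
Qed.

Definition decode s : X := sval (cid (pindex_conv s)).

Lemma decode_conv s : sconv rho (fun k => sseq rho (pindex s k)) (decode s).
Proof. by rewrite /decode; case: cid. Qed.

Lemma is_first_uniq s k i j : is_first s k i -> is_first s k j -> i = j.
Proof.
move=> [si hi] [sj hj]; by case: (ltngtP i j) => // [/hj/(_ si)|/hi/(_ sj)].
Qed.

Lemma first_code k x : rho (sseq rho (first k (code x))) x < 2^-1 ^+ k.
Proof.
have ex : exists i : nat, code x (pickle (i, k)).
  have k0 : 0 < 2^-1 ^+ k :> R by rewrite exprn_gt0.
  have [i hi] := sdist_dense rho x k0; exists i.
  by rewrite /code pickleK; apply/asboolP.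
have : is_first (code x) k (ex_minn ex).
  case: ex_minnP => i si hi; split=> // i' ii' /hi; rewrite leqNgt ii'.
  by [].
rewrite /first; case: xgetP => [i _ [+ _] _|h /h//].
by rewrite /code pickleK => /asboolP.
Qed.

Lemma codeK x : decode (code x) = x.
Proof.
apply: (sconv_uniq (decode_conv _)).
(* On a genuine code every move is accepted: consecutive centres are at distance below
   [2^-k + 2^-(k+1)], less than the allowed [2 * 2^-k]. *)
have pE k : pindex (code x) k = first k (code x).
  elim: k => // k IH /=; rewrite IH ifT//.
  apply: le_lt_trans (sdistD rho x _ _) _.
  have := first_code k x; have := first_code k.+1 x.
  have : 0 < 2^-1 ^+ k :> R by rewrite exprn_gt0.
  rewrite exprS (sdistC rho x (sseq rho (first k.+1 (code x)))); lra.
move=> e /ex_geo_lt[N hN]; exists N => n Nn; rewrite pE.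
apply: lt_trans (first_code n x) _.
by apply: le_lt_trans hN; exact: geo_anti.
Qed.

Lemma mpred_code j : mpred (fun x => code x j).
Proof.
rewrite /code; case: unpickle => [[i k]|]; last exact: mpred_cst.
apply: (mpred_ext _ (sdist_ball rho (sseq rho i) (2^-1 ^+ k))) => x /=.
by split=> /asboolP.
Qed.

Lemma measurable_decode d' (W : measurableType d') (s : W -> nat -> bool) :
  (forall j, mpred (fun w => s w j)) -> measurable_fun setT (fun w => decode (s w)).
Proof.
move=> ms.
have mfirst k : mdisc (fun w => first k (s w)).
  apply: mdisc_xget => [i|w i j]; last exact: is_first_uniq.
  apply: mpred_and => //; apply: mpred_all => i'.
  by apply: mpred_imp; [exact: mpred_cst|exact: mpred_not].
have mpi k : mdisc (fun w => pindex (s w) k).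
  elim: k => [|k IH]; first exact: mfirst.
  rewrite /=; apply: (mdisc_ex (F := fun i w => let j := pindex (s w) k in
    if rho (sseq rho j) (sseq rho i) < 2 * 2^-1 ^+ k then i else j)) => // i.
  by apply: (@mdisc_comp _ _ _ _ _ (fun j =>
    if rho (sseq rho j) (sseq rho i) < 2 * 2^-1 ^+ k then i else j)).
apply: (measurable_sconv (rho := rho) (z := fun k w => sseq rho (pindex (s w) k))).
  by move=> k; exact: measurable_fun_discE.
by move=> w; exact: decode_conv.
Qed.

End coding.

(** * A null Cantor set in an atomless space *)

Section cantor_scheme.
Context (R : realType) d (Y : measurableType d) (rho : sbmetric R Y).
Context (nu : probability Y R).
Hypothesis nu_atomless : forall y, nu [set y] = 0%E.

Definition supp y := forall r, 0 < r -> (0 < nu [set z | rho y z < r]%R)%E.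

(** The points outside the support are covered by the countably many null balls around the dense
    sequence. *)
Lemma supp_meets (A : set Y) : measurable A -> (0 < nu A)%E -> exists2 y, A y & supp y.
Proof.
move=> mA A0; apply: contrapT; move=> h.
pose B (nk : nat * nat) := if pselect
    (nu [set z | rho (sseq rho nk.1) z < nk.2.+1%:R^-1]%R = 0%E) then
    [set z | rho (sseq rho nk.1) z < nk.2.+1%:R^-1] else set0.
have mB nk : measurable (B nk).
  by rewrite /B; case: pselect => hp; [exact: sdist_ball|exact: measurable0].
have B0 nk : nu (B nk) = 0%E by rewrite /B; case: pselect => hp; rewrite ?measure0.
suff : nu A = 0%E by move=> E; rewrite E ltxx in A0.
have mU : measurable [set y | exists i, B i y] by exact: mpred_ex.
apply: (measure0S mA mU _ (measure0_bigcup mB B0)).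
move=> y Ay /=; apply: contrapT => nB; apply: h; exists y => // r r0.
rewrite lt_neqAle measure_ge0 andbT eq_sym; apply/eqP => r0'; apply: nB.
have r20 : 0 < r / 2 by rewrite divr_gt0.
have [k hk] := ex_natinv_lt r20.
have k0 : (0 : R) < k.+1%:R^-1 by rewrite invr_gt0.
have [n hn] := sdist_dense rho y k0; exists (n, k).
rewrite /B; case: pselect => //= hne; exfalso; apply: hne.
apply: (measure0S _ _ _ r0'); [exact: sdist_ball|exact: sdist_ball|].
move=> z /= hz; have := sdistD rho (sseq rho n) y z; rewrite (sdistC rho y (sseq rho n)).
by move: (k.+1%:R^-1) hk hn hz {k0} => t; lra.
Qed.

Definition cball c r := [set y | rho c y <= r].

Lemma measurable_cball c r : measurable (cball c r).
Proof.
apply: (mpred_ext (P := fun y => forall k : nat, rho c y < r + k.+1%:R^-1)); last first.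
  by apply: mpred_all => k; exact: sdist_ball.
move=> y; split=> [h|/= h k]; last first.
  by apply: le_lt_trans h _; rewrite ltrDl invr_gt0.
apply/ler_addgt0Pr => e /ex_natinv_lt[k ke].
by apply/ltW; apply: lt_trans (h k) _; rewrite ltrD2l.
Qed.

(** Continuity from above along closed balls shrinking to the null set [{c}]. *)
Lemma small_cball c (e : R) : 0 < e ->
  exists2 r, 0 < r & forall r', r' <= r -> (nu (cball c r') <= e%:E)%E.
Proof.
move=> e0; pose F n := cball c (n.+1%:R^-1).
have mF n : measurable (F n) by exact: measurable_cball.
have : nu \o F @ \oo --> nu (\bigcap_n F n).
  apply: nonincreasing_cvg_mu => //.
  - by rewrite (le_lt_trans (probability_le1 _ _))// ltry.
  - exact: bigcapT_measurable.
  - move=> m n mn; apply/subsetPset => y /= h; apply: le_trans h _.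
    by rewrite lef_pV2 ?posrE// ler_nat.
have -> : \bigcap_n F n = [set c].
  apply/seteqP; split=> [y hy|_ -> n _]/=; last first.
    by rewrite /F /cball /= sdistxx invr_ge0.
  apply/esym/(@sdist0 _ _ _ rho); apply/eqP; rewrite eq_le sdist_ge0 andbT.
  apply/ler_addgt0Pr => r /ex_natinv_lt[k ke]; rewrite add0r.
  by apply/ltW; apply: le_lt_trans ke; exact: (hy k I).
rewrite nu_atomless => /fine_cvgP[_ /cvgrPdist_lt /(_ e e0)[n _ hn]].
exists (n.+1%:R^-1); first by rewrite invr_gt0.
move=> r' hr'; have := hn n (leqnn n); rewrite /= sub0r normrN => hlt.
have fin : nu (F n) \is a fin_num by rewrite fin_num_measure.
apply: (@le_trans _ _ (nu (F n))).
  apply: le_measure; rewrite ?inE//; first exact: measurable_cball.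
  by move=> y /= h; exact: le_trans h hr'.
rewrite -(fineK fin) lee_fin; apply: le_trans (ltW hlt).
exact: ler_norm.
Qed.

(** The ball [p] is split in two: one child keeps the centre [p.1], the other is centred at [q.1],
    both with radius [q.2]. They lie in [p] and are disjoint. The bound [4^-n] is set against the
    2^n balls of level n, whose union then has measure at most 2^-n. *)
Definition splits n (p : Y * R) (q : Y * R) :=
  [/\ supp q.1, 0 < q.2, q.2 <= p.2 / 2, rho p.1 q.1 + q.2 <= p.2 &
   [/\ 2 * q.2 < rho p.1 q.1, (nu (cball p.1 q.2) <= (4^-1 ^+ n)%:E)%E &
       (nu (cball q.1 q.2) <= (4^-1 ^+ n)%:E)%E]].

Lemma splits_ex n (p : Y * R) : supp p.1 -> 0 < p.2 -> exists q, splits n p q.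
Proof.
move: p => [c r] /= sc r0.
have r20 : 0 < r / 2 by rewrite divr_gt0.
(* As the centre [c] is in the support but not an atom, the half ball without [c] still has positive
   measure and contains another point of the support. *)
have [] := @supp_meets ([set y | rho c y < r / 2] `&` [set y | y <> c]).
- apply: measurableI; first exact: sdist_ball.
  by apply: measurableC; exact: (measurable_sing rho).
- rewrite lt_neqAle measure_ge0 andbT eq_sym; apply/eqP => E0.
  suff E : nu [set z | rho c z < r / 2] = 0%E by have := sc _ r20; rewrite E ltxx.
  rewrite -(setUIDK [set z | rho c z < r / 2] [set c]).
  have m1 : measurable ([set z | rho c z < r / 2] `&` [set c]).
    by apply: measurableI; [exact: sdist_ball|exact: (measurable_sing rho)].
  have m2 : measurable ([set z | rho c z < r / 2] `\` [set c]).
    by apply: measurableD; [exact: sdist_ball|exact: (measurable_sing rho)].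
  apply: measure0U => //.
  apply: (measure0S m1 (measurable_sing rho c) _ (nu_atomless c)) => y [].
  by [].
move=> c1 [/= hc1 c1c] sc1.
have e0 : 0 < 4^-1 ^+ n :> R by rewrite exprn_gt0.
have [r1 r10 h1] := small_cball c e0; have [r2 r20' h2] := small_cball c1 e0.
have d0 : 0 < rho c c1.
  rewrite lt_neqAle sdist_ge0 andbT eq_sym; apply/eqP => h; apply: c1c.
  exact/esym/(@sdist0 _ _ _ rho).
(* One third of the distance of the centres separates the children; half of [r] keeps the new one
   inside, its centre being within [r / 2] of [c]. *)
pose r' := Num.min (Num.min r1 r2) (Num.min (rho c c1 / 3) (r / 2)).
have : 0 < r' by rewrite !lt_min r10 r20' r20 divr_gt0.
have := lexx r'; rewrite {2}/r' !le_min -!andbA => /and4P[rr1 rr2 rd rr] r'0.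
exists (c1, r'); split=> //=; first by lra.
split; [lra|exact: h1|exact: h2].
Qed.

Lemma splits_fun : exists child : nat -> Y * R -> Y * R,
  forall n p, supp p.1 -> 0 < p.2 -> splits n p (child n p).
Proof.
have /choice[f hf] : forall np : nat * (Y * R), exists q,
    supp np.2.1 -> 0 < np.2.2 -> splits np.1 np.2 q.
  move=> [n p] /=; have [[sp p0]|h] := pselect (supp p.1 /\ 0 < p.2).
    by have [q hq] := splits_ex n sp p0; exists q.
  by exists p => sp p0; exfalso; apply: h.
by exists (fun n p => f (n, p)) => n p; exact: (hf (n, p)).
Qed.

Definition child := sval (cid splits_fun).

Lemma child_splits n p : supp p.1 -> 0 < p.2 -> splits n p (child n p).
Proof. by rewrite /child; case: cid => f; apply. Qed.

Lemma supp_ex : exists y, supp y.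
Proof.
have [] := @supp_meets setT; first exact: measurableT.
  by rewrite probability_setT lte01.
by move=> y _ sy; exists y.
Qed.

(** The path is stored with its last turn first, so that [b :: s] is a child of [s]. The bit [false]
    keeps the centre of the parent. *)
Fixpoint node (s : seq bool) : Y * R :=
  if s is b :: s' then
    let p := node s' in let q := child (size s) p in
    ((if b then q.1 else p.1), q.2)
  else (sval (cid supp_ex), 1).

Lemma nodeE b s : node (b :: s) =
  (if b then (child (size s).+1 (node s)).1 else (node s).1,
   (child (size s).+1 (node s)).2).
Proof. by []. Qed.

Lemma node_supp s : supp (node s).1 /\ 0 < (node s).2.
Proof.
elim: s => [|b s [sp p0]] /=; first by split=> //; case: cid.
have [sq q0 _ _ _] := child_splits (size s).+1 sp p0.
by split=> //; case: b.
Qed.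

Lemma node_cons b s : let p := node s in let q := node (b :: s) in
  [/\ q.2 <= p.2 / 2, rho p.1 q.1 + q.2 <= p.2 &
      (nu (cball q.1 q.2) <= (4^-1 ^+ (size s).+1)%:E)%E].
Proof.
have [sp p0] := node_supp s.
have [sq q0 qp dq [_ n1 n2]] := child_splits (size s).+1 sp p0.
split; [exact: qp| |by case: b].
case: b; rewrite nodeE; first exact: dq.
by rewrite /= sdistxx add0r; lra.
Qed.

Lemma node_small s : (node s).2 <= 2^-1 ^+ size s.
Proof.
elim: s => // b s IH; have [h _ _] := node_cons b s.
by apply: le_trans h _; rewrite /= exprS; lra.
Qed.

Lemma cballS b s : cball (node (b :: s)).1 (node (b :: s)).2 `<=`
  cball (node s).1 (node s).2.
Proof.
move=> y; rewrite /cball/= -/(node (b :: s)); have [_ h _] := node_cons b s.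
by move: h; have := sdistD rho (node (b :: s)).1 (node s).1 y; lra.
Qed.

Definition in_node s y := cball (node s).1 (node s).2 y.

(** Balls are nested, so the parents agree by induction; siblings are disjoint since their centres
    are more than two radii apart. *)
Lemma in_node_inj y s t : size s = size t -> in_node s y -> in_node t y -> s = t.
Proof.
elim: s t => [|b s IH] [|c t]//= [st] sy ty.
have {IH} := IH t st (cballS sy) (cballS ty) => E; rewrite -{}E {t st} in ty *.
case: b c sy ty => -[]//; rewrite /in_node /cball /=; have [sp p0] := node_supp s;
  have [_ _ _ _ [h _ _]] := child_splits (size s).+1 sp p0 => h1 h2; exfalso;
  move: h; apply/negP; rewrite -leNgt.
  by have := sdistD rho y (node s).1 (child (size s).+1 (node s)).1;
    rewrite (sdistC rho y); lra.
by have := sdistD rho y (node s).1 (child (size s).+1 (node s)).1;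
  rewrite (sdistC rho y); lra.
Qed.

Fixpoint prefix (a : nat -> bool) n := if n is m.+1 then a m :: prefix a m else [::].

Lemma size_prefix a n : size (prefix a n) = n.
Proof. by elim: n => //= n ->. Qed.

Lemma branch_conv a : exists l, sconv rho (fun n => (node (prefix a n)).1) l.
Proof.
apply: geo_sconv => k.
have [_ h _] := node_cons (a k) (prefix a k).
have := node_small (prefix a k); rewrite size_prefix.
have [_] := node_supp (prefix a k.+1).
have : 0 < 2^-1 ^+ k :> R by rewrite exprn_gt0.
move: h => /=; lra.
Qed.

Definition branch a : Y := sval (cid (branch_conv a)).

Lemma branchP a : sconv rho (fun n => (node (prefix a n)).1) (branch a).
Proof. by rewrite /branch; case: cid. Qed.

(** Nested closed balls: the centres from level n on stay in the ball of level n, and so does their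
    limit. *)
Lemma branch_in a n : in_node (prefix a n) (branch a).
Proof.
have hsub m : cball (node (prefix a (n + m))).1 (node (prefix a (n + m))).2
    `<=` cball (node (prefix a n)).1 (node (prefix a n)).2.
  elim: m => [|m IH]; first by rewrite addn0.
  by rewrite addnS; apply: subset_trans IH; exact: cballS.
apply/ler_addgt0Pr => e e0; have [N hN] := branchP a e0.
have hc : cball (node (prefix a n)).1 (node (prefix a n)).2
    (node (prefix a (n + N))).1.
  by apply: (hsub N); rewrite /cball/= sdistxx ltW//; have [] := node_supp (prefix a (n + N)).
have := hN (n + N)%N (leq_addl _ _); move: hc; rewrite /cball/=.
have := sdistD rho (node (prefix a (n + N))).1 (node (prefix a n)).1 (branch a).
lra.
Qed.

(** Reads a branch back from its endpoint. It is defined on all of [Y] by membership in countably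
    many closed balls, hence is measurable. *)
Definition bit y n := `[< exists s, size s = n /\ in_node (true :: s) y >].

Lemma mpred_in_node s : mpred (in_node s).
Proof. exact: measurable_cball. Qed.

Lemma mpred_bit n : mpred (fun y => bit y n).
Proof.
apply: (mpred_ext (P := fun y => exists s, size s = n /\ in_node (true :: s) y)).
  by move=> y; split=> /asboolP.
apply: mpred_ex => s; apply: mpred_and; first exact: mpred_cst.
exact: mpred_in_node.
Qed.

Lemma bit_branch a n : bit (branch a) n = a n.
Proof.
apply/asboolP/idP => [[s [sn hs]]|an].
  have st : size (true :: s) = size (prefix a n.+1) by rewrite size_prefix /= sn.
  by have [<-] := in_node_inj st hs (branch_in a n.+1).
exists (prefix a n); split; first exact: size_prefix.
by have := branch_in a n.+1; rewrite /= an.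
Qed.

Lemma measurable_branch d' (W : measurableType d') (a : W -> nat -> bool) :
  (forall n, mpred (fun w => a w n)) -> measurable_fun setT (fun w => branch (a w)).
Proof.
move=> ma.
have mp n : mdisc (fun w => prefix (a w) n).
  elim: n => [|n IH] /=; first exact: mdisc_cst.
  apply: (mdisc_ex (F := fun s w => a w n :: s)) => // s.
  apply: (@mdisc_comp _ _ _ _ _ (fun b => b :: s)) => -[]; first exact: ma.
  apply: (mpred_ext _ (mpred_not (ma n))) => w.
  by split=> [/negP/negbTE|->].
apply: (measurable_sconv (rho := rho)
  (z := fun n w => (node (prefix (a w) n)).1)) => [n|w].
  exact: (@measurable_fun_discE _ _ _ _ _ _ (fun s => (node s).1)).
exact: branchP.
Qed.

Definition cantor_set := [set y | forall n, exists s, size s = n /\ in_node s y].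

Lemma measurable_cantor_set : measurable cantor_set.
Proof.
apply: mpred_all => n; apply: mpred_ex => s.
by apply: mpred_and; [exact: mpred_cst|exact: mpred_in_node].
Qed.

Lemma node_measure s : (nu (in_node s) <= (4^-1 ^+ size s)%:E)%E.
Proof.
case: s => [|b s]; last by have [] := node_cons b s.
by rewrite expr0; apply: probability_le1; exact: mpred_in_node.
Qed.

Lemma cantor_set0 : nu cantor_set = 0%E.
Proof.
apply/eqP; rewrite -measure_le0; apply/lee_addgt0Pr => e /ex_geo_lt[n ne].
rewrite add0e.
pose F (s : n.-tuple bool) := in_node s.
apply: (@le_trans _ _ (nu (\big[setU/set0]_(s : n.-tuple bool) F s))).
  apply: le_measure; rewrite ?inE.
  - exact: measurable_cantor_set.
  - by apply: bigsetU_measurable => s _; exact: mpred_in_node.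
  - move=> y /(_ n)[s [sn hs]]; rewrite -bigcup_seq.
    exists (Tuple (introT eqP sn)) => //=.
    by rewrite mem_index_enum.
apply: le_trans (measure_bigsetU_le _ (c := 4^-1 ^+ n) _ _) _.
- by move=> t; exact: mpred_in_node.
- by move=> t; apply: le_trans (node_measure t) _; rewrite size_tuple.
rewrite lee_fin; apply: le_trans (ltW ne).
rewrite /index_enum -enumT -cardT card_tuple card_bool natrX -exprMn.
by rewrite (_ : 2 * 4^-1 = 2^-1) //; lra.
Qed.

End cantor_scheme.

(* The codes of the points of X, spread over a null Cantor set of Y. *)
Lemma null_embedding (R : realType) dX dY (X : measurableType dX)
    (Y : measurableType dY) (nu : probability Y R) (x0 : X) (y0 : Y) :
  standard_borel R X -> standard_borel R Y ->
  (forall y, nu [set y] = 0%E) ->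
  exists (J : X -> Y) (K : Y -> X) (Z : set Y),
    [/\ measurable_fun setT J, measurable_fun setT K, cancel J K,
        measurable Z & nu Z = 0%E /\ forall x, Z (J x)].
Proof.
move=> /(standard_borelP x0)[rX] /(standard_borelP y0)[rY] nu0.
exists (fun x => branch rY nu0 (code rX x)), (fun y => decode rX (bit rY nu0 y)).
exists (cantor_set rY nu0); split.
- by apply: measurable_branch => n; exact: mpred_code.
- by apply: measurable_decode => n; exact: mpred_bit.
- move=> x; rewrite -[RHS](codeK rX); congr decode.
  by apply/funext => n; exact: bit_branch.
- exact: measurable_cantor_set.
split; first exact: cantor_set0.
move=> x n; exists (prefix (code rX x) n); split; first exact: size_prefix.
exact: branch_in.
Qed.

(** * Boxes in the integer lattice *)

Section boxes.
Context (d : nat).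
Local Notation G := 'cV[int]_d.

Definition norm1 (v : G) : nat := (\sum_i `|v i 0%R|)%N.

Definition cube (N : nat) : seq G :=
  [seq (\col_i ((f i : nat)%:Z - N%:Z)) | f : {ffun 'I_d -> 'I_(N.*2.+1)}].

(** With radius [2^k - 1], box 0 is the single point 0, sums of two elements of box k lie in box
    k+1, and the size grows by a factor of at most 3^d. *)
Definition box k : seq G := cube (2 ^ k).-1.

Lemma size_cube N : size (cube N) = ((N.*2.+1) ^ d)%N.
Proof. by rewrite size_map -cardT card_ffun !card_ord. Qed.

Lemma cube_uniq N : uniq (cube N).
Proof.
rewrite map_inj_uniq ?enum_uniq// => f g /matrixP fg; apply/ffunP => i.
by have := fg i 0; rewrite !mxE => /addIr [] /val_inj.
Qed.

Lemma mem_cube N (u : G) : (u \in cube N) = [forall i, (`|u i 0%R| <= N)%N].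
Proof.
apply/mapP/forallP => [[f _ ->] i|h].
  by rewrite mxE; case: (f i) => m /=; rewrite -mul2n; lia.
exists [ffun i => inord `|(u i 0 + N%:Z)%R|%N]; first by rewrite mem_enum.
apply/matrixP => i j; rewrite !mxE ffunE (ord1 j) inordK.
  have := h i; move: (u i _) => z; lia.
by have := h i; rewrite -mul2n; lia.
Qed.

Lemma box_uniq k : uniq (box k).
Proof. exact: cube_uniq. Qed.

Lemma mem_box k (u : G) : (u \in box k) = [forall i, (`|u i 0%R| < 2 ^ k)%N].
Proof.
rewrite mem_cube; apply: eq_forallb => i.
have : (0 < 2 ^ k)%N by rewrite expn_gt0.
by case: (2 ^ k)%N.
Qed.

Lemma mem_boxP k (u : G) : reflect (forall i, (`|u i 0%R| < 2 ^ k)%N) (u \in box k).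
Proof. by rewrite mem_box; exact: forallP. Qed.

Lemma boxS k k' : (k <= k')%N -> {subset box k <= box k'}.
Proof.
move=> kk' u /mem_boxP hu; apply/mem_boxP => i.
by apply: leq_trans (hu i) _; rewrite leq_exp2l.
Qed.

Lemma boxD k (u v : G) : u \in box k -> v \in box k -> u + v \in box k.+1.
Proof.
move=> /mem_boxP hu /mem_boxP hv; apply/mem_boxP => i; rewrite mxE expnS.
by have := hu i; have := hv i; move: (u i _) (v i _) => a b; lia.
Qed.

Lemma boxN k (u : G) : u \in box k -> - u \in box k.
Proof. by move=> /mem_boxP hu; apply/mem_boxP => i; rewrite mxE abszN. Qed.

Lemma box0_eq0 (u : G) : u \in box 0 -> u = 0.
Proof.
move=> /mem_boxP hu; apply/matrixP => i j; rewrite (ord1 j) mxE.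
by apply/eqP; have := hu i; rewrite expn0 ltnS leqn0 absz_eq0.
Qed.

Lemma mem0_box k : (0 : G) \in box k.
Proof. by apply/mem_boxP => i; rewrite mxE absz0 expn_gt0. Qed.

Lemma size_box_gt0 k : (0 < size (box k))%N.
Proof. by rewrite size_cube expn_gt0. Qed.

Lemma size_boxS k : (size (box k.+1) <= 3 ^ d * size (box k))%N.
Proof.
rewrite !size_cube -expnMn.
have [->|d0] := posnP d; first by rewrite !expn0.
rewrite leq_exp2r// expnS; have : (0 < 2 ^ k)%N by rewrite expn_gt0.
lia.
Qed.

Lemma norm1_box k (u : G) : u \in box k -> (norm1 u <= d * 2 ^ k)%N.
Proof.
move=> /mem_boxP hu; rewrite -[X in (X * _)%N](card_ord d) -sum_nat_const.
by apply: leq_sum => i _; exact/ltnW.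
Qed.

Lemma norm1_coord (u : G) i : (`|u i 0%R| <= norm1 u)%N.
Proof. by rewrite /norm1 (bigD1 i)//= leq_addr. Qed.

Lemma norm1_eq0 (u : G) : (norm1 u == 0)%N = (u == 0).
Proof.
apply/idP/eqP => [|->]; last first.
  by rewrite /norm1 big1// => i _; rewrite mxE absz0.
rewrite /norm1 sum_nat_eq0 => /forallP h; apply/matrixP => i j.
by rewrite (ord1 j) mxE; apply/eqP; have := h i; rewrite absz_eq0.
Qed.

Lemma box_ex (u : G) : u != 0 -> exists2 k, u \in box k & (2 ^ k <= 2 * norm1 u)%N.
Proof.
rewrite -norm1_eq0 -lt0n => u0; exists (trunc_log 2 (norm1 u)).+1.
  apply/mem_boxP => i; apply: leq_ltn_trans (norm1_coord u i) _.
  exact: trunc_log_ltn.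
by rewrite expnS leq_mul2l/= trunc_logP.
Qed.

Definition unitv (e : 'I_d * bool) : G := \col_i ((i == e.1)%:Z * (-1) ^+ e.2).

(** Induction along a geodesic from 0 to v inside the box: taking one unit off a nonzero coordinate
    lowers [norm1] by one and never leaves the box. *)
Lemma box_ind k (P : G -> nat -> Prop) : P 0 0%N ->
  (forall v n e, v \in box k -> P v n -> P (v + unitv e) n.+1) ->
  forall v, v \in box k -> P v (norm1 v).
Proof.
move=> P0 PS v; have [n] := ubnP (norm1 v).
elim: n v => // n IH v vn vk.
have [v0|] := eqVneq v 0.
  by have /eqP -> : (norm1 v == 0)%N; rewrite ?norm1_eq0 v0.
rewrite -norm1_eq0 sum_nat_eq0 negb_forall => /existsP[i /= vi].
pose e := (i, v i 0 < 0); pose v' := v - unitv e.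
have v'i j : (`|v' j 0%R| = `|v j 0%R| - (j == i))%N.
  rewrite /v' /e !mxE /=; have [->|ji] := eqVneq j i; last by rewrite mul0r; lia.
  by rewrite mul1r; case: ltrP => hv; rewrite ?expr1 ?expr0; lia.
have v'n : norm1 v = (norm1 v').+1.
  rewrite /norm1 (bigD1 i)//= [in RHS](bigD1 i)//= v'i eqxx.
  rewrite (eq_bigr (fun j => `|v' j 0%R|%N)); last first.
    by move=> j ji; rewrite v'i (negbTE ji) subn0.
  by move: vi; rewrite -lt0n -addSn => vi; congr (_ + _)%N; rewrite subn1 prednK.
have v'k : v' \in box k.
  apply/mem_boxP => j; rewrite v'i; move/mem_boxP: vk => /(_ j).
  by apply: leq_ltn_trans; exact: leq_subr.
rewrite v'n; have -> : v = v' + unitv e by rewrite subrK.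
by apply: PS => //; apply: IH => //; rewrite v'n in vn.
Qed.

End boxes.
Arguments box {d} k.

(** * A Vitali covering inequality for dyadic boxes *)

Section vitali.
Context (R : realType) (d : nat).
Local Notation G := 'cV[int]_d.
Implicit Types (phi : G -> R) (E B : seq G) (r : G -> nat).

Lemma max_radius E r e : e \in E ->
  exists2 e0, e0 \in E & forall e', e' \in E -> (r e' <= r e0)%N.
Proof.
elim: E e => // a E IH e _; case: E IH => [|b E] IH.
  by exists a; rewrite ?mem_head// => e'; rewrite inE => /eqP ->.
have [e0 e0E he0] := IH b (mem_head _ _).
have [ra|/ltnW ra] := leqP (r a) (r e0).
  exists e0; first by rewrite inE e0E orbT.
  by move=> e'; rewrite inE => /orP[/eqP ->//|/he0].
exists a; first exact: mem_head.
by move=> e'; rewrite inE => /orP[/eqP ->//|/he0 /leq_trans]; apply.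
Qed.

Lemma sum_shift phi (e0 : G) k B : uniq B ->
  (forall u, u \in box k -> e0 + u \in B) ->
  \sum_(u <- B | u - e0 \in box k) phi u = \sum_(w <- box k) phi (e0 + w).
Proof.
move=> uB sB; rewrite -big_filter -(big_map (fun w => e0 + w) xpredT phi).
apply: perm_big; apply: uniq_perm.
- exact: filter_uniq.
- by rewrite map_inj_uniq ?box_uniq//; exact: addrI.
move=> u; rewrite mem_filter; apply/andP/mapP => [[uk _]|[w wk ->]].
  by exists (u - e0); rewrite // addrC subrK.
by split; [rewrite addrC addKr|exact: sB].
Qed.

Lemma sum_subset phi k B (e0 : G) : (forall u, 0 <= phi u) -> uniq B ->
  (forall u, u \in box k -> e0 + u \in B) ->
  \sum_(w <- box k) phi (e0 + w) <= \sum_(u <- B) phi u.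
Proof.
move=> phi0 uB sB; rewrite -(sum_shift phi uB sB).
rewrite [leRHS](bigID (fun u => u - e0 \in box k))/= lerDl.
by apply: sumr_ge0 => u _.
Qed.

(* Greedy selection: a box of maximal radius [r e0] meets only boxes whose
   centres lie in the doubled box around [e0]. *)
Lemma vitali phi E r B (lam : R) : 0 <= lam -> (forall u, 0 <= phi u) ->
  uniq E -> uniq B ->
  (forall e u, e \in E -> u \in box (r e) -> e + u \in B) ->
  (forall e, e \in E ->
    lam * (size (box (r e) : seq G))%:R <= \sum_(u <- box (r e)) phi (e + u)) ->
  lam * (size E)%:R <= 3 ^+ d * \sum_(u <- B) phi u.
Proof.
move=> lam0; have [n] := ubnP (size E); elim: n E phi => // n IH E phi.
case: E => [|e1 E1] En phi0 uE uB sB hE.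
  by rewrite mulr0 mulr_ge0 ?exprn_ge0// sumr_ge0.
set E := e1 :: E1 in En uE sB hE *.
have [e0 e0E he0] := max_radius r (mem_head e1 E1).
pose r0 := r e0.
(* The discarded centres lie in a translate of box [r0.+1], which has at most 3^d times as many
   points as the chosen box; this is the constant of the inequality. *)
pose E' := [seq e <- E | e - e0 \notin box r0.+1].
(* Erasing [phi] on the chosen box prevents its mass from being counted again; the boxes with
   centres in [E'] miss it, so their lower bounds persist. *)
pose phi' u := if u - e0 \in box r0 then 0 else phi u.
have E'n : (size E' < n)%N.
  rewrite -ltnS; apply: leq_trans En; rewrite ltnS size_filter.
  rewrite -(count_predC (fun e => e - e0 \notin box r0.+1) E).
  rewrite -[X in (X < _)%N]addn0 ltn_add2l -has_count; apply/hasP.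
  by exists e0 => //=; rewrite subrr mem0_box.
have {IH} hE' : lam * (size E')%:R <= 3 ^+ d * \sum_(u <- B) phi' u.
  apply: IH => //.
  - by move=> u; rewrite /phi'; case: ifP.
  - exact: filter_uniq.
  - by move=> e u; rewrite mem_filter => /andP[_ eE]; exact: sB.
  - move=> e; rewrite mem_filter => /andP[ne eE]; apply: le_trans (hE e eE) _.
    rewrite le_eqVlt; apply/orP; left; apply/eqP.
    rewrite !big_seq; apply: eq_bigr => u uk; rewrite /phi' ifF//.
    apply/negbTE/negP => uk'; case/negP: ne.
    have -> : e - e0 = (e + u - e0) - u by rewrite addrAC addrK.
    by apply: boxD => //; apply: boxN; apply: boxS uk; exact: he0.
have sizeE : (size E <= size E' + size (box r0.+1 : seq G))%N.
  rewrite -[size E](count_predC (fun e => e - e0 \notin box r0.+1)) size_filter.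
  rewrite leq_add2l -size_filter -(size_map (fun e => e - e0)).
  apply: uniq_leq_size.
    by rewrite map_inj_uniq ?filter_uniq//; exact: addIr.
  by move=> u /mapP[e]; rewrite mem_filter /= negbK => /andP[h _] ->.
have sumE : \sum_(u <- B) phi u =
    \sum_(u <- box r0) phi (e0 + u) + \sum_(u <- B) phi' u.
  rewrite (bigID (fun u => u - e0 \in box r0))/=; congr (_ + _).
    by apply: sum_shift => // u; exact: sB.
  rewrite [RHS](bigID (fun u => u - e0 \in box r0))/= [X in _ = X + _]big1.
    by rewrite add0r; apply: eq_bigr => u /negbTE h; rewrite /phi' h.
  by move=> u h; rewrite /phi' h.
rewrite sumE mulrDr.
apply: (@le_trans _ _ (lam * (size E' + size (box r0.+1 : seq G))%:R)).
  by rewrite ler_wpM2l// ler_nat.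
rewrite natrD mulrDr addrC lerD//.
apply: (@le_trans _ _ (lam * (3 ^ d * size (box r0 : seq G))%:R)).
  by rewrite ler_wpM2l// ler_nat size_boxS.
by rewrite natrM natrX mulrCA ler_wpM2l ?exprn_ge0// hE.
Qed.

End vitali.

(** * Growth of a cocycle with a small maximal function *)

Section path_bound.
Context (R : realType) (d : nat) (X : Type) (T : 'cV[int]_d -> X -> X).
Local Notation G := 'cV[int]_d.
Hypothesis T0 : forall x, T 0 x = x.
Hypothesis TD : forall g k x, T (g + k) x = T g (T k x).
Variable c : G -> X -> R.
Hypothesis cD : forall g k x, c (g + k) x = c g (T k x) + c k x.

Definition gen_sum x : R := \sum_(e : 'I_d * bool) `|c (unitv e) x|.

(** The dyadic maximal function of [gen_sum] at [x] is at most [lam]. *)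
Definition tame (lam : R) x := forall k,
  \sum_(u <- box k) gen_sum (T u x) <= lam * (size (box k : seq G))%:R.

Let c0 x : c 0 x = 0.
Proof. by have := cD 0 0 x; rewrite addr0 T0; lra. Qed.

Lemma gen_sum_ge0 x : 0 <= gen_sum x.
Proof. by apply: sumr_ge0 => e _. Qed.

(** Along a geodesic from 0 to v in box k', each step adds a sum of [gen_sum] over a translate of
    box k contained in box k'+1. *)
Lemma tame_shift_sum lam x k k' v : 0 <= lam -> tame lam x -> (k <= k')%N ->
  v \in box k' ->
  \sum_(w <- box k) `|c v (T w x)| <=
    (norm1 v)%:R * (lam * (size (box k'.+1 : seq G))%:R).
Proof.
move=> lam0 tx kk'.
apply: (box_ind (P := fun v n => \sum_(w <- box k) `|c v (T w x)| <=
   n%:R * (lam * (size (box k'.+1 : seq G))%:R))).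
  by rewrite mul0r big1// => w _; rewrite c0 normr0.
move=> {}v n e vk IH; rewrite -natr1 mulrDl mul1r.
apply: (@le_trans _ _ (\sum_(w <- box k) (`|c v (T w x)| + gen_sum (T (v + w) x)))).
  apply: ler_sum => w _; rewrite addrC cD -TD.
  rewrite (le_trans (ler_normD _ _))// addrC lerD2l.
  by rewrite /gen_sum (bigD1 e)//= lerDl sumr_ge0.
rewrite big_split/= lerD//; apply: le_trans (tx k'.+1).
apply: (sum_subset (phi := fun u => gen_sum (T u x))) => [u||u uk].
- exact: gen_sum_ge0.
- exact: box_uniq.
- by apply: boxD => //; exact: boxS uk.
Qed.

Definition box_avg k x : R := (\sum_(w <- box k) c w x) / (size (box k : seq G))%:R.

(** On box k+1 the norm is at most [2 d 2^k], box k+2 has at most 9^d times the size of box k, and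
    the two double sums below contribute equal bounds up to box sizes: together [4 * 9^d * d]. *)
Lemma box_avg_step lam x k : 0 <= lam -> tame lam x ->
  `|box_avg k.+1 x - box_avg k x| <= 4 * 9 ^+ d * d%:R * lam * 2 ^+ k.
Proof.
move=> lam0 tx.
set b0 := (size (box k : seq G))%:R : R.
set b1 := (size (box k.+1 : seq G))%:R : R.
set b2 := (size (box k.+2 : seq G))%:R : R.
have b00 : 0 < b0 by rewrite ltr0n size_box_gt0.
have b10 : 0 < b1 by rewrite ltr0n size_box_gt0.
have b20 : 0 < b2 by rewrite ltr0n size_box_gt0.
have b21 : b2 <= 3 ^+ d * b1 by rewrite -natrX -natrM ler_nat size_boxS.
have b1b0 : b1 <= 3 ^+ d * b0 by rewrite -natrX -natrM ler_nat size_boxS.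
(* Expanding [c (w' + w) x] in both orders turns [c w' x - c w x] into a difference of values at
   translated points, which averages control. *)
have D : box_avg k.+1 x - box_avg k x = (\sum_(w' <- box k.+1) \sum_(w <- box k)
    (c w' (T w x) - c w (T w' x))) / (b1 * b0).
  have -> : \sum_(w' <- box k.+1) \sum_(w <- box k) (c w' (T w x) - c w (T w' x)) =
      \sum_(w' <- box k.+1) \sum_(w <- box k) (c w' x - c w x).
    apply: eq_bigr => w' _; apply: eq_bigr => w _.
    by have := cD w' w x; have := cD w w' x; rewrite (addrC w'); lra.
  have -> : \sum_(w' <- box k.+1) \sum_(w <- box k) (c w' x - c w x) =
      b0 * (\sum_(w' <- box k.+1) c w' x) - b1 * (\sum_(w <- box k) c w x).
    rewrite (eq_bigr (fun w' => b0 * c w' x - \sum_(w <- box k) c w x)).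
      rewrite big_split/= -mulr_sumr sumrN; congr (_ - _).
      by rewrite big_const_seq count_predT iter_addr addr0 mulr_natl.
    move=> w' _; rewrite big_split/= sumrN; congr (_ - _).
    by rewrite big_const_seq count_predT iter_addr addr0 mulr_natl.
  by rewrite /box_avg -/b0 -/b1; field; rewrite !gt_eqF.
have n0 (w : G) : w \in box k.+1 -> (norm1 w)%:R <= d%:R * 2 * 2 ^+ k :> R.
  by move=> /norm1_box; rewrite expnS mulnA -(ler_nat R) !natrM natrX.
set t := d%:R * 2 * 2 ^+ k * (lam * b2).
have S1 : \sum_(w' <- box k.+1) \sum_(w <- box k) `|c w' (T w x)| <= b1 * t.
  apply: (@le_trans _ _ (\sum_(w' <- box k.+1 : seq G) t)).
    rewrite !big_seq; apply: ler_sum => w' wk.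
    apply: le_trans (tame_shift_sum lam0 tx (leqnSn k) wk) _.
    by rewrite /t ler_wpM2r ?n0// mulr_ge0// ltW.
  by rewrite big_const_seq count_predT iter_addr addr0 mulr_natl.
have S2 : \sum_(w' <- box k.+1) \sum_(w <- box k) `|c w (T w' x)| <= b0 * t.
  rewrite exchange_big/=.
  apply: (@le_trans _ _ (\sum_(w <- box k : seq G) t)).
    rewrite !big_seq; apply: ler_sum => w wk.
    have wk' : w \in box k.+1 by apply: boxS wk.
    apply: le_trans (tame_shift_sum lam0 tx (leqnn k.+1) wk') _.
    by rewrite /t ler_wpM2r ?n0// mulr_ge0// ltW.
  by rewrite big_const_seq count_predT iter_addr addr0 mulr_natl.
rewrite D normrM [`|_^-1|]gtr0_norm ?invr_gt0 ?mulr_gt0//.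
rewrite ler_pdivrMr ?mulr_gt0//.
apply: (@le_trans _ _ (b1 * t + b0 * t)).
  apply: le_trans (lerD S1 S2); rewrite -big_split/=.
  apply: le_trans (ler_norm_sum _ _ _) _; apply: ler_sum => w' _.
  rewrite -big_split/=; apply: le_trans (ler_norm_sum _ _ _) _.
  by apply: ler_sum => w _; exact: ler_normB.
have b01 : b0 <= b1.
  by rewrite ler_nat uniq_leq_size ?box_uniq//; exact: boxS.
have b20' : b2 <= 9 ^+ d * b0.
  apply: le_trans b21 _; rewrite (_ : 9 = 3 * 3 :> R); last by lra.
  by rewrite exprMn -mulrA ler_wpM2l ?exprn_ge0.
have t0 : 0 <= d%:R * 2 * 2 ^+ k * lam :> R by rewrite !mulr_ge0// exprn_ge0.
set t' := d%:R * 2 * 2 ^+ k * lam in t0.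
have tE : t = t' * b2 by rewrite /t mulrA.
have -> : 4 * 9 ^+ d * d%:R * lam * 2 ^+ k * (b1 * b0) = (b1 + b1) * (t' * (9 ^+ d * b0)).
  by rewrite /t'; ring.
rewrite -mulrDl; apply: ler_pM.
- by rewrite addr_ge0 ?ltW.
- by rewrite tE mulr_ge0// ltW.
- by rewrite lerD2l.
- by rewrite tE ler_wpM2l.
Qed.

(** The increments sum to a geometric series, starting from 0 at box 0. *)
Lemma box_avg_le lam x k : 0 <= lam -> tame lam x ->
  `|box_avg k x| <= 4 * 9 ^+ d * d%:R * lam * 2 ^+ k.
Proof.
move=> lam0 tx; elim: k => [|k IH].
  rewrite /box_avg big_seq big1 => [|w /box0_eq0 ->]; last exact: c0.
  by rewrite mul0r normr0 !mulr_ge0// exprn_ge0.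
have := box_avg_step k lam0 tx.
have -> : box_avg k.+1 x = box_avg k x + (box_avg k.+1 x - box_avg k x).
  by rewrite addrC subrK.
rewrite exprS => h; apply: le_trans (ler_normD _ _) _.
rewrite addrAC subrr add0r in h.
apply: le_trans (lerD IH h) _; rewrite le_eqVlt; apply/orP; left; apply/eqP; ring.
Qed.

(* Averaging over a box lets the path from [x] to [T v x] spread out, so that
   it only sees averages of [gen_sum]. *)
Lemma tame_cocycle_le lam x v : 0 <= lam -> tame lam x -> tame lam (T v x) ->
  `|c v x| <= (3 ^+ d + 16 * 9 ^+ d * d%:R) * lam * (norm1 v)%:R.
Proof.
move=> lam0 tx tvx; have [->|v0] := eqVneq v 0.
  by rewrite c0 normr0 !mulr_ge0 ?addr_ge0// ?mulr_ge0 ?exprn_ge0.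
have [k vk kv] := box_ex v0.
set b0 := (size (box k : seq 'cV[int]_d))%:R : R.
have b00 : 0 < b0 by rewrite ltr0n size_box_gt0.
(* From [c v x + c w (T v x) = c w x + c v (T w x)], averaged over w in box k. *)
have E : c v x = (\sum_(w <- box k) c v (T w x)) / b0 + box_avg k x
    - box_avg k (T v x).
  rewrite /box_avg -/b0 -mulrDl -mulrBl -big_split/= -sumrB.
  rewrite (eq_bigr (fun=> c v x)) => [|w _].
    rewrite big_const_seq count_predT iter_addr addr0 -[c v x *+ _]mulr_natr.
    by rewrite mulfK// gt_eqF.
  by have := cD v w x; have := cD w v x; rewrite (addrC w); lra.
have h1 : `|(\sum_(w <- box k) c v (T w x)) / b0| <= 3 ^+ d * lam * (norm1 v)%:R.
  rewrite normrM [`|_^-1|]gtr0_norm ?invr_gt0// ler_pdivrMr//.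
  apply: le_trans (ler_norm_sum _ _ _) _.
  apply: le_trans (tame_shift_sum lam0 tx (leqnn k) vk) _.
  rewrite mulrC -[leRHS]mulrA [(norm1 v)%:R * b0]mulrC [leRHS]mulrA.
  rewrite ler_wpM2r// [leRHS]mulrAC [leRHS]mulrC ler_wpM2l//.
  by rewrite -natrX -natrM ler_nat size_boxS.
have h2 := box_avg_le k lam0 tx; have h3 := box_avg_le k lam0 tvx.
have h4 : 4 * 9 ^+ d * d%:R * lam * 2 ^+ k <=
    4 * 9 ^+ d * d%:R * lam * (2 * (norm1 v)%:R) :> R.
  rewrite ler_wpM2l ?mulr_ge0 ?exprn_ge0//.
  by rewrite -natrX -natrM ler_nat.
rewrite E; apply: le_trans (ler_normB _ _) _.
apply: (le_trans (lerD (ler_normD _ _) (lexx _))).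
(* The constant 16 is 4 from [box_avg_le], times 2 from [2^k <= 2 |v|], times 2 for the two
   endpoints. *)
have -> : (3 ^+ d + 16 * 9 ^+ d * d%:R) * lam * (norm1 v)%:R =
  3 ^+ d * lam * (norm1 v)%:R + 4 * 9 ^+ d * d%:R * lam * (2 * (norm1 v)%:R)
  + 4 * 9 ^+ d * d%:R * lam * (2 * (norm1 v)%:R) by ring.
by rewrite !lerD// ?(le_trans h2) ?(le_trans h3).
Qed.
End path_bound.

(** * The maximal inequality *)

Section invariant_integral.
Context (R : realType) (dX : measure_display) (X : measurableType dX).
Context (mu : probability X R) (d : nat) (T : zsystem mu d).
Local Notation G := 'cV[int]_d.

Lemma act_comp_measurable (f : X -> R) g : measurable_fun setT f ->
  measurable_fun setT (fun x => f (T g x)).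
Proof. by move=> mf; apply: measurableT_comp => //; exact: zact_measurable. Qed.

Lemma zactN g x : T (- g) (T g x) = x.
Proof. by rewrite -zactD addNr zact0. Qed.

Lemma zactNK g x : T g (T (- g) x) = x.
Proof. by rewrite -zactD addrN zact0. Qed.

Lemma mpred_act P g : mpred P -> mpred (fun x => P (T g x)).
Proof. by move=> mP; exact: (mpred_preimage (zact_measurable T g) mP). Qed.

Lemma integral_act (f : X -> \bar R) g : measurable_fun setT f ->
  (forall x, 0 <= f x)%E ->
  (\int[mu]_x f (T g x) = \int[mu]_x f x)%E.
Proof.
move=> mf f0.
have := ge0_integral_pushforward (zact_measurable T g) mu (D := setT) (f := f)
  measurableT mf (fun y _ => f0 y).
rewrite preimage_setT => <-.
apply: eq_measure_integral; first exact: zact_measurable.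
by move=> mT A mA _; exact: (zact_preserving T g mA).
Qed.

Lemma mu_act A g : measurable A -> mu [set x | A (T g x)] = mu A.
Proof. by move=> mA; have := zact_preserving T g mA. Qed.

Lemma ae_act (P : X -> Prop) : {ae mu, forall x, P x} ->
  {ae mu, forall x, forall g, P (T g x)}.
Proof.
move=> /ae_conull[A [mA A0 AP]]; apply: ae_all => g.
apply: (conull_ae (A := T g @^-1` A)) => [||x]; last exact: AP.
  exact: mpred_act.
by rewrite preimage_setC zact_preserving//; exact: measurableC.
Qed.

(** The group is countable, so a conull set contains an invariant one; pointwise arguments can then
    move freely along orbits. *)
Lemma conull_invariant (P : X -> Prop) : {ae mu, forall x, P x} ->
  exists A, [/\ measurable A, mu (~` A) = 0%E, A `<=` P &
    forall g x, A x -> A (T g x)].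
Proof.
move=> /ae_conull[A [mA A0 AP]].
have mB : measurable [set x | forall g, A (T g x)].
  by apply: mpred_all => g; exact: mpred_act.
exists [set x | forall g, A (T g x)]; split => //.
- have : {ae mu, forall x, A x} by apply: (conull_ae mA).
  move=> /ae_act aeA; apply/negligibleP; first exact: measurableC.
  by [].
- by move=> x /(_ 0); rewrite zact0 => /AP.
- by move=> g x Ax k; rewrite -zactD.
Qed.

Lemma integral_sum_act (f : X -> R) (c : R) (l : seq G) :
  measurable_fun setT f -> (forall x, 0 <= f x) -> 0 <= c ->
  (\int[mu]_x (c * \sum_(u <- l) f (T u x))%:E =
   (c * (size l)%:R)%:E * \int[mu]_x (f x)%:E)%E.
Proof.
move=> mf f0 c0.
have ms l' : measurable_fun setT (fun x => \sum_(u <- l') f (T u x)).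
  by apply: measurable_sum => u; exact: act_comp_measurable.
have s0 l' x : 0 <= \sum_(u <- l') f (T u x) by apply: sumr_ge0.
under eq_integral do rewrite EFinM.
rewrite ge0_integralZl_EFin//; first last.
- by apply/measurable_EFinP; exact: ms.
- by move=> x _; rewrite lee_fin.
rewrite EFinM -muleA; congr (_ * _)%E.
elim: l => [|u l IH].
  by rewrite mul0e; under eq_integral do rewrite big_nil; exact: integral0.
under eq_integral do rewrite big_cons EFinD.
rewrite ge0_integralD//; first last.
- by apply/measurable_EFinP; exact: ms.
- by move=> x _; rewrite lee_fin.
- by apply/measurable_EFinP; exact: act_comp_measurable.
- by move=> x _; rewrite lee_fin.
rewrite IH (integral_act (f := fun x => (f x)%:E)); first last.
- by move=> x; rewrite lee_fin.
- exact/measurable_EFinP.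
rewrite -[X in (X + _)%E]mul1e -ge0_muleDl ?lee_fin//.
by rewrite -EFinD [_ + _]nat1r.
Qed.

Section maximal.
Variable h : X -> R.
Hypothesis mh : measurable_fun setT h.
Hypothesis h0 : forall x, 0 <= h x.

Let big k x := \sum_(u <- box k) h (T u x).

Let mbig k : measurable_fun setT (big k).
Proof. by apply: measurable_sum => u; exact: act_comp_measurable. Qed.

(** Radii are truncated at [K], so that a finite piece of the orbit suffices; [maximal] lets [K]
    grow. *)
Definition exceeds (lam : R) K : set X := [set x | exists k, (k <= K)%N /\
  lam * (size (box k : seq G))%:R < big k x].

Let mexceeds lam K : measurable (exceeds lam K).
Proof.
apply: mpred_ex => k; apply: mpred_and; first exact: mpred_cst.
by apply: mpred_lt => //; exact: measurable_cst.
Qed.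

(** Transference to one orbit: the visits to the exceptional set from box K are centres of heavy
    boxes of radius at most K, all inside box K+1, and [vitali] applies. *)
Lemma exceeds_sum lam K x : 0 <= lam ->
  lam * \sum_(u <- box K) \1_(exceeds lam K) (T u x)
    <= 3 ^+ d * \sum_(u <- box K.+1) h (T u x).
Proof.
move=> lam0.
pose E := [seq u <- box K | T u x \in exceeds lam K].
have /choice[r hr] : forall u : G, exists k, u \in E -> (k <= K)%N /\
    lam * (size (box k : seq G))%:R < big k (T u x).
  move=> u.
  have [uE|] := boolP (u \in E); last by exists 0%N.
  by move: uE; rewrite mem_filter => /andP[/set_mem [k hk] _]; exists k.
have -> : \sum_(u <- box K) \1_(exceeds lam K) (T u x) = (size E)%:R :> R.
  rewrite size_filter -sum1_count natr_sum [RHS]big_mkcond/=.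
  by apply: eq_bigr => u _; rewrite indicE; case: (_ \in _).
apply: (vitali (phi := fun u => h (T u x)) (r := r)) => //.
- by apply: filter_uniq; exact: box_uniq.
- exact: box_uniq.
- move=> e u eE ur; apply: boxD; first by move: eE; rewrite mem_filter => /andP[].
  by apply: boxS ur; have [] := hr e eE.
- move=> e eE; apply: ltW; have [_] := hr e eE; rewrite /big.
  by under eq_bigr do rewrite -zactD addrC.
Qed.

(** The factor 9^d is 3^d from the covering times 3^d from the passage from box K to box K+1, after
    integration by invariance. *)
Lemma maximal_finite lam K : 0 < lam ->
  (mu (exceeds lam K) <= (lam^-1 * 9 ^+ d)%:E * \int[mu]_x (h x)%:E)%E.
Proof.
move=> lam0; set I := (\int[mu]_x (h x)%:E)%E.
have I0 : (0 <= I)%E by apply: integral_ge0 => x _; rewrite lee_fin.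
have mhE : measurable_fun setT (EFin \o h) by exact/measurable_EFinP.
set b := (size (box K : seq G))%:R : R.
set b1 := (size (box K.+1 : seq G))%:R : R.
have b0 : 0 < b by rewrite ltr0n size_box_gt0.
have b1b : b1 <= 3 ^+ d * b by rewrite -natrX -natrM ler_nat size_boxS.
have L : (\int[mu]_x (lam * \sum_(u <- box K) \1_(exceeds lam K) (T u x))%:E
    = (lam * b)%:E * mu (exceeds lam K))%E.
  rewrite (integral_sum_act (f := \1_(exceeds lam K))); first last.
  - exact: ltW.
  - by move=> y; rewrite indicE.
  - exact: measurable_indic.
  by rewrite integral_indic// setIT.
have U : (\int[mu]_x (3 ^+ d * \sum_(u <- box K.+1) h (T u x))%:E
    = (3 ^+ d * b1)%:E * I)%E.
  by rewrite integral_sum_act// exprn_ge0.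
have : ((lam * b)%:E * mu (exceeds lam K) <= (9 ^+ d * b)%:E * I)%E.
  rewrite -L; apply: (@le_trans _ _ ((3 ^+ d * b1)%:E * I)%E); last first.
    rewrite lee_wpmul2r// lee_fin (_ : 9 = 3 * 3 :> R); last by lra.
    by rewrite exprMn -mulrA ler_wpM2l ?exprn_ge0.
  rewrite -U; apply: ge0_le_integral => //.
  - move=> x _; rewrite lee_fin; apply: mulr_ge0; first exact: ltW.
    by apply: sumr_ge0 => u _; rewrite indicE.
  - apply/measurable_EFinP; apply: measurable_funM; first exact: measurable_cst.
    apply: measurable_sum => u.
    apply: (act_comp_measurable (f := \1_(exceeds lam K))).
    exact: measurable_indic.
  - apply/measurable_EFinP; apply: measurable_funM; first exact: measurable_cst.
    by apply: measurable_sum => u; exact: act_comp_measurable.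
  - by move=> x _; rewrite lee_fin exceeds_sum// ltW.
have mf : mu (exceeds lam K) \is a fin_num by rewrite fin_num_measure.
rewrite -(fineK mf); case: I I0 {L U} => [r r0|_ _|//].
  rewrite -!EFinM !lee_fin => hh; rewrite -mulrA ler_pdivlMl//.
  by rewrite -(ler_pM2r b0); move: hh; rewrite mulrAC [_ * r]mulrAC.
by rewrite gt0_muley ?leey// lte_fin mulr_gt0 ?invr_gt0// exprn_gt0.
Qed.

Lemma maximal (lam : R) : 0 < lam ->
  (mu [set x | ~ forall k, (big k x <= lam * (size (box k : seq G))%:R)%R]
    <= (lam^-1 * 9 ^+ d)%:E * \int[mu]_x (h x)%:E)%E.
Proof.
move=> lam0.
have -> : [set x | ~ forall k, big k x <= lam * (size (box k : seq G))%:R] =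
    \bigcup_K exceeds lam K.
  apply/seteqP; split=> [x /existsNP[k /negP]|x [K _ [k [_ hk]]] /(_ k)].
    by rewrite -ltNge => hk; exists k => //; exists k.
  by rewrite leNgt hk.
have mU : measurable (\bigcup_K exceeds lam K) by exact: bigcupT_measurable.
have := @nondecreasing_cvg_mu _ _ _ mu (exceeds lam) (mexceeds lam) mU.
have nd : nondecreasing_seq (exceeds lam).
  move=> m n mn; apply/subsetPset => x [k [km hk]].
  by exists k; split=> //; exact: leq_trans mn.
move=> /(_ nd) cv; rewrite -(cvg_lim _ cv)//.
apply: lime_le; first by apply/cvg_ex; eexists; exact: cv.
by near=> K; exact: maximal_finite.
Unshelve. all: by end_near. Qed.

End maximal.
End invariant_integral.

(** * The mean ergodic theorem *)

Section integrable_real.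
Context (R : realType) (dX : measure_display) (X : measurableType dX).
Context (mu : probability X R).
Implicit Types f g : X -> R.

Definition L1 f := mu.-integrable setT (EFin \o f).
Definition mean f : R := \int[mu]_x f x.

Lemma L1_measurable f : L1 f -> measurable_fun setT f.
Proof. by move=> /integrableP[/measurable_EFinP]. Qed.

Lemma L1D f g : L1 f -> L1 g -> L1 (fun x => f x + g x).
Proof. by move=> Lf Lg; exact: (integrableD measurableT Lf Lg). Qed.

Lemma L1Z c f : L1 f -> L1 (fun x => c * f x).
Proof. by move=> Lf; exact: (integrableZl measurableT c Lf). Qed.

Lemma L1B f g : L1 f -> L1 g -> L1 (fun x => f x - g x).
Proof. by move=> Lf Lg; exact: (integrableB measurableT Lf Lg). Qed.

Lemma L1_norm f : L1 f -> L1 (fun x => `|f x|).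
Proof. exact: integrable_norm. Qed.

Lemma L1_bounded f c : measurable_fun setT f -> (forall x, `|f x| <= c) -> L1 f.
Proof.
move=> mf fc; apply: measurable_bounded_integrable => //.
  by rewrite (le_lt_trans (probability_le1 _ _))// ltry.
exists c; split=> [|M cM x _]; first exact: num_real.
by apply: le_trans (fc x) _; exact: ltW.
Qed.

Lemma L1_cst c : L1 (cst c).
Proof. by apply: (@L1_bounded _ `|c|); first exact: measurable_cst. Qed.

Lemma L1_sum (I : Type) (s : seq I) (F : I -> X -> R) :
  (forall i, L1 (F i)) -> L1 (fun x => \sum_(i <- s) F i x).
Proof.
move=> LF; elim: s => [|i s IH].
  by under eq_fun do rewrite big_nil; exact: L1_cst.
by under eq_fun do rewrite big_cons; exact: L1D.
Qed.

Lemma meanD f g : L1 f -> L1 g -> mean (fun x => f x + g x) = mean f + mean g.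
Proof. by move=> Lf Lg; rewrite /mean RintegralD. Qed.

Lemma meanB f g : L1 f -> L1 g -> mean (fun x => f x - g x) = mean f - mean g.
Proof. by move=> Lf Lg; rewrite /mean RintegralB. Qed.

Lemma meanZ c f : L1 f -> mean (fun x => c * f x) = c * mean f.
Proof. by move=> Lf; rewrite /mean RintegralZl. Qed.

Lemma mean_cst c : mean (cst c) = c.
Proof.
rewrite /mean Rintegral_cst//; have -> : fine (mu setT) = 1 by rewrite probability_setT.
by rewrite mulr1.
Qed.

Lemma le_mean f g : L1 f -> L1 g -> (forall x, f x <= g x) -> mean f <= mean g.
Proof. by move=> Lf Lg fg; apply: le_Rintegral. Qed.

Lemma mean_ge0 f : (forall x, 0 <= f x) -> 0 <= mean f.
Proof. by move=> f0; apply: Rintegral_ge0. Qed.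

Lemma mean_norm f : L1 f -> `|mean f| <= mean (fun x => `|f x|).
Proof. by move=> Lf; apply: le_normr_Rintegral. Qed.

Lemma mean_sum (I : Type) (s : seq I) (F : I -> X -> R) :
  (forall i, L1 (F i)) -> mean (fun x => \sum_(i <- s) F i x) = \sum_(i <- s) mean (F i).
Proof.
move=> LF; elim: s => [|i s IH].
  by under [in LHS]eq_fun do rewrite big_nil; rewrite big_nil -[RHS]mean_cst.
rewrite big_cons -IH -meanD//; last exact: L1_sum.
by under [in LHS]eq_fun do rewrite big_cons.
Qed.

Lemma L1_EFin f : L1 f -> (\int[mu]_x (f x)%:E = (mean f)%:E)%E.
Proof. by move=> Lf; rewrite /mean /Rintegral fineK// integrable_fin_num. Qed.

Lemma markov_mean f (c : R) : L1 f -> (forall x, 0 <= f x) -> 0 < c ->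
  (mu [set x | (c < f x)%R] <= (c^-1 * mean f)%:E)%E.
Proof.
move=> Lf f0 c0; have mf := L1_measurable Lf.
have mA : measurable [set x | (c < f x)%R].
  by apply: mpred_lt => //; exact: measurable_cst.
have fin : mu [set x | (c < f x)%R] \is a fin_num by rewrite fin_num_measure.
rewrite -(fineK fin) lee_fin ler_pdivlMl//.
have L1A : L1 (fun x => c * \1_[set x | (c < f x)%R] x).
  apply: L1Z; apply: (@L1_bounded _ 1); first exact: measurable_indic.
  by move=> x; rewrite indicE; case: (_ \in _); rewrite ?normr1 ?normr0.
apply: le_trans (le_mean L1A Lf _); last first.
  move=> x; rewrite indicE; case: (boolP (_ \in _)) => [/set_mem /ltW|_]/=.
    by rewrite mulr1.
  by rewrite mulr0.
rewrite meanZ; last first.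
  apply: (@L1_bounded _ 1); first exact: measurable_indic.
  by move=> x; rewrite indicE; case: (_ \in _); rewrite ?normr1 ?normr0.
by rewrite /mean /Rintegral integral_indic// setIT.
Qed.

(** Markov at height [2^-n] leaves sets of measure at most [c * 2^-n], and Borel-Cantelli
    applies. *)
Lemma ae_eventually_small (w : nat -> X -> R) (c : R) :
  (forall n, L1 (w n)) -> (forall n x, 0 <= w n x) ->
  (forall n, mean (w n) <= c * 4^-1 ^+ n) ->
  {ae mu, forall x, exists N, forall n, (N <= n)%N -> w n x <= 2^-1 ^+ n}.
Proof.
move=> Lw w0 wc.
pose F n := [set x | (2^-1 ^+ n < w n x)%R].
have mF n : measurable (F n).
  apply: mpred_lt; first exact: measurable_cst.
  exact: L1_measurable (Lw n).
have hF n : (mu (F n) <= (c * 2^-1 ^+ n)%:E)%E.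
  apply: le_trans (markov_mean (Lw n) (w0 n) _) _; first by rewrite exprn_gt0.
  rewrite lee_fin -exprVn invrK.
  apply: le_trans (ler_wpM2l _ (wc n)) _; first by rewrite exprn_ge0.
  rewrite (_ : 4^-1 = 2^-1 * 2^-1 :> R); last by lra.
  have h : 2 ^+ n * 2^-1 ^+ n = 1 :> R by rewrite -exprMn divff// expr1n.
  rewrite exprMn; move: (2^-1 ^+ n) (2 ^+ n) h => a b h.
  have -> : b * (c * (a * a)) = c * a * (b * a) by ring.
  by rewrite h mulr1.
have S : (\sum_(n <oo) mu (F n) < +oo)%E.
  apply: (@le_lt_trans _ _ (\sum_(n <oo) (c * 2^-1 ^+ n)%:E)%E).
    by apply: lee_nneseries => // n _; exact: hF.
  apply: (@le_lt_trans _ _ (2 * c)%:E); last exact: ltry.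
  have c0 : 0 <= c.
    by have := wc 0%N; rewrite expr0 mulr1; apply: le_trans; exact: mean_ge0.
  apply: lime_le.
    apply: is_cvg_nneseries => n _ _.
    by rewrite lee_fin mulr_ge0// exprn_ge0.
  near=> n.
  have -> : (\sum_(0 <= i < n) (c * 2^-1 ^+ i)%:E)%E = (2 * c - 2 * c * 2^-1 ^+ n)%:E.
    elim: (n) => [|m IH]; first by rewrite big_nil expr0; congr EFin; ring.
    by rewrite big_nat_recr//= IH -EFinD exprS; congr EFin; field.
  by rewrite lee_fin lerBlDr lerDl !mulr_ge0// exprn_ge0.
exists (lim_sup_set F); split.
- by apply: bigcap_measurable => // k _; apply: bigcup_measurable.
- exact: lim_sup_set_cvg0.
- move=> x /= hx N _; apply: contrapT => hn; apply: hx; exists N => n Nn.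
  rewrite leNgt; apply/negP => hw; apply: hn; exists n.
Unshelve. all: by end_near. Qed.

End integrable_real.

Section averages.
Context (R : realType) (dX : measure_display) (X : measurableType dX).
Context (mu : probability X R) (d : nat) (T : zsystem mu d).
Local Notation G := 'cV[int]_d.
Implicit Types (f : X -> R) (g : G).
Local Notation L1 := (L1 mu).
Local Notation mean := (mean mu).

Lemma L1_act f g : L1 f -> L1 (fun x => f (T g x)).
Proof.
move=> Lf; have mf := L1_measurable Lf; apply/integrableP; split.
  by apply/measurable_EFinP; exact: act_comp_measurable.
rewrite (integral_act T (f := fun x => `|(f x)%:E|%E)) => [||x].
- by have /integrableP[] := Lf.
- by apply: measurableT_comp => //; apply/measurable_EFinP.
- exact: abse_ge0.
Qed.

Lemma mean_act f g : L1 f -> mean (fun x => f (T g x)) = mean f.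
Proof.
move=> Lf; have mf := L1_measurable Lf; rewrite /mean /Rintegral; congr fine.
have mfE : measurable_fun setT (EFin \o f) by apply/measurable_EFinP.
rewrite integralE [RHS]integralE; congr (_ - _)%E.
  rewrite -(integral_act T g (f := (fun x => (f x)%:E)^\+%E))//.
    by apply: eq_integral => x _; rewrite !funeposE.
  exact: measurable_funepos.
rewrite -(integral_act T g (f := (fun x => (f x)%:E)^\-%E))//.
  by apply: eq_integral => x _; rewrite !funenegE.
exact: measurable_funeneg.
Qed.

(* Trees encode the dyadic convex combinations of translates, which are closed
   under the midpoints needed by the parallelogram argument. *)
Inductive avg := Leaf of G | Mid of avg & avg.

Fixpoint avg_app (t : avg) f (x : X) : R :=
  match t with
  | Leaf g => f (T g x)
  | Mid a b => 2^-1 * (avg_app a f x + avg_app b f x)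
  end.

Fixpoint avg_shift v t :=
  match t with
  | Leaf g => Leaf (g + v)
  | Mid a b => Mid (avg_shift v a) (avg_shift v b)
  end.

Fixpoint avg_comp t' t :=
  match t' with
  | Leaf g => avg_shift g t
  | Mid a b => Mid (avg_comp a t) (avg_comp b t)
  end.

Lemma avg_shiftE v t f x : avg_app (avg_shift v t) f x = avg_app t f (T v x).
Proof. by elim: t => [g|a IHa b IHb] /=; rewrite ?zactD ?IHa ?IHb. Qed.

Lemma avg_compE t' t f x : avg_app (avg_comp t' t) f x = avg_app t' (avg_app t f) x.
Proof. by elim: t' => [g|a IHa b IHb] /=; rewrite ?avg_shiftE ?IHa ?IHb. Qed.

Lemma avg_appB t f f' x :
  avg_app t (fun y => f y - f' y) x = avg_app t f x - avg_app t f' x.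
Proof. by elim: t => [g|a IHa b IHb] //=; rewrite IHa IHb; ring. Qed.

Lemma avg_app_cst t c x : avg_app t (cst c) x = c.
Proof. by elim: t => [g|a IHa b IHb] //=; rewrite IHa IHb; field. Qed.

Lemma avg_app_norm t f x : `|avg_app t f x| <= avg_app t (fun y => `|f y|) x.
Proof.
elim: t => [g|a IHa b IHb] //=.
rewrite normrM gtr0_norm ?invr_gt0// ler_wpM2l ?invr_ge0//.
by apply: le_trans (ler_normD _ _) _; exact: lerD.
Qed.

Lemma avg_app_le t f f' x : (forall y, f y <= f' y) -> avg_app t f x <= avg_app t f' x.
Proof.
by move=> ff'; elim: t => [g|a IHa b IHb] //=; rewrite ler_wpM2l ?invr_ge0// lerD.
Qed.

Lemma avg_app_bounded t f c x : (forall y, `|f y| <= c) -> `|avg_app t f x| <= c.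
Proof.
move=> fc; apply: le_trans (avg_app_norm _ _ _) _.
by apply: le_trans (avg_app_le (f' := cst c) _ _ fc) _; rewrite avg_app_cst.
Qed.

Lemma avg_app_measurable t f : measurable_fun setT f -> measurable_fun setT (avg_app t f).
Proof.
move=> mf; elim: t => [g|a IHa b IHb] /=; first exact: act_comp_measurable.
by apply: measurable_funM; [exact: measurable_cst|exact: measurable_funD].
Qed.

Lemma L1_avg t f : L1 f -> L1 (avg_app t f).
Proof.
move=> Lf; elim: t => [g|a IHa b IHb] /=; first exact: L1_act.
by apply: L1Z; exact: L1D.
Qed.

Lemma mean_avg t f : L1 f -> mean (avg_app t f) = mean f.
Proof.
move=> Lf; elim: t => [g|a IHa b IHb] /=; first exact: mean_act.
have La := L1_avg a Lf; have Lb := L1_avg b Lf.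
by rewrite meanZ ?meanD ?IHa ?IHb//; [field|exact: L1D].
Qed.

Definition dist1 f f' := mean (fun x => `|f x - f' x|).

Lemma dist1_triangle f2 f1 f3 : L1 f1 -> L1 f2 -> L1 f3 ->
  dist1 f1 f3 <= dist1 f1 f2 + dist1 f2 f3.
Proof.
move=> L_1 L_2 L_3; rewrite /dist1 -meanD; [|exact/L1_norm/L1B|exact/L1_norm/L1B].
apply: le_mean => [||x]; first exact/L1_norm/L1B.
  by apply: L1D; exact/L1_norm/L1B.
exact: ler_distD.
Qed.

Lemma dist1_avg t f f' : L1 f -> L1 f' ->
  dist1 (avg_app t f) (avg_app t f') <= dist1 f f'.
Proof.
move=> Lf Lf'; have LB : L1 (fun x => `|f x - f' x|) by exact/L1_norm/L1B.
rewrite /dist1 -[leRHS](mean_avg t LB); apply: le_mean => [||x].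
- by apply/L1_norm/L1B; exact: L1_avg.
- exact: L1_avg.
- by rewrite -avg_appB; exact: avg_app_norm.
Qed.

Lemma dist1_cst f c : L1 f -> `|mean f - c| <= dist1 f (cst c).
Proof.
move=> Lf; have Lc := L1_cst mu c.
by rewrite -{1}(mean_cst mu c) -meanB//; apply: mean_norm; exact: L1B.
Qed.

Section bounded.
Hypothesis T_ergodic : zergodic T.
Variables (f : X -> R) (c : R).
Hypothesis mf : measurable_fun setT f.
Hypothesis fc : forall x, `|f x| <= c.

Let Q t := mean (fun x => avg_app t f x ^+ 2).

Let L1_sq t t' a b : L1 (fun x => (a * avg_app t f x + b * avg_app t' f x) ^+ 2).
Proof.
apply: (@L1_bounded _ _ _ _ _ ((`|a| * c + `|b| * c) ^+ 2)).
  apply: measurable_funX; apply: measurable_funD; apply: measurable_funM;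
    by [exact: measurable_cst|exact: avg_app_measurable].
move=> x; rewrite normrX lerXn2r ?nnegrE//.
  by rewrite addr_ge0// mulr_ge0// (le_trans _ (fc x)).
apply: le_trans (ler_normD _ _) _; rewrite !normrM.
by rewrite lerD// ler_wpM2l//; exact: avg_app_bounded.
Qed.

Let L1_sq1 t : L1 (fun x => avg_app t f x ^+ 2).
Proof.
have := L1_sq t t 1 0; congr (mu.-integrable _ _).
by apply/funext => x /=; rewrite mul1r mul0r addr0.
Qed.

Lemma parallelogram t t' :
  mean (fun x => (avg_app t f x - avg_app t' f x) ^+ 2) =
  2 * Q t + 2 * Q t' - 4 * Q (Mid t t').
Proof.
have E : (fun x => (avg_app t f x - avg_app t' f x) ^+ 2) = (fun x =>
   (2 * avg_app t f x ^+ 2 + 2 * avg_app t' f x ^+ 2)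
   - 4 * avg_app (Mid t t') f x ^+ 2).
  by apply/funext => x /=; field.
rewrite E meanB; [|by apply: L1D; apply: L1Z|exact: L1Z].
by rewrite meanD ?meanZ//; exact: L1Z.
Qed.

Let I := inf (range Q).

Let Q_lb t : I <= Q t.
Proof.
apply: ge_inf; last by exists t.
by exists 0 => _ [s _ <-]; apply: mean_ge0 => x; exact: sqr_ge0.
Qed.

(** The rate [16^-n] yields L^1 distances of order [4^-n], small enough for
    [ae_eventually_small]. *)
Lemma minimizers : exists t : nat -> avg, forall n, Q (t n) < I + 16^-1 ^+ n.
Proof.
suff /choice[t ht] : forall n, exists t, Q t < I + 16^-1 ^+ n by exists t.
move=> n; have [||_ [t _ <-] ht] := @inf_adherent R (range Q) (16^-1 ^+ n).
- by rewrite exprn_gt0.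
- split; first by exists (Q (Leaf 0)); exists (Leaf 0).
  by exists 0 => _ [s _ <-]; apply: mean_ge0 => x; exact: sqr_ge0.
- by exists t.
Qed.

(* [|y| <= (s + y^2 / s) / 2] with [s = 4^-n]. *)
Lemma near_minimizers t t' n : Q t < I + 16^-1 ^+ n -> Q t' < I + 16^-1 ^+ n ->
  mean (fun x => `|avg_app t f x - avg_app t' f x|) <= 3 * 4^-1 ^+ n.
Proof.
move=> Qt Qt'; have Qm := Q_lb (Mid t t').
have P := parallelogram t t'.
set s := 4^-1 ^+ n : R.
have s0 : 0 < s by rewrite exprn_gt0.
have sE : 16^-1 ^+ n = s * s by rewrite -exprMn; congr (_ ^+ n); lra.
have Lsq : L1 (fun x => (avg_app t f x - avg_app t' f x) ^+ 2).
  have := L1_sq t t' 1 (-1); congr (mu.-integrable _ _).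
  by apply/funext => x /=; rewrite mul1r mulN1r.
have LA u : L1 (avg_app u f) by apply: L1_avg; exact: L1_bounded mf fc.
apply: (@le_trans _ _ (mean (fun x => s / 2 + (2 * s)^-1 *
    (avg_app t f x - avg_app t' f x) ^+ 2))).
  apply: le_mean => [||x].
  - by apply/L1_norm/L1B.
  - by apply: L1D; [exact: L1_cst|exact: L1Z].
  move: (_ - _) => y; have y2 : y ^+ 2 = `|y| ^+ 2 by rewrite real_normK ?num_real.
  rewrite y2; move: `|y| => z; rewrite -subr_ge0.
  have -> : s / 2 + (2 * s)^-1 * z ^+ 2 - z = (s - z) ^+ 2 * (2 * s)^-1.
    by field; rewrite gt_eqF.
  by rewrite mulr_ge0 ?sqr_ge0// invr_ge0 mulr_ge0// ltW.
rewrite meanD; [|exact: L1_cst|exact: L1Z].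
rewrite (mean_cst mu) meanZ// P.
(* The parallelogram identity bounds the mean square by [4 s^2]; allowing [5 s^2] makes the total
   the round [3 s]. *)
have -> : 3 * s = s / 2 + (2 * s)^-1 * (5 * (s * s)) by field; rewrite gt_eqF.
rewrite lerD2l ler_wpM2l ?invr_ge0 ?mulr_ge0 ?ltW//.
by rewrite sE in Qt Qt'; nra.
Qed.

Let Q_shift v t : Q (avg_shift v t) = Q t.
Proof.
rewrite /Q -(mean_act v (L1_sq1 t)); congr (mean _).
by apply/funext => x; rewrite avg_shiftE.
Qed.

Section limit.
Variable t : nat -> avg.
Hypothesis Qt : forall n, Q (t n) < I + 16^-1 ^+ n.

Let u n := avg_app (t n) f.

Let u_norm n x : `|u n x| <= c.
Proof. exact: avg_app_bounded. Qed.

Let mu_ n : measurable_fun setT (u n).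
Proof. exact: avg_app_measurable. Qed.

Let Lu n : L1 (u n).
Proof. exact: (L1_bounded mu (mu_ n) (u_norm n)). Qed.

(** Both parts come from [near_minimizers]; asymptotic invariance holds because a translate of a
    near-minimizer is again one, by [Q_shift]. *)
Definition settled x := (exists N, forall n, (N <= n)%N -> `|u n x - u n.+1 x| <= 2^-1 ^+ n)
  /\ forall v, exists N, forall n, (N <= n)%N -> `|u n x - u n (T v x)| <= 2^-1 ^+ n.

Lemma settled_ae : {ae mu, forall x, settled x}.
Proof.
have h1 : {ae mu, forall x, exists N, forall n, (N <= n)%N -> `|u n x - u n.+1 x| <= 2^-1 ^+ n}.
  apply: (ae_eventually_small (c := 3)) => // n; first exact/L1_norm/L1B.
  apply: near_minimizers => //; apply: lt_le_trans (Qt _) _.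
  by rewrite lerD2l ler_wiXn2l//; lra.
have h2 : {ae mu, forall x, forall v, exists N, forall n, (N <= n)%N ->
    `|u n x - u n (T v x)| <= 2^-1 ^+ n}.
  apply: ae_all => v; apply: (ae_eventually_small (c := 3)) => // n.
    by apply/L1_norm/L1B => //; exact: L1_act.
  rewrite (_ : (fun x => _) = fun x => `|u n x - avg_app (avg_shift v (t n)) f x|).
    by apply: near_minimizers => //; rewrite Q_shift.
  by apply/funext => x; rewrite avg_shiftE.
by apply: filterS2 h1 h2 => x ? ?; split.
Qed.

(** States that the limsup of [u n x] is at most [b], through countable quantifiers to remain
    measurable in x. At settled points it is invariant. *)
Definition limsup_le (b : R) x := forall j : nat, exists N, forall n, (N <= n)%N ->
  u n x <= b + j.+1%:R^-1.

Lemma limsup_le_act b v x : settled x -> limsup_le b x -> limsup_le b (T v x).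
Proof.
move=> [_ /(_ v)[N1 h1]] hb j.
have j0 : (0 : R) < j.+1%:R^-1 / 2 by rewrite divr_gt0// invr_gt0.
have [k hk] := ex_natinv_lt j0; have [N2 h2] := hb k.
have [N3 h3] := ex_geo_lt j0.
exists (maxn N1 (maxn N2 N3)) => n; rewrite !geq_max => /and3P[n1 n2 n3].
have := h1 n n1; have := h2 n n2; rewrite distrC ler_norml => a1 /andP[_ a2].
have := le_lt_trans (geo_anti R n3) h3.
move: (j.+1%:R^-1) (k.+1%:R^-1) (2^-1 ^+ n) j0 hk a1 a2 => p q r *; lra.
Qed.

Lemma limsup_leS b b' x : b <= b' -> limsup_le b x -> limsup_le b' x.
Proof.
move=> bb' hb j; have [N hN] := hb j; exists N => n /hN h.
by apply: le_trans h _; rewrite lerD2r.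
Qed.

Lemma settled_converges (b : R) x : settled x -> (forall j : nat, limsup_le (b + j.+1%:R^-1) x) ->
  (forall j : nat, ~ limsup_le (b - j.+1%:R^-1) x) ->
  u ^~ x @ \oo --> b.
Proof.
move=> [[N0 h0] _] hu hl; apply/cvgrPdist_le => e e0.
have e4 : 0 < e / 4 by rewrite divr_gt0.
have [j hj] := ex_natinv_lt e4.
have [N1 h1] := hu j j.
have [N2 h2] := ex_geo_lt e4.
have /existsNP[k /forallNP hk] := hl j.
pose M := maxn N0 N2.
have tail m p : (N0 <= m)%N -> `|u m x - u (m + p)%N x| <= 2 * 2^-1 ^+ m - 2 * 2^-1 ^+ (m + p).
  move=> Nm; elim: p => [|p IH]; first by rewrite addn0 subrr normr0; lra.
  rewrite addnS; apply: le_trans (ler_distD (u (m + p)%N x) _ _) _.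
  have := h0 (m + p)%N (leq_trans Nm (leq_addr _ _)).
  by move: IH; rewrite exprS; lra.
near=> n.
have nN1 : (N1 <= n)%N by near: n; exact: nbhs_infty_ge.
have nM : (M <= n)%N by near: n; exact: nbhs_infty_ge.
have /existsNP[m /not_implyP[nm /negP]] := hk n; rewrite -ltNge => um.
have := tail n (m - n)%N (leq_trans (leq_maxl _ _) nM); rewrite subnKC// => dnm.
have := h1 n nN1; have := le_lt_trans (geo_anti R (leq_trans (leq_maxr _ _) nM)) h2.
have : 0 < 2^-1 ^+ m :> R by rewrite exprn_gt0.
have : (0 : R) < k.+1%:R^-1 by rewrite invr_gt0.
move: dnm; rewrite ler_distl ler_distl => /andP[d1 d2].
move: (j.+1%:R^-1) (k.+1%:R^-1) (2^-1 ^+ n) (2^-1 ^+ m) d1 d2 hj um => p q r s.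
by move=> *; apply/andP; split; lra.
Unshelve. all: by end_near. Qed.

(** By ergodicity each sublevel set of the limsup has measure 0 or 1; the infimum of the levels of
    full measure is the almost sure limit. *)
Lemma limsup_const : exists b : R, {ae mu, forall x, u ^~ x @ \oo --> b}.
Proof.
have [X0 [mX0 X00 X0s X0T]] := conull_invariant T settled_ae.
pose B (b : R) := [set x | X0 x /\ limsup_le b x].
have mB (b : R) : measurable (B b).
  apply: mpred_and => //; apply: mpred_all => j; apply: mpred_ex => N.
  apply: mpred_all => n; apply: mpred_imp; first exact: mpred_cst.
  by apply: mpred_le => //; exact: measurable_cst.
have BT (b : R) g x : B b x -> B b (T g x).
  by move=> [x0 xb]; split; [exact: X0T|apply: limsup_le_act => //; exact: X0s].
have B01 (b : R) : mu (B b) = 0%E \/ mu (B b) = 1%E.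
  apply: T_ergodic => // g; apply/seteqP; split=> x; last exact: BT.
  by move=> /(BT b (- g)); rewrite zactN.
pose S := [set b : R | mu (B b) = 1%E].
have Sc : S c.
  suff E : B c = X0 by rewrite /S/= E; exact: conull1.
  apply/seteqP; split=> [x []//|x x0]; split=> // j; exists 0%N => n _.
  apply: (@le_trans _ _ c); last by rewrite lerDl invr_ge0.
  by apply: le_trans (u_norm n x); exact: ler_norm.
have Slb (b : R) : S b -> - c <= b.
  move=> Sb; rewrite leNgt; apply/negP => bc.
  have bc0 : 0 < - c - b by rewrite subr_gt0.
  have [j hj] := ex_natinv_lt bc0.
  suff B0 : B b = set0.
    by move: Sb; rewrite /S/= B0 measure0 => /eqP; rewrite eq_sym onee_eq0.
  apply/seteqP; split=> x // -[_ /(_ j)[N /(_ N (leqnn _))]].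
  have := u_norm N x; rewrite ler_norml => /andP[+ _].
  by clear Sb Sc X00; move: (j.+1%:R^-1) hj => p *; lra.
have infS : has_inf S by split; [exists c|exists (- c)].
exists (inf S).
have h1 j : {ae mu, forall x, limsup_le (inf S + j.+1%:R^-1) x}.
  have j0 : (0 : R) < j.+1%:R^-1 by rewrite invr_gt0.
  have [s Ss sj] := inf_adherent j0 infS.
  apply: (conull_ae (A := B s)) => //.
    by rewrite probability_setC// Ss subee.
  by move=> x [_]; apply: limsup_leS; exact: ltW.
have h2 j : {ae mu, forall x, ~ B (inf S - j.+1%:R^-1) x}.
  have [B0|B1] := B01 (inf S - j.+1%:R^-1).
    by exists (B (inf S - j.+1%:R^-1)); split => // x /=; rewrite notK.
  have : inf S <= inf S - j.+1%:R^-1 by apply: ge_inf => //; exists (- c).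
  by rewrite lerBrDr gerDl leNgt invr_gt0 ltr0Sn.
have h3 : {ae mu, forall x, X0 x} by exact: (conull_ae mX0).
have := ae_all h1; have := ae_all h2; apply: filterS3 h3 => x x0 x2 x1.
apply: settled_converges => //; first exact: X0s.
by move=> j hj; exact: (x2 j).
Qed.

Lemma averages_converge (b e : R) : {ae mu, forall x, u ^~ x @ \oo --> b} -> 0 < e ->
  exists n, dist1 (u n) (cst b) <= e.
Proof.
move=> ub e0.
have [] := @dominated_convergence _ _ _ mu setT measurableT
  (fun n x => (u n x)%:E) (cst b%:E) (cst c%:E).
- by move=> n; apply/measurable_EFinP.
- exact: measurable_cst.
- by apply: filterS ub => x hx _; apply: cvg_EFin => //; exact: nearW.
- exact: (L1_cst mu c).
- by apply: aeW => x n _; rewrite lee_fin.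
move=> _ /fine_cvgP[_ /cvgrPdist_lt /(_ e e0)[n _ hn]] _; exists n.
have := hn n (leqnn n). rewrite /= sub0r normrN => /ltW; apply: le_trans.
exact: ler_norm.
Qed.
End limit.

Lemma mean_ergodic_bounded e : 0 < e ->
  exists t, dist1 (avg_app t f) (cst (mean f)) <= e.
Proof.
move=> e0; have [t ht] := minimizers; have [b hb] := limsup_const ht.
have Lf : L1 f by exact: L1_bounded mf fc.
have -> : mean f = b.
  apply/eqP; rewrite -subr_eq0 -normr_eq0 eq_le normr_ge0 andbT.
  apply/ler_addgt0Pl => r r0; rewrite addr0.
  have [n hn] := averages_converge hb r0.
  rewrite -(mean_avg (t n) Lf); apply: le_trans hn; apply: dist1_cst.
  exact: L1_avg.
by have [n hn] := averages_converge hb e0; exists (t n).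
Qed.
End bounded.

Hypothesis T_ergodic : zergodic T.

Lemma truncation f e : L1 f -> 0 < e ->
  exists f' c, [/\ measurable_fun setT f', forall x, `|f' x| <= c & dist1 f f' <= e].
Proof.
move=> Lf e0; have mf := L1_measurable Lf.
pose F n x := Num.max (- n%:R) (Num.min (f x) n%:R).
have mF n : measurable_fun setT (F n).
  apply: measurable_maxr; first exact: measurable_cst.
  by apply: measurable_minr => //; exact: measurable_cst.
have Fn n x : `|F n x| <= n%:R.
  have n0 : 0 <= n%:R :> R by exact: ler0n.
  rewrite ler_norml /F le_max lexx/= ge_max ge_min lexx orbT andbT.
  lra.
have Ff n x : `|F n x| <= `|f x|.
  have n0 : 0 <= n%:R :> R by exact: ler0n.
  rewrite /F; case: (lerP (f x) n%:R) => h1; case: (lerP (- n%:R)) => h2 //.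
  - rewrite normrN ger0_norm//; apply: (@le_trans _ _ (- f x)); first by lra.
    by rewrite -normrN; exact: ler_norm.
  - rewrite ger0_norm//; apply: (@le_trans _ _ (f x)); first by lra.
    exact: ler_norm.
  - by lra.
have [] := @dominated_convergence _ _ _ mu setT measurableT
  (fun n x => (F n x)%:E) (EFin \o f) (EFin \o (fun x => `|f x|)).
- by move=> n; apply/measurable_EFinP.
- exact/measurable_EFinP.
- apply: aeW => x _; apply: cvg_EFin; first exact: nearW.
  apply: cvg_near_cst; near=> n.
  have : `|f x| <= n%:R by near: n; exact: nbhs_infty_ger.
  rewrite ler_norml => /andP[h1 h2].
  by rewrite /= /F min_l// max_r.
- exact: (L1_norm Lf).
- by apply: aeW => x n _; rewrite lee_fin.
move=> _ /fine_cvgP[_ /cvgrPdist_lt /(_ e e0)[n _ hn]] _; exists (F n), n%:R.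
split=> //; have := hn n (leqnn n); rewrite /= sub0r normrN => /ltW.
apply: le_trans; apply: le_trans (ler_norm _).
rewrite /dist1 /mean /Rintegral; under eq_integral do rewrite distrC.
by [].
Unshelve. all: by end_near. Qed.

Lemma mean_ergodic f e : L1 f -> 0 < e ->
  exists t, dist1 (avg_app t f) (cst (mean f)) <= e.
Proof.
move=> Lf e0; have e3 : 0 < e / 3 by rewrite divr_gt0.
have [f' [c [mf' f'c ff']]] := truncation Lf e3.
have Lf' : L1 f' by exact: L1_bounded mf' f'c.
have [t ht] := mean_ergodic_bounded T_ergodic mf' f'c e3.
exists t.
have h1 := dist1_avg t Lf Lf'.
have h2 : dist1 (cst (mean f')) (cst (mean f)) <= e / 3.
  rewrite /dist1 (_ : (fun x : X => _) = cst `|mean f' - mean f|) //.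
  rewrite (mean_cst mu) distrC -meanB//; apply: le_trans ff'.
  by apply: mean_norm; exact: L1B.
have La := L1_avg t Lf; have La' := L1_avg t Lf'.
have h3 := dist1_triangle La La' (L1_cst mu (mean f)).
have h4 := dist1_triangle La' (L1_cst mu (mean f')) (L1_cst mu (mean f)).
lra.
Qed.

(** Functions are treated one at a time: a further average fixes constants and contracts [dist1], so
    it does not spoil what the earlier ones achieved. *)
Lemma mean_ergodic_family (I : eqType) (s : seq I) (F : I -> X -> R) e :
  (forall i, L1 (F i)) -> 0 < e ->
  exists t, forall i, i \in s -> dist1 (avg_app t (F i)) (cst (mean (F i))) <= e.
Proof.
move=> LF e0; elim: s => [|i s [t ht]]; first by exists (Leaf 0).
have Li := L1_avg t (LF i).
have [t' ht'] := mean_ergodic Li e0; exists (avg_comp t' t).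
have E j : avg_app (avg_comp t' t) (F j) = avg_app t' (avg_app t (F j)).
  by apply/funext => x; exact: avg_compE.
move=> j; rewrite inE E => /orP[/eqP ->|js].
  by move: ht'; rewrite mean_avg.
have := dist1_avg t' (L1_avg t (LF j)) (L1_cst mu (mean (F j))).
have -> : avg_app t' (cst (mean (F j))) = cst (mean (F j)).
  by apply/funext => x; exact: avg_app_cst.
by move/le_trans; apply; exact: ht.
Qed.

End averages.

(** * Asymptotically linear cocycles *)

Section real_cocycle.
Context (R : realType) (dX : measure_display) (X : measurableType dX).
Context (mu : probability X R) (d : nat) (T : zsystem mu d).
Hypothesis T_ergodic : zergodic T.
Local Notation G := 'cV[int]_d.
Local Notation L1 := (L1 mu).
Local Notation mean := (mean mu).
Variable s : G -> X -> R.
Hypothesis sD : forall g k x, s (g + k) x = s g (T k x) + s k x.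
Hypothesis Ls : forall g, L1 (s g).

Let ms g : measurable_fun setT (s g).
Proof. exact: L1_measurable. Qed.

(** For a translate by g the transfer function is [- s g], since [s (v + g)] expands in two orders;
    midpoints average transfer functions. *)
Lemma cohomologous (t : avg d) : exists b : X -> R, measurable_fun setT b /\
  forall v x, s v x = b (T v x) - b x + avg_app T t (s v) x.
Proof.
elim: t => [g|a1 [b1 [m1 h1]] a2 [b2 [m2 h2]]] /=.
  exists (fun x => - s g x); split; first exact: measurable_funN.
  by move=> v x; have := sD v g x; have := sD g v x; rewrite addrC; lra.
exists (fun x => 2^-1 * (b1 x + b2 x)); split.
  by apply: measurable_funM; [exact: measurable_cst|exact: measurable_funD].
by move=> v x; have := h1 v x; have := h2 v x; lra.
Qed.

Lemma mean_cocycleD g k : mean (s (g + k)) = mean (s g) + mean (s k).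
Proof.
rewrite -(mean_act T k (Ls g)) -meanD//; last exact: L1_act.
by congr (mean _); apply/funext => x; exact: sD.
Qed.

Definition residual t g x : R := avg_app T t (s g) x - mean (s g).

Lemma residualD t g k x : residual t (g + k) x = residual t g (T k x) + residual t k x.
Proof.
rewrite /residual mean_cocycleD.
suff -> : avg_app T t (s (g + k)) x = avg_app T t (s g) (T k x) + avg_app T t (s k) x.
  by ring.
elim: t => [v|a IHa b IHb] /=; last by rewrite IHa IHb; ring.
by rewrite sD -!zactD [k + v]addrC.
Qed.

Lemma L1_residual t g : L1 (residual t g).
Proof. by apply: L1B; [exact: L1_avg|exact: L1_cst]. Qed.

Lemma mu_norm_gt_small (b : X -> R) e : measurable_fun setT b -> 0 < e ->
  exists c : R, 0 < c /\ (mu [set x | (c < `|b x|)%R] <= e%:E)%E.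
Proof.
move=> mb e0; pose F (n : nat) := [set x | n.+1%:R < `|b x|].
have mF n : measurable (F n).
  apply: mpred_lt; first exact: measurable_cst.
  exact: measurableT_comp.
have : mu \o F @ \oo --> mu (\bigcap_n F n).
  apply: nonincreasing_cvg_mu => //.
  - by rewrite (le_lt_trans (probability_le1 _ _))// ltry.
  - exact: bigcapT_measurable.
  - move=> m n mn; apply/subsetPset => y; apply: le_lt_trans.
    by rewrite ler_nat.
have -> : \bigcap_n F n = set0.
  apply/seteqP; split=> // x hx.
  have := hx (Num.truncn `|b x|) I; rewrite /F/= ltNge => /negP; apply.
  by apply/ltW; rewrite truncnS_gt.
rewrite measure0 => /fine_cvgP[_ /cvgrPdist_lt /(_ e e0)[n _ hn]].
exists n.+1%:R; split; first by rewrite ltr0n.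
have fin : mu (F n) \is a fin_num by rewrite fin_num_measure.
have := hn n (leqnn n); rewrite /= sub0r normrN => /ltW h.
rewrite -(fineK fin) lee_fin; apply: le_trans h; exact: ler_norm.
Qed.

Lemma real_cocycle_linear e : 0 < e -> exists N A, [/\ measurable A,
  (mu (~` A) <= e%:E)%E &
  forall v x, (N <= norm1 v)%N -> A x -> A (T v x) ->
    `|s v x - mean (s v)| <= e * (norm1 v)%:R].
Proof.
move=> e0.
(* [K] is the constant of [tame_cocycle_le]. Then [lam] makes [K * lam = e / 2], and [eta] makes the
   maximal inequality give at most [e / 2]; the [n + 1] keeps the denominator positive when d =
   0. *)
pose K : R := 3 ^+ d + 16 * 9 ^+ d * d%:R.
have K0 : 0 < K by rewrite ltr_pwDl ?exprn_gt0// !mulr_ge0// exprn_ge0.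
pose lam := e / 2 / K.
have lam0 : 0 < lam by rewrite !divr_gt0.
pose n : R := #|{: 'I_d * bool}|%:R.
pose eta := e / 2 * lam / 9 ^+ d / (n + 1).
have n0 : 0 <= n by exact: ler0n.
have n10 : 0 < n + 1 by rewrite ltr_wpDl.
have p90 : 0 < 9 ^+ d :> R by rewrite exprn_gt0.
have eta0 : 0 < eta by rewrite !divr_gt0// mulr_gt0// divr_gt0.
have [t ht] := mean_ergodic_family T_ergodic (enum {: 'I_d * bool})
  (F := fun e => s (unitv e)) (fun e => Ls _) eta0.
have [b [mb hb]] := cohomologous t.
have e20 : 0 < e / 2 by rewrite divr_gt0.
have [c [c0 hc]] := mu_norm_gt_small mb e20.
pose h := gen_sum (residual t).
have Lh : L1 h by apply: L1_sum => u; exact/L1_norm/L1_residual.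
have h0 x : 0 <= h x by exact: gen_sum_ge0.
have mh : mean h <= n * eta.
  rewrite /h /gen_sum mean_sum => [|u]; last exact/L1_norm/L1_residual.
  apply: (@le_trans _ _ (\sum_(u : 'I_d * bool) eta)).
    by apply: ler_sum => u _; exact: (ht u (mem_enum _ _)).
  by rewrite sumr_const mulr_natl.
have := maximal T (L1_measurable Lh) h0 lam0; rewrite L1_EFin//.
pose C := [set x | ~ forall k,
  \sum_(u <- box k) h (T u x) <= lam * (size (box k : seq G))%:R].
rewrite -/C => hC.
have mC : measurable C.
  apply: mpred_not; apply: mpred_all => k; apply: mpred_le; last exact: measurable_cst.
  apply: measurable_sum => u; apply: act_comp_measurable; exact: L1_measurable Lh.
pose Bb := [set x | c < `|b x|].
have mBb : measurable Bb.
  apply: mpred_lt; first exact: measurable_cst.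
  exact: measurableT_comp.
(* Beyond this length the coboundary, at most [2 c], is below [e / 2 * |v|]. *)
exists (Num.truncn (4 * c / e)).+1, (~` (C `|` Bb)); split.
- by apply: measurableC; exact: measurableU.
- rewrite setCK; apply: le_trans (measureU2 _ mC mBb) _.
  rewrite [e]splitr EFinD; apply: leeD => //; apply: le_trans hC _.
  rewrite -EFinM lee_fin.
  apply: (@le_trans _ _ (lam^-1 * 9 ^+ d * (n * eta))).
    by rewrite ler_wpM2l// mulr_ge0 ?invr_ge0 ?exprn_ge0// ltW.
  have -> : lam^-1 * 9 ^+ d * (n * eta) = e / 2 * (n / (n + 1)).
    by rewrite /eta; field; rewrite !gt_eqF.
  by rewrite -[leRHS]mulr1 (ler_wpM2l (ltW e20))// ler_pdivrMr// mul1r lerDl.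
move=> v x Nv; rewrite setCU => -[/contrapT Cx Bx] [/contrapT Cvx Bvx].
have bx : `|b x| <= c by rewrite leNgt; apply/negP.
have bvx : `|b (T v x)| <= c by rewrite leNgt; apply/negP.
have tx : tame T (residual t) lam x by [].
have tvx : tame T (residual t) lam (T v x) by [].
have R1 := tame_cocycle_le (zact0 T) (zactD T) (residualD t) (ltW lam0) tx tvx.
have -> : s v x - mean (s v) = (b (T v x) - b x) + residual t v x.
  by rewrite {1}hb /residual addrA.
rewrite -/K in R1.
have KE : K * lam = e / 2 by rewrite /lam; field; rewrite gt_eqF.
rewrite KE in R1.
have Nv' : 4 * c / e <= (norm1 v)%:R.
  apply/ltW; apply: lt_le_trans (truncnS_gt _) _.
  by rewrite ler_nat.
have : 4 * c <= e * (norm1 v)%:R by rewrite [leRHS]mulrC -ler_pdivrMr.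
have := ler_normD (b (T v x) - b x) (residual t v x).
have := ler_normB (b (T v x)) (b x).
by clear hC hc ht; lra.
Qed.
End real_cocycle.

Section vector_cocycle.
Context (R : realType) (dX : measure_display) (X : measurableType dX).
Context (mu : probability X R) (d D : nat) (T : zsystem mu d).
Hypothesis T_ergodic : zergodic T.
Local Notation G := 'cV[int]_d.
Local Notation H := 'cV[int]_D.

Lemma zlenE n (v : 'cV[int]_n) : zlen R v = (norm1 v)%:R.
Proof.
rewrite /zlen /l1norm /norm1 natr_sum; apply: eq_bigr => i _.
by rewrite mxE natr_absz intr_norm.
Qed.

Variable sigma : G -> X -> H.
Hypothesis sigma_cocycle : full_cocycle T sigma.
Hypothesis sigma_int : forall g, (\int[mu]_x (zlen R (sigma g x))%:E < +oo)%E.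

Definition coord i g x : R := (sigma g x i 0)%:~R.

Let coordD i g k x : coord i (g + k) x = coord i g (T k x) + coord i k x.
Proof. by rewrite /coord (sigma_cocycle.2 g k x) mxE intrD. Qed.

Let L1_coord i g : L1 mu (coord i g).
Proof.
have ms : mdisc (sigma g) by move=> h; exact: sigma_cocycle.1.
apply/integrableP; split.
  by apply/measurable_EFinP; exact: (measurable_fun_discE (fun w : H => (w i 0)%:~R : R) ms).
apply: le_lt_trans (sigma_int g); apply: ge0_le_integral => //.
- apply/measurable_EFinP; apply: measurableT_comp => //.
  exact: (measurable_fun_discE (fun w : H => (w i 0)%:~R : R) ms).
- by apply/measurable_EFinP; exact: (measurable_fun_discE (fun w : H => zlen R w) ms).
- move=> x _; rewrite lee_fin /zlen /l1norm (bigD1 i)//= mxE lerDl.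
  exact: sumr_ge0.
Qed.

Definition drift : 'M[R]_(D, d) := \matrix_(i, j) mean mu (coord i (delta_mx j 0)).

Lemma driftE v i : (drift *m real_vec R v) i 0 = mean mu (coord i v).
Proof.
pose m (g : G) := mean mu (coord i g).
have mD g k : m (g + k) = m g + m k.
  exact: (mean_cocycleD (coordD i) (L1_coord i)).
have m0 : m 0 = 0 by have := mD 0 0; rewrite addr0; lra.
have mN g : m (- g) = - m g by have := mD (- g) g; rewrite addNr m0; lra.
have mMn g n : m (g *+ n) = m g *+ n.
  by elim: n => [|n IH]; rewrite ?mulr0n// !mulrS mD IH.
have mZ g (z : int) : m (z *: g) = z%:~R * m g.
  have -> : z *: g = g *~ z by rewrite -{1}[z]intz scaler_int.
  case: z => n; first by rewrite -!pmulrn mMn mulr_natl.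
  by rewrite NegzE !mulrNz mN -!pmulrn mMn mulNr mulr_natl.
have msum (F : 'I_d -> G) : m (\sum_j F j) = \sum_j m (F j).
  exact: (big_morph m mD m0).
rewrite -/(m v) {2}(matrix_sum_delta v) msum mxE; apply: eq_bigr => j _.
by rewrite big_ord1 mZ !mxE mulrC.
Qed.

Theorem cocycle_linear e : 0 < e -> exists (N : nat) (A : set X), [/\ measurable A,
  ((1 - e)%:E < mu A)%E &
  forall v x, N%:R <= zlen R v -> (A `&` T v @^-1` A) x ->
    l1norm (real_vec R (sigma v x) - drift *m real_vec R v) <= e * zlen R v].
Proof.
(* Dividing by D+1 and not D gives the strict inequality for the measure of the set, and a nonzero
   denominator for D = 0. *)
move=> e0; pose e' := e / D.+1%:R.
have D0 : 0 < D.+1%:R :> R by rewrite ltr0n.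
have e'0 : 0 < e' by rewrite divr_gt0.
have /choice[NA hNA] : forall i : 'I_D, exists NA : nat * set X, [/\ measurable NA.2,
    (mu (~` NA.2) <= e'%:E)%E & forall v x, (NA.1 <= norm1 v)%N -> NA.2 x -> NA.2 (T v x) ->
    `|coord i v x - mean mu (coord i v)| <= e' * (norm1 v)%:R].
  move=> i; have [N [A hA]] := real_cocycle_linear T_ergodic (coordD i) (L1_coord i) e'0.
  by exists (N, A).
exists (\max_i (NA i).1), (~` \big[setU/set0]_(i < D) ~` (NA i).2).
have mU : measurable (\big[setU/set0]_(i < D) ~` (NA i).2).
  by apply: bigsetU_measurable => i _; apply: measurableC; have [] := hNA i.
split; first exact: measurableC.
- rewrite probability_setC// EFinB.
  have fin : mu (\big[setU/set0]_(i < D) ~` (NA i).2) \is a fin_num.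
    by rewrite fin_num_measure.
  have : (mu (\big[setU/set0]_(i < D) ~` (NA i).2) <= (D%:R * e')%:E)%E.
    apply: le_trans (measure_bigsetU_le _ (c := e') _ _) _.
    + by move=> i; apply: measurableC; have [] := hNA i.
    + by move=> i; have [] := hNA i.
    + by rewrite /index_enum -enumT -cardT card_ord.
  rewrite -(fineK fin) -EFinB lee_fin lte_fin => h.
  rewrite ltrD2l ltrN2; apply: le_lt_trans h _.
  by rewrite /e' mulrCA gtr_pMr// ltr_pdivrMr// mul1r ltr_nat.
move=> v x; rewrite zlenE ler_nat => Nv [Ax ATx].
have NA_in i y : (~` \big[setU/set0]_(i < D) ~` (NA i).2) y -> (NA i).2 y.
  move=> hy; apply: contrapT => nA; apply: hy.
  by rewrite (bigD1 i)//=; left.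
apply: (@le_trans _ _ (\sum_(i < D) e' * (norm1 v)%:R)).
  apply: ler_sum => i _; have [_ _ hi] := hNA i.
  have -> : (real_vec R (sigma v x) - drift *m real_vec R v) i 0 =
      coord i v x - mean mu (coord i v) by rewrite -driftE /coord !mxE.
  apply: hi; [|exact: NA_in Ax|exact: NA_in ATx].
  by apply: leq_trans Nv; exact: leq_bigmax.
rewrite sumr_const card_ord -[leLHS]mulr_natl mulrA ler_wpM2r//.
by rewrite /e' mulrCA ger_pMr// ler_pdivrMr// mul1r ler_nat.
Qed.
End vector_cocycle.

(** * Stable orbit equivalences *)

Lemma ergodic_sweep (R : realType) dX (X : measurableType dX) (mu : probability X R)
    d (T : zsystem mu d) (A : set X) : zergodic T -> measurable A -> (0 < mu A)%E ->
  {ae mu, forall x, exists g, A (T g x)}.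
Proof.
move=> T_ergodic mA A0; pose B := [set x | exists g, A (T g x)].
have mB : measurable B by apply: mpred_ex => g; exact: mpred_act.
have [|B0|B1] := T_ergodic B mB.
- move=> g; apply/seteqP; split=> x [k].
    by rewrite -zactD => Ak; exists (k + g).
  by move=> Ak; exists (k - g); rewrite -zactD subrK.
- have : (mu A <= mu B)%E.
    by apply: le_measure; rewrite ?inE// => x Ax; exists 0; rewrite zact0.
  by rewrite B0 leNgt A0.
- apply: (conull_ae mB) => //.
  by rewrite probability_setC// B1 subee.
Qed.

Section soe_basics.
Context (R : realType) (dX dY : measure_display).
Context (X : measurableType dX) (Y : measurableType dY).
Context (mu : probability X R) (nu : probability Y R) (m n : nat).
Context (T : zsystem mu m) (S : zsystem nu n) (Phi : soe T S).
Local Notation U := (soe_dom Phi).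
Local Notation V := (soe_img Phi).
Local Notation f := (soe_map Phi).
Local Notation fi := (soe_inv Phi).

Lemma soe_map_img x : U x -> V (f x).
Proof. exact: (set_bij_homo (soe_bij Phi)). Qed.

Lemma soe_map_inj x y : U x -> U y -> f x = f y -> x = y.
Proof. by move=> Ux Uy; apply: (set_bij_inj (soe_bij Phi)); rewrite inE. Qed.

Lemma soe_mapK x : U x -> fi (f x) = x.
Proof.
by move=> Ux; rewrite /soe_inv pinvKV ?inE//; exact: set_bij_inj (soe_bij Phi).
Qed.

Lemma soe_invK y : V y -> f (fi y) = y.
Proof.
move=> Vy; rewrite /soe_inv pinvK// inE.
exact: (set_bij_surj (soe_bij Phi)).
Qed.

Lemma soe_inv_dom y : V y -> U (fi y).
Proof.
move=> Vy; have [x Ux <-] := set_bij_surj (soe_bij Phi) Vy.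
by rewrite soe_mapK.
Qed.

(** The compression constant: [soe_map] multiplies measure by it. *)
Definition soe_ratio : R := fine (nu V) / fine (mu U).

Lemma soe_fine_gt0 : 0 < fine (mu U) /\ 0 < fine (nu V).
Proof.
have fU : mu U \is a fin_num by rewrite fin_num_measure//; exact: soe_dom_measurable.
have fV : nu V \is a fin_num by rewrite fin_num_measure//; exact: soe_img_measurable.
by split; rewrite -lte_fin fineK//; [exact: soe_dom_gt0|exact: soe_img_gt0].
Qed.

Lemma soe_ratio_gt0 : 0 < soe_ratio.
Proof. by have [? ?] := soe_fine_gt0; rewrite divr_gt0. Qed.

Lemma mpred_soe_map (B : set Y) : measurable B -> mpred (fun x => U x /\ B (f x)).
Proof.
move=> mB; exact: (soe_map_measurable (soe_dom_measurable Phi) mB).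
Qed.

Lemma mpred_soe_inv (A : set X) : measurable A -> mpred (fun y => V y /\ A (fi y)).
Proof.
move=> mA; exact: (soe_inv_measurable (soe_img_measurable Phi) mA).
Qed.

Lemma soe_scale (B : set Y) : measurable B -> B `<=` V ->
  nu B = (soe_ratio%:E * mu (U `&` f @^-1` B))%E.
Proof.
move=> mB BV; have [u0 v0] := soe_fine_gt0.
have fB : nu B \is a fin_num by rewrite fin_num_measure.
have fA : mu (U `&` f @^-1` B) \is a fin_num.
  by rewrite fin_num_measure//; exact: mpred_soe_map.
have := soe_measure mB BV.
rewrite -(fineK fB) -(fineK fA) -EFinM /soe_ratio.
move: (fine (nu B)) (fine (mu (_ `&` _))) => b a h; congr EFin.
have -> : fine (nu V) / fine (mu U) * a = fine (nu V) * (a / fine (mu U)) by ring.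
by rewrite h mulrCA divff ?mulr1// gt_eqF.
Qed.

Lemma soe_ae_pullback (P : Y -> Prop) : {ae nu, forall y, P y} ->
  {ae mu, forall x, U x -> P (f x)}.
Proof.
move=> /ae_conull[A [mA A0 AP]].
have mB : measurable (V `&` ~` A).
  by apply: measurableI; [exact: soe_img_measurable|exact: measurableC].
have B0 : nu (V `&` ~` A) = 0%E.
  by apply: (measure0S mB (measurableC mA)) => // y [].
exists (U `&` f @^-1` (V `&` ~` A)); split; first exact: mpred_soe_map.
  have := soe_scale mB (fun y => @proj1 _ _); rewrite B0 => /esym/eqP.
  by rewrite mule_eq0 eqe gt_eqF ?soe_ratio_gt0//= => /eqP.
move=> x /= /not_implyP[Ux nP]; split=> //; split; first exact: soe_map_img.
by move=> /AP.
Qed.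

Lemma soe_ae_pushforward (P : X -> Prop) : {ae mu, forall x, U x -> P x} ->
  {ae nu, forall y, V y -> P (fi y)}.
Proof.
move=> /ae_conull[A [mA A0 AP]].
have mB : measurable [set y | V y /\ (~` A) (fi y)].
  by apply: mpred_soe_inv; exact: measurableC.
exists [set y | V y /\ (~` A) (fi y)]; split => //.
  rewrite soe_scale//; last by move=> y [].
  rewrite (_ : mu _ = 0%E) ?mule0//.
  apply: (measure0S (B := ~` A)) => //; [exact: mpred_soe_map|exact: measurableC|].
  by move=> x /= [Ux [_]]; rewrite soe_mapK.
move=> y /= /not_implyP[Vy nP]; split=> // Af; apply: nP; apply: AP => //.
exact: soe_inv_dom.
Qed.

Lemma soe_sym_bij : set_bij V U fi.
Proof. exact: bijpinv_bij (soe_bij Phi). Qed.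

Lemma soe_sym_inv x : U x -> pinv V fi x = f x.
Proof.
move=> Ux; have := soe_map_img Ux => Vf.
rewrite -{1}(soe_mapK Ux) pinvKV ?inE//.
exact: set_bij_inj soe_sym_bij.
Qed.

Lemma soe_sym_measurable : measurable_fun U (pinv V fi).
Proof.
apply: (eq_measurable_fun f); last exact: soe_map_measurable.
by move=> x; rewrite inE => Ux; rewrite soe_sym_inv.
Qed.

Lemma soe_sym_measure (A : set X) : measurable A -> A `<=` U ->
  fine (nu (V `&` fi @^-1` A)) / fine (nu V) = fine (mu A) / fine (mu U).
Proof.
move=> mA AU; have mB : measurable (V `&` fi @^-1` A) by exact: mpred_soe_inv.
rewrite -(soe_measure mB (fun y => @proj1 _ _)); congr (fine (mu _) / _).
apply/seteqP; split=> [x [Ux [_]]/=|x Ax]; first by rewrite soe_mapK.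
have Ux := AU x Ax; split=> //; split; first exact: soe_map_img.
by rewrite /= soe_mapK.
Qed.

Lemma soe_orbit_iff x : U x ->
  f @` (zorbit T x `&` U) = zorbit S (f x) `&` V ->
  forall g, U (T g x) -> exists h, f (T g x) = S h (f x).
Proof.
move=> Ux E g Ug; have : (f @` (zorbit T x `&` U)) (f (T g x)).
  by exists (T g x) => //; split=> //; exists g.
by rewrite E => -[[h _ hE] _]; exists h.
Qed.

Lemma soe_sym_orbit : {ae nu, forall y, V y ->
  fi @` (zorbit S y `&` V) = zorbit T (fi y) `&` U}.
Proof.
have := soe_ae_pushforward (soe_orbit Phi); apply: filterS => y h Vy.
have {h} := h Vy; rewrite soe_invK// => E.
apply/seteqP; split=> [x [y' hy <-]|x [ox Ux]].
  by move: hy; rewrite -E => -[x' [ox Ux] <-]; rewrite soe_mapK.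
exists (f x); last by rewrite soe_mapK.
by rewrite -E; exists x.
Qed.

Definition soe_sym : soe S T :=
  SOE (soe_img_measurable Phi) (soe_dom_measurable Phi)
    (soe_img_gt0 Phi) (soe_dom_gt0 Phi) soe_sym_bij
    (@soe_inv_measurable _ _ _ _ _ _ _ _ _ _ _ Phi) soe_sym_measurable
    soe_sym_measure soe_sym_orbit.

(** The double inverse agrees with [soe_map] on U only, so the comparison is made at returns to
    U. *)
Lemma soe_sym_beta g x : U x -> U (T g x) ->
  soe_beta soe_sym g x = soe_alpha Phi g x.
Proof.
move=> Ux Ug; rewrite /soe_beta /soe_alpha /transfer; congr (xget 0 _).
have E z : U z -> soe_inv soe_sym z = f z by exact: soe_sym_inv.
by apply/seteqP; split=> h /=; rewrite !E.
Qed.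

Lemma ssoe_one_sym : ssoe_one Phi -> ssoe_one soe_sym.
Proof.
move=> [[sigma [sc sa si]] hT]; split; first exact: hT.
exists sigma; split=> // g; have := sa g; apply: filterS => x h [Ux Ug].
by rewrite h// soe_sym_beta.
Qed.

Hypotheses (T_free : zfree T) (S_free : zfree S) (T_ergodic : zergodic T).

(** Gathers on one invariant conull set all that holds almost everywhere, including freeness of [S]
    at image points, so that identities for alpha become pointwise. *)
Record soe_good (X0 : set X) : Prop := SoeGood {
  good_measurable : measurable X0;
  good_conull : mu (~` X0) = 0%E;
  good_invariant : forall g x, X0 x -> X0 (T g x);
  good_free : forall x, X0 x -> injective (fun g => T g x);
  good_free_img : forall x, X0 x -> U x -> injective (fun h => S h (f x));
  good_orbit : forall x, X0 x -> U x ->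
    f @` (zorbit T x `&` U) = zorbit S (f x) `&` V;
  good_sweep : forall x, X0 x -> exists g, U (T g x)
}.

Lemma soe_good_ex (P : X -> Prop) : {ae mu, forall x, P x} ->
  exists2 X0, soe_good X0 & X0 `<=` P.
Proof.
move=> aeP; have h1 := soe_ae_pullback S_free.
have h2 := ergodic_sweep T_ergodic (soe_dom_measurable Phi) (soe_dom_gt0 Phi).
have h6 := ae_and (ae_and (ae_and h1 h2) (ae_and T_free (soe_orbit Phi))) aeP.
have [X0 [mX X00 X0s X0T]] := conull_invariant T h6.
exists X0; last by move=> x /X0s[].
by split=> // x /X0s[[[? ?] [? ?]] ?].
Qed.

Section good.
Variables (X0 : set X) (X0_good : soe_good X0).
Local Notation alpha := (soe_alpha Phi).

Lemma alphaP g x : X0 x -> U x -> U (T g x) -> f (T g x) = S (alpha g x) (f x).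
Proof.
move=> x0 Ux Ug; rewrite /alpha /transfer.
case: xgetP => [h _ //|h].
have [k hk] := soe_orbit_iff Ux (good_orbit X0_good x0 Ux) Ug.
by have := h k.
Qed.

Lemma alpha_uniq g x h : X0 x -> U x -> U (T g x) -> f (T g x) = S h (f x) ->
  alpha g x = h.
Proof.
move=> x0 Ux Ug E; apply: (good_free_img X0_good x0 Ux).
by rewrite -E alphaP.
Qed.

Lemma alphaD g k x : X0 x -> U x -> U (T k x) -> U (T (g + k) x) ->
  alpha (g + k) x = alpha g (T k x) + alpha k x.
Proof.
move=> x0 Ux Uk Ugk; apply: alpha_uniq => //.
rewrite zactD alphaP ?zactD//; last 2 first.
- exact: good_invariant.
- by rewrite -zactD.
by rewrite alphaP.
Qed.

Lemma beta_alpha g x : X0 x -> U x -> U (T g x) ->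
  [/\ V (f x), V (S (alpha g x) (f x)) & soe_beta Phi (alpha g x) (f x) = g].
Proof.
move=> x0 Ux Ug; have fE := alphaP x0 Ux Ug.
split; [exact: soe_map_img|by rewrite -fE; exact: soe_map_img|].
apply: (good_free X0_good x0); rewrite /soe_beta /transfer.
case: xgetP => [h _ /=|/(_ g)/=]; last by rewrite -fE !soe_mapK.
by rewrite -fE !soe_mapK.
Qed.

Lemma mpred_alpha (y0 : Y) g h :
  mpred (fun x => [/\ X0 x, U x, U (T g x) & alpha g x = h]).
Proof.
have [rY] := standard_borelP y0 (zsystem_standard S).
have mU := soe_dom_measurable Phi.
(* [soe_map] is measurable only on U; the constant extension makes [mpred_eq] applicable. *)
pose f' x := if pselect (U x) then f x else y0.
have mf' : measurable_fun setT f'.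
  apply: measurable_funTP => A mA.
  apply: (mpred_ext (P := fun x => (U x /\ A (f x)) \/ (~ U x /\ A y0))).
    move=> x; rewrite /f'; case: pselect => Ux; split=> //.
    - by case=> [[]//|[]//].
    - by left.
    - by case=> [[]//|[]//].
    - by right.
  apply: mpred_or; first exact: mpred_soe_map.
  by apply: mpred_and; [exact: mpred_not|exact: mpred_cst].
apply: (mpred_ext (P := fun x => (X0 x /\ U x) /\ (U (T g x) /\
    f' (T g x) = S h (f' x)))).
  move=> x; rewrite /f'.
  case: (pselect (U x)) => Ux; last by split=> [[[]]//|[]//].
  case: (pselect (U (T g x))) => Ug; last by split=> [[_ []]//|[]//].
  split=> [[[x0 _] [_ E]]|[x0 _ _ E]].
    by split=> //; exact: alpha_uniq.
  by rewrite alphaP// E.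
apply: mpred_and; first by apply: mpred_and => //; exact: good_measurable.
apply: mpred_and; first exact: mpred_act.
apply: (mpred_eq rY).
  by apply: measurableT_comp => //; exact: zact_measurable.
by apply: measurableT_comp => //; exact: zact_measurable.
Qed.

End good.
End soe_basics.

(** * Recurrence and invertibility of the drift *)

Lemma sum_le1 (R : numDomainType) (p : nat -> bool) a K :
  (forall k l, (k < l)%N -> p k -> p l -> False) ->
  \sum_(k <- iota a K) (p k)%:R <= 1 :> R.
Proof.
move=> hp; elim: K a => [|K IH] a; first by rewrite big_nil ler01.
rewrite big_cons; case pa: (p a); last by rewrite add0r.
rewrite big_seq big1 ?addr0// => l; rewrite mem_iota => /andP[al _].
by case pl: (p l) => //; case: (hp a l al pa pl).
Qed.

Section recurrence.
Context (R : realType) (dX : measure_display) (X : measurableType dX).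
Context (mu : probability X R) (d : nat) (T : zsystem mu d).

(* The translates of a wandering set are disjoint. *)
Lemma wandering_null (W : set X) (e : 'cV[int]_d) : measurable W ->
  (forall x k, W x -> (0 < k)%N -> ~ W (T (e *+ k) x)) -> mu W = 0%E.
Proof.
move=> mW hW.
have fin : mu W \is a fin_num by rewrite fin_num_measure.
have hK K : K%:R * fine (mu W) <= 1.
  pose l := [seq e *+ k | k <- iota 0 K].
  have mI : measurable_fun setT (\1_W : X -> R) by exact: measurable_indic.
  have I0 (x : X) : 0 <= \1_W x :> R by rewrite indicE.
  have := integral_sum_act T l mI I0 ler01.
  rewrite mul1r integral_indic// setIT size_map size_iota => E.
  suff : (\int[mu]_x (1 * \sum_(u <- l) \1_W (T u x))%:E <= 1)%E.
    by rewrite E -lee_fin EFinM fineK.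
  have -> : 1%E = (\int[mu]_x (cst 1%:E) x)%E :> \bar R.
    by rewrite integral_cst// mul1e; exact/esym/probability_setT.
  apply: ge0_le_integral => //.
  - by move=> x _; rewrite lee_fin mul1r sumr_ge0// => u _; rewrite indicE.
  - apply/measurable_EFinP; apply: measurable_funM; first exact: measurable_cst.
    by apply: measurable_sum => u; exact: (act_comp_measurable T u mI).
  - move=> x _; rewrite lee_fin mul1r big_map.
    under eq_bigr do rewrite indicE.
    apply: sum_le1 => k k' kk' /set_mem Wk /set_mem Wk'.
    apply: (hW _ (k' - k)%N Wk); first by rewrite subn_gt0.
    by rewrite -zactD -mulrnDr subnK// ltnW.
rewrite -(fineK fin); congr EFin; apply/eqP.
rewrite eq_le fine_ge0// andbT leNgt; apply/negP => a0.
have [k hk] := ex_natinv_lt a0.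
have := hK k.+1; rewrite leNgt => /negP; apply.
by rewrite -ltr_pdivrMl ?ltr0n// mulr1.
Qed.

(** Points that never return at a positive multiple of N+1 form a wandering set for [e *+ N.+1]. Off
    all these null sets there are arbitrarily late returns. *)
Lemma recurrence (B : set X) (e : 'cV[int]_d) : measurable B -> (0 < mu B)%E ->
  exists2 x, B x & forall N, exists2 k, (N <= k)%N & B (T (e *+ k) x).
Proof.
move=> mB B0.
pose W N := [set x | B x /\ forall k, (0 < k)%N -> ~ B (T (e *+ (k * N.+1)) x)].
have mW N : measurable (W N).
  apply: mpred_and => //; apply: mpred_all => k.
  apply: mpred_imp; first exact: mpred_cst.
  by apply: mpred_not; exact: mpred_act.
have W0 N : mu (W N) = 0%E.
  apply: (@wandering_null _ (e *+ N.+1)) => // x k [_ hx] k0 [Bk _].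
  by apply: (hx k k0); rewrite mulnC mulrnA.
have mU : measurable (~` [set x | exists N, W N x]).
  by apply: measurableC; exact: mpred_ex.
have [x [Bx nW]] := nonnull_meets_conull mB mU B0
  ltac:(by rewrite setCK; exact: measure0_bigcup).
exists x => // N; apply: contrapT => hN; apply: nW; exists N; split=> // k k0 Bk.
apply: hN; exists (k * N.+1)%N => //.
by rewrite (leq_trans (leqnSn N))// leq_pmull.
Qed.
End recurrence.

Section asymptotically_linear.
Context (R : realType) (dX : measure_display) (X : measurableType dX).
Context (mu : probability X R) (m n : nat) (T : zsystem mu m).

(** The condition of [M_kakutani] for an arbitrary family of maps, with a rectangular matrix because
    d = D is yet to be proved. *)
Definition asym_linear (sigma : 'cV[int]_m -> X -> 'cV[int]_n) (M : 'M[R]_(n, m)) :=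
  forall e, 0 < e -> exists (N : nat) (A : set X), [/\ measurable A,
    ((1 - e)%:E < mu A)%E &
    forall v x, N%:R <= zlen R v -> (A `&` T v @^-1` A) x ->
      l1norm (real_vec R (sigma v x) - M *m real_vec R v) <= e * zlen R v].

End asymptotically_linear.

Section l1norm_theory.
Context (R : realType).

Lemma l1norm_ge0 n (w : 'cV[R]_n) : 0 <= l1norm w.
Proof. exact: sumr_ge0. Qed.

Lemma l1normD n (v w : 'cV[R]_n) : l1norm (v + w) <= l1norm v + l1norm w.
Proof.
by rewrite /l1norm -big_split/=; apply: ler_sum => i _; rewrite mxE ler_normD.
Qed.

Lemma l1normZ n a (v : 'cV[R]_n) : l1norm (a *: v) = `|a| * l1norm v.
Proof. by rewrite /l1norm mulr_sumr; apply: eq_bigr => i _; rewrite mxE normrM. Qed.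

Lemma l1norm_eq0 n (v : 'cV[R]_n) : l1norm v = 0 -> v = 0.
Proof.
move=> /eqP; rewrite psumr_eq0// => /allP h; apply/matrixP => i j.
rewrite (ord1 j) mxE; apply/eqP; rewrite -normr_eq0.
by apply: (implyP (h i _)) => //; rewrite mem_index_enum.
Qed.

Definition mxnorm m n (M : 'M[R]_(m, n)) : R := \sum_i \sum_j `|M i j|.

Lemma mxnorm_ge0 m n (M : 'M[R]_(m, n)) : 0 <= mxnorm M.
Proof. by apply: sumr_ge0 => i _; exact: sumr_ge0. Qed.

Lemma l1norm_mulmx m n (M : 'M[R]_(m, n)) v : l1norm (M *m v) <= mxnorm M * l1norm v.
Proof.
rewrite /l1norm /mxnorm mulr_suml; apply: ler_sum => i _.
rewrite mxE mulr_suml; apply: le_trans (ler_norm_sum _ _ _) _.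
apply: ler_sum => j _; rewrite normrM ler_wpM2l//.
by rewrite (bigD1 j)//= lerDl sumr_ge0.
Qed.

Lemma norm1D n (u v : 'cV[int]_n) : (norm1 (u + v) <= norm1 u + norm1 v)%N.
Proof.
rewrite /norm1 -big_split/=; apply: leq_sum => i _.
by rewrite mxE; move: (u i _) (v i _) => a b; lia.
Qed.

Lemma norm1N n (u : 'cV[int]_n) : norm1 (- u) = norm1 u.
Proof. by apply: eq_bigr => i _; rewrite mxE abszN. Qed.

Lemma norm1_0 n : norm1 (0 : 'cV[int]_n) = 0%N.
Proof. by apply/eqP; rewrite norm1_eq0. Qed.

Lemma real_vecMn n (u : 'cV[int]_n) k : real_vec R (u *+ k) = k%:R *: real_vec R u.
Proof. by apply/matrixP => i j; rewrite !mxE mulmxnE rmorphMn/= mulr_natl. Qed.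

End l1norm_theory.

(** * The drifts of the two cocycles are mutually inverse *)

Section drift_inverse.
Context (R : realType) (dX dY : measure_display).
Context (X : measurableType dX) (Y : measurableType dY).
Context (mu : probability X R) (nu : probability Y R) (m n : nat).
Context (T : zsystem mu m) (S : zsystem nu n) (Phi : soe T S).
Hypotheses (T_free : zfree T) (S_free : zfree S) (T_ergodic : zergodic T).
Local Notation U := (soe_dom Phi).
Local Notation V := (soe_img Phi).
Local Notation f := (soe_map Phi).
Variables (sigma : 'cV[int]_m -> X -> 'cV[int]_n) (tau : 'cV[int]_n -> Y -> 'cV[int]_m).
Hypothesis sigmaE : forall g, {ae mu, forall x, (U `&` T g @^-1` U) x ->
  sigma g x = soe_alpha Phi g x}.
Hypothesis tauE : forall h, {ae nu, forall y, (V `&` S h @^-1` V) y ->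
  tau h y = soe_beta Phi h y}.
Variables (M : 'M[R]_(n, m)) (M' : 'M[R]_(m, n)).
Hypotheses (sigmaM : asym_linear T sigma M) (tauM : asym_linear S tau M').

Let good_set : exists X0, [/\ soe_good Phi X0,
  forall g x, X0 x -> U x -> U (T g x) -> sigma g x = soe_alpha Phi g x &
  forall h x, X0 x -> U x -> V (S h (f x)) -> tau h (f x) = soe_beta Phi h (f x)].
Proof.
have h1 := ae_all sigmaE; have h2 := soe_ae_pullback Phi (ae_all tauE).
have [X0 gX0 X0s] := soe_good_ex Phi T_free S_free T_ergodic (ae_and h1 h2).
exists X0; split=> // [g x /X0s[hx _] Ux Ug|h x /X0s[_ hx] Ux Vh].
  by apply: hx.
by apply: hx => //; split=> //; exact: soe_map_img.
Qed.

(** Otherwise U would be covered, up to a null set, by the complement of A and the part of U sent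
    outside A', of measures below [e] and [e / soe_ratio Phi]. *)
Lemma return_set A A' e : measurable A -> measurable A' ->
  ((1 - e)%:E < mu A)%E -> ((1 - e)%:E < nu A')%E ->
  e * (1 + (soe_ratio Phi)^-1) < fine (mu U) ->
  (0 < mu [set x | A x /\ (U x /\ A' (f x))])%E.
Proof.
move=> mA mA' eA eA' he.
have mU := soe_dom_measurable Phi; have mV := soe_img_measurable Phi.
have r0 := soe_ratio_gt0 Phi.
have compl (d0 : measure_display) (Z : measurableType d0) (la : probability Z R) B :
    measurable B -> ((1 - e)%:E < la B)%E -> fine (la (~` B)) < e.
  move=> mB; have fB : la B \is a fin_num by rewrite fin_num_measure.
  rewrite probability_setC// -(fineK fB) lte_fin -EFinB /=; lra.
have c1 := compl _ _ _ _ mA eA; have c2 := compl _ _ _ _ mA' eA'.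
pose C := [set x | U x /\ (V `&` ~` A') (f x)].
have mVA : measurable (V `&` ~` A') by apply: measurableI => //; exact: measurableC.
have mC : measurable C by exact: mpred_soe_map.
have mB : measurable [set x | A x /\ (U x /\ A' (f x))].
  by apply: mpred_and => //; exact: mpred_soe_map.
have cC : fine (mu C) < (soe_ratio Phi)^-1 * e.
  rewrite ltr_pdivlMl//; apply: le_lt_trans c2.
  have fC : mu C \is a fin_num by rewrite fin_num_measure.
  have fA : nu (~` A') \is a fin_num by rewrite fin_num_measure//; exact: measurableC.
  rewrite -lee_fin EFinM !fineK// -(soe_scale mVA (fun y => @proj1 _ _)).
  have mAC' : measurable (~` A') by exact: measurableC.
  by apply: le_measure; rewrite ?inE// => y [].
rewrite lt_neqAle measure_ge0 andbT eq_sym; apply/eqP => B0.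
have B0' : (mu [set x | A x /\ (U x /\ A' (f x))] <= 0)%E by rewrite B0.
have mAC : measurable (~` A) by exact: measurableC.
have mACC : measurable (~` A `|` C) by exact: measurableU.
have fU : mu U \is a fin_num by rewrite fin_num_measure.
have fC : mu C \is a fin_num by rewrite fin_num_measure.
have fA : mu (~` A) \is a fin_num by rewrite fin_num_measure.
have key : fine (mu U) <= fine (mu (~` A)) + fine (mu C).
  rewrite -lee_fin EFinD !fineK//.
  apply: (@le_trans _ _ (mu ([set x | A x /\ (U x /\ A' (f x))] `|` (~` A `|` C)))).
    apply: le_measure; rewrite ?inE//; first exact: measurableU.
    move=> x Ux; have [Ax|nA] := pselect (A x); last by right; left.
    have [Afx|nAf] := pselect (A' (f x)); first by left.
    by right; right; split=> //; split=> //; exact: soe_map_img.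
  apply: le_trans (measureU2 _ mB mACC) _; rewrite -[leRHS]add0e.
  by apply: leeD; [exact: B0'|exact: measureU2].
move: he; apply/negP; rewrite -leNgt mulrDr mulr1.
apply: le_trans key _; apply: lerD; first exact: ltW.
by rewrite mulrC; exact: ltW.
Qed.

(** At a late return v = k e_j, with h = alpha(v, x) and tau(h, f x) = v, both linear estimates
    apply: h is close to M v and v to M' h. Dividing by k leaves an estimate for e_j itself. *)
Let approx (j : 'I_m) e : 0 < e -> e <= 1 ->
  e * (1 + (soe_ratio Phi)^-1) < fine (mu U) ->
  l1norm (real_vec R (delta_mx j 0) - M' *m M *m real_vec R (delta_mx j 0))
    <= e * (mxnorm M + 1 + mxnorm M').
Proof.
move=> e0 e1 he.
have [N [A [mA eA hA]]] := sigmaM e0; have [N' [A' [mA' eA' hA']]] := tauM e0.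
have [X0 [gX0 sX0 tX0]] := good_set.
have B0 := return_set mA mA' eA eA' he.
set B := [set x | A x /\ (U x /\ A' (f x))] in B0.
have mB : measurable B by apply: mpred_and => //; exact: mpred_soe_map.
have mB0 : measurable (B `&` X0).
  by apply: measurableI => //; exact: good_measurable gX0.
have BX0 : (0 < mu (B `&` X0))%E.
  rewrite lt_neqAle measure_ge0 andbT eq_sym; apply/eqP => h.
  move: B0; rewrite lt_neqAle measure_ge0 andbT eq_sym => /eqP; apply.
  apply: (measure0S mB (measurableU _ _ mB0 (measurableC (good_measurable gX0)))).
    by move=> x Bx; have [x0|] := pselect (X0 x); [left|right].
  apply: measure0U => //; last exact: good_conull gX0.
  by apply: measurableC; exact: good_measurable gX0.
pose u : 'cV[int]_m := delta_mx j 0.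
have nu1 k : norm1 (u *+ k) = k.
  rewrite /norm1 (bigD1 j)//= big1 => [|i ij].
    by rewrite mulmxnE mxE !eqxx addn0 -[_ *+ k]/(k%:R : int) natz.
  by rewrite mulmxnE mxE (negbTE ij) mul0rn.
have [x [[Ax [Ux A'x]] x0] xrec] := recurrence T u mB0 BX0.
(* Ensures that h is long enough for the estimate on tau: for h in [cube n N'] the norm of tau(h, f
   x) is at most K, whereas tau(h, f x) = v has norm k > K. *)
pose K := (\max_(h <- cube n N') norm1 (tau h (f x)))%N.
have [k hk [[Ak [Uk A'k]] _]] := xrec (maxn N (maxn K.+1 1)).
move: hk; rewrite !geq_max => /and3P[Nk Kk k0].
set v := u *+ k in Ak Uk A'k.
have [Vx Vh tauh] := beta_alpha gX0 x0 Ux Uk.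
set h := soe_alpha Phi v x in Vh tauh.
have sE : sigma v x = h by exact: sX0.
have tE : tau h (f x) = v by rewrite tX0.
have fE : f (T v x) = S h (f x) by exact: (alphaP gX0).
have vk : zlen R v = k%:R by rewrite zlenE nu1.
have kR0 : 0 < k%:R :> R by rewrite ltr0n.
have h1 : l1norm (real_vec R h - M *m real_vec R v) <= e * k%:R.
  rewrite -vk -sE; apply: hA; first by rewrite vk ler_nat.
  by split.
have hN' : N'%:R <= zlen R h.
  rewrite zlenE ler_nat leqNgt; apply/negP => hN.
  have : h \in cube n N'.
    rewrite mem_cube; apply/forallP => i.
    by apply: leq_trans (norm1_coord h i) _; exact: ltnW.
  move=> hc; have : (norm1 (tau h (f x)) <= K)%N.
    by rewrite /K (big_rem h)//= leq_maxl.
  by rewrite tE nu1 leqNgt Kk.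
have h2 : l1norm (real_vec R v - M' *m real_vec R h) <= e * zlen R h.
  by rewrite -tE; apply: hA' => //; split=> //=; rewrite -fE.
have hle : zlen R h <= (mxnorm M + e) * k%:R.
  rewrite /zlen -(subrK (M *m real_vec R v) (real_vec R h)).
  apply: le_trans (l1normD _ _) _; rewrite mulrDl addrC; apply: lerD => //.
  by rewrite -vk; exact: l1norm_mulmx.
have E : real_vec R v - M' *m M *m real_vec R v =
    (real_vec R v - M' *m real_vec R h) + M' *m (real_vec R h - M *m real_vec R v).
  by rewrite mulmxBr mulmxA addrA subrK.
have : l1norm (real_vec R v - M' *m M *m real_vec R v) <=
    e * (mxnorm M + 1 + mxnorm M') * k%:R.
  rewrite E; apply: le_trans (l1normD _ _) _.
  have h3 := le_trans (l1norm_mulmx M' _) (ler_wpM2l (mxnorm_ge0 M') h1).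
  have h4 := le_trans h2 (ler_wpM2l (ltW e0) hle).
  apply: le_trans (lerD h4 h3) _.
  have -> : e * (mxnorm M + 1 + mxnorm M') * k%:R =
    e * ((mxnorm M + 1) * k%:R) + mxnorm M' * (e * k%:R) by ring.
  by rewrite lerD2r (ler_wpM2l (ltW e0))// ler_wpM2r// lerD2l.
rewrite real_vecMn -scalemxAr -scalerBr l1normZ gtr0_norm// mulrC.
by rewrite ler_pM2r.
Qed.

Lemma drift_inverse : M' *m M = 1%:M.
Proof.
have [a0 _] := soe_fine_gt0 Phi; have r0 := soe_ratio_gt0 Phi.
set a := fine (mu U) in a0.
pose c := 1 + (soe_ratio Phi)^-1.
have c0 : 0 < c by rewrite addr_gt0// invr_gt0.
pose b := mxnorm M + 1 + mxnorm M'.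
have b0 : 0 < b.
  by rewrite ltr_wpDr ?mxnorm_ge0// ltr_wpDl ?mxnorm_ge0.
have L0 j : real_vec R (delta_mx j 0) - M' *m M *m real_vec R (delta_mx j 0) = 0.
  apply: l1norm_eq0; apply/eqP; rewrite eq_le l1norm_ge0 andbT.
  apply/ler_addgt0Pl => r r0'; rewrite addr0.
  pose e := Num.min 1 (Num.min (a / c / 2) (r / b)).
  have e0 : 0 < e by rewrite !lt_min ltr01 !divr_gt0.
  have := lexx e; rewrite {2}/e !le_min => /and3P[e1 ea er].
  have := approx j e0 e1; rewrite -/c -/b -/a => /(_ _) /le_trans; apply.
    apply: (@le_lt_trans _ _ (a / c / 2 * c)); first by rewrite ler_wpM2r// ltW.
    have -> : a / c / 2 * c = a / 2 by field; rewrite gt_eqF.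
    by rewrite ltr_pdivrMr// ltr_pMr// ltr1n.
  by rewrite -ler_pdivlMr.
have realE j : real_vec R (delta_mx j 0) = delta_mx j 0 :> 'cV[R]_m.
  by apply/matrixP => i k; rewrite !mxE; case: (_ && _).
apply/matrixP => i j; move: (L0 j); rewrite realE -colE => /eqP.
rewrite subr_eq0 => /eqP /matrixP /(_ i 0).
by rewrite !mxE eqxx andbT => ->.
Qed.

End drift_inverse.

(** * Lipschitz extension of cocycles *)

(** Costs are integers, so the infimum in McShane's formula is attained. *)
Lemma int_minimum (E : int -> Prop) (b : int) : (exists z, E z) ->
  (forall z, E z -> b <= z) -> exists2 z, E z & forall z', E z' -> z <= z'.
Proof.
move=> [z0 Ez0] hb.
have ex : exists k : nat, `[< E (b + k%:Z) >].
  exists `|z0 - b|%N; apply/asboolP; have := hb z0 Ez0 => bz0.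
  by have -> : b + `|z0 - b|%N%:Z = z0 by lia.
have [k /asboolP Ek hk] := ex_minnP ex.
exists (b + k%:Z) => // z' Ez'; have bz' := hb z' Ez'.
have := hk `|z' - b|%N; have -> : b + `|z' - b|%N%:Z = z' by lia.
by move=> /(_ (asboolT Ez')); lia.
Qed.

(* McShane's formula [inf_v (a_v + C |w - v|)] extends a Lipschitz function
   from the return set of a point to the whole group.  It is canonical up to the
   additive constant coming from the base point [v0], so its increments form a
   cocycle. *)
Section mcshane.
Context (R : realType) (dX : measure_display) (X : measurableType dX).
Context (mu : probability X R) (d D : nat) (T : zsystem mu d).
Local Notation G := 'cV[int]_d.
Local Notation H := 'cV[int]_D.
Variables (X0 U : set X) (a : G -> X -> H) (C : nat).
Hypotheses (mX0 : measurable X0) (X00 : mu (~` X0) = 0%E).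
Hypothesis X0T : forall g x, X0 x -> X0 (T g x).
Hypotheses (mU : measurable U) (ma : forall g, mdisc (a g)).
Hypothesis sweep : forall x, X0 x -> exists g, U (T g x).
Hypothesis aD : forall g k x, X0 x -> U x -> U (T k x) -> U (T (g + k) x) ->
  a (g + k) x = a g (T k x) + a k x.
Hypothesis a_lip : forall g x i, X0 x -> U x -> U (T g x) ->
  (`|a g x i 0%R| <= C * norm1 g)%N.

Definition cost i x (v0 w v : G) : int :=
  a (v - v0) (T v0 x) i 0 + (C * norm1 (w - v))%:Z.

Definition is_min i x (v0 w : G) (z : int) :=
  (exists2 v, U (T v x) & cost i x v0 w v = z) /\
  forall v, U (T v x) -> z <= cost i x v0 w v.

Let act_sub v w x : T (v - w) (T w x) = T v x.
Proof. by rewrite -zactD subrK. Qed.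

Lemma a_diff x v0 v0' v : X0 x -> U (T v0 x) -> U (T v0' x) -> U (T v x) ->
  a (v - v0) (T v0 x) = a (v - v0') (T v0' x) + a (v0' - v0) (T v0 x).
Proof.
move=> x0 U0 U0' Uv.
have -> : v - v0 = (v - v0') + (v0' - v0) by rewrite addrA subrK.
by rewrite aD ?act_sub//; [exact: X0T|rewrite zactD !act_sub].
Qed.

Lemma is_min_uniq i x v0 w z z' : is_min i x v0 w z -> is_min i x v0 w z' -> z = z'.
Proof.
move=> [[v Uv <-] h] [[v' Uv' <-] h']; apply/eqP; rewrite eq_le.
by apply/andP; split; [exact: h|exact: h'].
Qed.

Lemma is_min_change i x v0 v0' w z : X0 x -> U (T v0 x) -> U (T v0' x) ->
  is_min i x v0 w z -> is_min i x v0' w (z - a (v0' - v0) (T v0 x) i 0).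
Proof.
move=> x0 U0 U0' [[v Uv <-] h].
have E u : U (T u x) -> cost i x v0' w u = cost i x v0 w u - a (v0' - v0) (T v0 x) i 0.
  by move=> Uu; rewrite /cost (a_diff x0 U0 U0' Uu) mxE; ring.
split; first by exists v; rewrite ?E.
by move=> u Uu; rewrite E// lerD2r; exact: h.
Qed.

Lemma cost_lower i x v0 w v : X0 x -> U (T v0 x) -> U (T v x) ->
  - (C * norm1 (w - v0))%:Z <= cost i x v0 w v.
Proof.
move=> x0 U0 Uv; have := @a_lip (v - v0) (T v0 x) i (X0T v0 x0) U0.
rewrite act_sub => /(_ Uv); rewrite /cost.
have : (C * norm1 (v - v0) <= C * norm1 (w - v) + C * norm1 (w - v0))%N.
  rewrite -mulnDr leq_mul2l; apply/orP; right.
  have -> : v - v0 = - (w - v) + (w - v0) by rewrite opprB addrA subrK.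
  by apply: leq_trans (norm1D _ _) _; rewrite norm1N.
move: (a _ _ i 0) (C * norm1 (v - v0))%N (C * norm1 (w - v))%N (C * norm1 (w - v0))%N.
by move=> t p q r; lia.
Qed.

Lemma is_min_ex i x v0 w : X0 x -> U (T v0 x) -> exists z, is_min i x v0 w z.
Proof.
move=> x0 U0.
have [] := @int_minimum (fun z => exists2 v, U (T v x) & cost i x v0 w v = z)
  (- (C * norm1 (w - v0))%:Z).
- by exists (cost i x v0 w v0); exists v0.
- by move=> _ [v Uv <-]; exact: cost_lower.
move=> z zE hz; exists z; split=> // v Uv; apply: hz; by exists v.
Qed.

Lemma is_min_lip i x v0 w w' z z' : is_min i x v0 w z -> is_min i x v0 w' z' ->
  z <= z' + (C * norm1 (w - w'))%:Z.
Proof.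
move=> [_ h] [[v Uv <-] _]; apply: le_trans (h v Uv) _; rewrite /cost.
have : (C * norm1 (w - v) <= C * norm1 (w' - v) + C * norm1 (w - w'))%N.
  rewrite -mulnDr leq_mul2l; apply/orP; right; rewrite addnC.
  by have -> : w - v = (w - w') + (w' - v); [rewrite addrA subrK|exact: norm1D].
move: (a _ _ i 0) (C * norm1 (w - v))%N (C * norm1 (w' - v))%N (C * norm1 (w - w'))%N.
by move=> t p q r; lia.
Qed.

Lemma is_min_act i x v0 k w z : is_min i x v0 (w + k) z ->
  is_min i (T k x) (v0 - k) w z.
Proof.
have E v : cost i (T k x) (v0 - k) w v = cost i x v0 (w + k) (v + k).
  rewrite /cost act_sub; congr (a _ _ _ _ + _).
    by rewrite opprB addrA.
  by congr (Posz (C * norm1 _)%N); rewrite opprD addrACA subrr addr0.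
move=> [[v Uv <-] h]; split.
  exists (v - k); first by rewrite act_sub.
  by rewrite E subrK.
by move=> u Uu; rewrite E; apply: h; rewrite zactD.
Qed.

(** The Lipschitz bound says that no detour through another return v is cheaper than w itself, so
    the formula really extends [a]. *)
Lemma is_min_base i x w : X0 x -> U x -> U (T w x) -> is_min i x 0 w (a w x i 0).
Proof.
move=> x0 Ux Uw; have cE v : cost i x 0 w v = a v x i 0 + (C * norm1 (w - v))%:Z.
  by rewrite /cost subr0 zact0.
split; first by exists w => //; rewrite cE subrr norm1_0 muln0 addr0.
move=> v Uv; rewrite cE.
have := a_diff x0 (v0 := 0) (v0' := v) (v := w).
rewrite zact0 !subr0 => -> //; rewrite mxE.
have := @a_lip (w - v) (T v x) i (X0T v x0) Uv; rewrite act_sub => /(_ Uw).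
move: (a (w - v) _ i 0) (a v x i 0) (C * norm1 (w - v))%N => t s p; lia.
Qed.

(** The base point [v0] cancels in the difference by [is_min_change]. Outside the invariant set [X0]
    no value qualifies, and [extension] takes the default 0, which is still a cocycle there. *)
Definition increment i g x (z : int) := X0 x /\ exists v0 z1 z2,
  [/\ U (T v0 x), is_min i x v0 g z1, is_min i x v0 0 z2 & z = z1 - z2].

Definition extension g x : H := \col_i xget 0 [set z | increment i g x z].

Lemma increment_uniq i g x z z' : increment i g x z -> increment i g x z' -> z = z'.
Proof.
move=> [x0 [v0 [z1 [z2 [U0 m1 m2 ->]]]]] [_ [v0' [z1' [z2' [U0' m1' m2' ->]]]]].
have := is_min_uniq (is_min_change x0 U0 U0' m1) m1'.
have := is_min_uniq (is_min_change x0 U0 U0' m2) m2'.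
by move=> <- <-; lia.
Qed.

Lemma extensionE i g x v0 z1 z2 : X0 x -> U (T v0 x) ->
  is_min i x v0 g z1 -> is_min i x v0 0 z2 -> extension g x i 0 = z1 - z2.
Proof.
move=> x0 U0 m1 m2; rewrite /extension mxE.
have hz : increment i g x (z1 - z2) by split=> //; exists v0, z1, z2.
by case: xgetP => [z _ hz'|/(_ _ hz)//]; exact: increment_uniq hz' hz.
Qed.

Lemma extension_out i g x : ~ X0 x -> extension g x i 0 = 0.
Proof. by move=> nx; rewrite /extension mxE; case: xgetP => // z _ []. Qed.

Lemma extensionD g k x : extension (g + k) x = extension g (T k x) + extension k x.
Proof.
apply/matrixP => i j; rewrite (ord1 j) [RHS]mxE.
have [x0|nx0] := pselect (X0 x); last first.
  rewrite !extension_out// => /(X0T (- k)); first by rewrite -zactD addNr zact0.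
have [v0 U0] := sweep x0.
have [z1 m1] := is_min_ex i (g + k) x0 U0.
have [z2 m2] := is_min_ex i k x0 U0.
have [z3 m3] := is_min_ex i 0 x0 U0.
rewrite (extensionE x0 U0 m1 m3) (extensionE x0 U0 m2 m3).
have U0' : U (T (v0 - k) (T k x)) by rewrite act_sub.
have m2' : is_min i x v0 (0 + k) z2 by rewrite add0r.
rewrite (extensionE (X0T k x0) U0' (is_min_act m1) (is_min_act m2')).
by lia.
Qed.

Lemma mdisc_cost i v0 w v : mdisc (fun x => cost i x v0 w v).
Proof.
rewrite /cost; apply: (@mdisc_comp _ _ _ _ _ (fun h : H => h i 0 + (C * norm1 (w - v))%:Z)).
by move=> h; exact: (mpred_act T v0 (ma (v - v0) h)).
Qed.

Lemma mpred_is_min i v0 w z : mpred (fun x => is_min i x v0 w z).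
Proof.
apply: mpred_and.
  apply: (mpred_ext (P := fun x => exists v, U (T v x) /\ cost i x v0 w v = z)).
    by move=> x; split=> [[v [? ?]]|[v ? ?]]; exists v.
  by apply: mpred_ex => v; apply: mpred_and; [exact: mpred_act|exact: mdisc_cost].
apply: mpred_all => v; apply: mpred_imp; first exact: mpred_act.
apply: (mpred_disc (Q := fun t _ => (z <= t) : Prop) (mdisc_cost i v0 w v)) => t.
exact: mpred_cst.
Qed.

Lemma mdisc_extension g : mdisc (extension g).
Proof.
move=> h.
apply: (mpred_ext (P := fun x => forall i, xget 0 [set z | increment i g x z] = h i 0)).
  move=> x; split=> [E|<- i]; last by rewrite mxE.
  by apply/matrixP => i j; rewrite mxE E (ord1 j).
apply: mpred_all => i.
suff : mdisc (fun x => xget 0 [set z | increment i g x z]) by apply.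
apply: mdisc_xget => [z|]; last by move=> x z z'; exact: increment_uniq.
apply: mpred_and => //; apply: mpred_ex => v0; apply: mpred_ex => z1; apply: mpred_ex => z2.
apply: (mpred_ext (P := fun x => (U (T v0 x) /\ is_min i x v0 g z1) /\
   (is_min i x v0 0 z2 /\ z = z1 - z2))).
  by move=> x; split=> [[[? ?] [? ?]]|[? ? ? ?]].
apply: mpred_and; apply: mpred_and; last exact: mpred_cst.
- exact: mpred_act.
- exact: mpred_is_min.
- exact: mpred_is_min.
Qed.

Lemma extension_base g x : X0 x -> U x -> U (T g x) -> extension g x = a g x.
Proof.
move=> x0 Ux Ug; apply/matrixP => i j; rewrite (ord1 j).
have U0 : U (T 0 x) by rewrite zact0.
rewrite (extensionE x0 U0 (is_min_base i x0 Ux Ug) (is_min_base i x0 Ux U0)).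
have := @aD 0 0 x x0; rewrite addr0 zact0 => /(_ Ux Ux Ux) /matrixP /(_ i 0).
by rewrite mxE; move: (a 0 x i 0) (a g x i 0) => p q; lia.
Qed.

Lemma extension_lip i g x : (`|extension g x i 0%R| <= C * norm1 g)%N.
Proof.
have [x0|nx0] := pselect (X0 x); last by rewrite extension_out// absz0.
have [v0 U0] := sweep x0.
have [z1 m1] := is_min_ex i g x0 U0; have [z2 m2] := is_min_ex i 0 x0 U0.
rewrite (extensionE x0 U0 m1 m2).
have := is_min_lip m1 m2; have := is_min_lip m2 m1.
rewrite subr0 sub0r norm1N; lia.
Qed.

Lemma mcshane_extension (b : G -> X -> H) :
  (forall g, {ae mu, forall x, (U `&` T g @^-1` U) x -> a g x = b g x}) ->
  integrable_extension T U b.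
Proof.
move=> ab; exists extension; split.
- split=> [g h|g k x]; [exact: mdisc_extension|exact: extensionD].
- move=> g; have hX0 : {ae mu, forall x, X0 x} by exact: (conull_ae mX0).
  have := ae_and hX0 (ab g); apply: filterS => x [x0 hx] [Ux Ug].
  by rewrite extension_base// hx.
move=> g; pose c : R := (D * (C * norm1 g))%:R.
apply: (@le_lt_trans _ _ (\int[mu]_x (cst c%:E) x)%E); last first.
  rewrite integral_cst//; apply: lte_mul_pinfty => //.
    by rewrite lee_fin /c ler0n.
  exact: le_lt_trans (probability_le1 mu measurableT) (ltry 1).
apply: ge0_le_integral => //.
- by move=> x _; rewrite lee_fin zlenE.
- apply/measurable_EFinP.
  exact: (measurable_fun_discE (fun w : H => zlen R w) (mdisc_extension g)).
move=> x _; rewrite lee_fin zlenE ler_nat /norm1 -[X in (X * _)%N](card_ord D).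
by rewrite -sum_nat_const; apply: leq_sum => i _; exact: extension_lip.
Qed.

End mcshane.

(** * From Lipschitz bounds to integrable cocycles *)

Section soe_infty_extension.
Context (R : realType) (dX dY : measure_display).
Context (X : measurableType dX) (Y : measurableType dY).
Context (mu : probability X R) (nu : probability Y R) (m n : nat).
Context (T : zsystem mu m) (S : zsystem nu n) (Phi : soe T S).
Hypotheses (T_free : zfree T) (S_free : zfree S) (T_ergodic : zergodic T).
Local Notation U := (soe_dom Phi).

Lemma lipschitz_extension (C : R) :
  (forall g, {ae mu, forall x, (U `&` T g @^-1` U) x ->
     zlen R (soe_alpha Phi g x) <= C * zlen R g}) ->
  integrable_extension T U (soe_alpha Phi).
Proof.
move=> hC; have [X0 gX0 X0s] := soe_good_ex Phi T_free S_free T_ergodic (ae_all hC).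
have [mX0 X00 X0T _ _ _ Xsweep] := gX0.
have mU := soe_dom_measurable Phi.
pose good g x := [/\ X0 x, U x & U (T g x)].
pose a g x := if pselect (good g x) then soe_alpha Phi g x else 0.
have aE g x : X0 x -> U x -> U (T g x) -> a g x = soe_alpha Phi g x.
  by move=> x0 Ux Ug; rewrite /a; case: pselect => // ng; case: ng.
have mgood g : mpred (good g).
  apply: (mpred_ext (P := fun x => X0 x /\ (U x /\ U (T g x)))).
    by move=> x; split=> [[? [? ?]]|[? ? ?]].
  by apply: mpred_and => //; apply: mpred_and => //; exact: mpred_act.
have ma g : mdisc (a g).
  move=> h; apply: (mpred_ext (P := fun x => (good g x /\
    [/\ X0 x, U x, U (T g x) & soe_alpha Phi g x = h]) \/ (~ good g x /\ 0 = h))).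
    move=> x; rewrite /a; case: pselect => hx; split.
    - by case=> [[_ []]//|[]//].
    - by move=> E; left; split=> //; have [] := hx.
    - by case=> [[]//|[]//].
    - by right.
  apply: mpred_or; apply: mpred_and => //.
  - exact: (mpred_alpha gX0 point).
  - exact: mpred_not.
  - exact: mpred_cst.
(* The Lipschitz constant is rounded up to a natural number so that costs are integers. *)
apply: (mcshane_extension (X0 := X0) (a := a) (C := (Num.truncn C).+1)) => //.
- move=> g k x x0 Ux Uk Ugk; rewrite !aE//; first exact: (alphaD gX0).
  + exact: X0T.
  + by rewrite -zactD.
- move=> g x i x0 Ux Ug; rewrite aE//.
  have := X0s x x0 g (conj Ux Ug); rewrite !zlenE => h.
  apply: leq_trans (norm1_coord _ i) _.
  rewrite -(ler_nat R) natrM; apply: le_trans h _.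
  by rewrite ler_wpM2r//; exact/ltW/truncnS_gt.
- move=> g; have hX0 : {ae mu, forall x, X0 x} by exact: (conull_ae mX0).
  by apply: filterS hX0 => x x0 [Ux Ug]; exact: aE.
Qed.

End soe_infty_extension.

(** * Greedy matching of the two spaces *)

(** An atom would be recurrent along the first coordinate axis, hence fixed by a nonzero element,
    against freeness. *)
Lemma zfree_atomless (R : realType) dX (X : measurableType dX) (mu : probability X R)
    n (T : zsystem mu n) : (0 < n)%N -> zfree T -> forall x, mu [set x] = 0%E.
Proof.
move=> n0 T_free x; have [rX] := standard_borelP x (zsystem_standard T).
apply/eqP; rewrite eq_le measure_ge0 andbT leNgt; apply/negP => x0.
have mx := measurable_sing rX x.
pose e : 'cV[int]_n := delta_mx (Ordinal n0) 0.
have [_ -> /(_ 1%N)[k k0 kx]] := recurrence T e mx x0.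
have [A [mA A0 AP]] := ae_conull T_free.
have [_ [-> /AP inj]] := nonnull_meets_conull mx mA x0 A0.
have : e *+ k = 0 by apply: inj; rewrite kx zact0.
move=> /matrixP /(_ (Ordinal n0) 0); rewrite mulmxnE !mxE !eqxx.
by rewrite -[_ *+ k]/(k%:R : int) natz => -[k00]; rewrite k00 in k0.
Qed.

Section matching.
Context (R : realType) (dX dY : measure_display).
Context (X : measurableType dX) (Y : measurableType dY).
Context (mu : probability X R) (nu : probability Y R) (m n : nat).
Context (T : zsystem mu m) (S : zsystem nu n) (Phi : soe T S).
Local Notation G := 'cV[int]_m.
Local Notation H := 'cV[int]_n.
Local Notation U := (soe_dom Phi).
Local Notation V := (soe_img Phi).
Local Notation f := (soe_map Phi).
Local Notation fi := (soe_inv Phi).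
Local Notation c := (soe_ratio Phi).

Definition theta (gh : G * H) x := S gh.2 (f (T gh.1 x)).
Definition eta (gh : G * H) y := T (- gh.1) (fi (S (- gh.2) y)).

Definition matched_dom (gh : G * H) (A : set X) (B : set Y) : set X :=
  [set x | [/\ A x, U (T gh.1 x) & B (theta gh x)]].
Definition matched_img (gh : G * H) (A : set X) (B : set Y) : set Y :=
  [set y | [/\ B y, V (S (- gh.2) y) & A (eta gh y)]].

(** Stage j applies the pair numbered j to whatever is still unmatched on both sides; numbers that
    decode to no pair change nothing. *)
Fixpoint remaining (k : nat) : set X * set Y :=
  if k is j.+1 then
    let A := (remaining j).1 in let B := (remaining j).2 in
    if unpickle j is Some gh then
      (A `\` matched_dom gh A B, B `\` matched_img gh A B)
    else (A, B)
  else (setT, setT).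

(** Where the default pair occurs, [domk] and [imgk] are empty. *)
Definition step (k : nat) : G * H := odflt (0, 0) (unpickle k).

Definition domk k : set X := if unpickle k is Some gh then
  matched_dom gh (remaining k).1 (remaining k).2 else set0.
Definition imgk k : set Y := if unpickle k is Some gh then
  matched_img gh (remaining k).1 (remaining k).2 else set0.

Lemma remaining_domE k x : (remaining k).1 x <-> forall j, (j < k)%N -> ~ domk j x.
Proof.
elim: k => [|k IH] /=; first by split.
split=> [h j|h].
  rewrite ltnS leq_eqVlt => /orP[/eqP ->|jk].
    by move: h; rewrite /domk; case: (unpickle k) => [gh [_]|_ []].
  have [+ _] := IH; apply => //.
  by move: h; case: (unpickle k) => [gh []|].
have hk : (remaining k).1 x by apply/IH => j jk; apply: h; exact: ltnW.
have := h k (ltnSn k); rewrite /domk.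
by case: (unpickle k) => [gh nd|_] //; split.
Qed.

Lemma remaining_imgE k y : (remaining k).2 y <-> forall j, (j < k)%N -> ~ imgk j y.
Proof.
elim: k => [|k IH] /=; first by split.
split=> [h j|h].
  rewrite ltnS leq_eqVlt => /orP[/eqP ->|jk].
    by move: h; rewrite /imgk; case: (unpickle k) => [gh [_]|_ []].
  have [+ _] := IH; apply => //.
  by move: h; case: (unpickle k) => [gh []|].
have hk : (remaining k).2 y by apply/IH => j jk; apply: h; exact: ltnW.
have := h k (ltnSn k); rewrite /imgk.
by case: (unpickle k) => [gh nd|_] //; split.
Qed.

Lemma domkP k x : domk k x -> [/\ (remaining k).1 x, U (T (step k).1 x) &
  (remaining k).2 (theta (step k) x)].
Proof. by rewrite /domk /step; case: (unpickle k). Qed.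

Lemma imgkP k y : imgk k y -> [/\ (remaining k).2 y, V (S (- (step k).2) y) &
  (remaining k).1 (eta (step k) y)].
Proof. by rewrite /imgk /step; case: (unpickle k). Qed.

Lemma domk_uniq x j k : domk j x -> domk k x -> j = k.
Proof.
move=> dj dk; have [hj _ _] := domkP dj; have [hk _ _] := domkP dk.
case: (ltngtP j k) => // [jk|kj].
  by case: ((remaining_domE k x).1 hk j jk dj).
by case: ((remaining_domE j x).1 hj k kj dk).
Qed.

Lemma imgk_uniq y j k : imgk j y -> imgk k y -> j = k.
Proof.
move=> dj dk; have [hj _ _] := imgkP dj; have [hk _ _] := imgkP dk.
case: (ltngtP j k) => // [jk|kj].
  by case: ((remaining_imgE k y).1 hk j jk dj).
by case: ((remaining_imgE j y).1 hj k kj dk).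
Qed.

Lemma thetaK gh x : U (T gh.1 x) -> eta gh (theta gh x) = x.
Proof. by move=> Ug; rewrite /eta /theta zactN soe_mapK// zactN. Qed.

Lemma etaK gh y : V (S (- gh.2) y) -> theta gh (eta gh y) = y.
Proof. by move=> Vh; rewrite /eta /theta zactNK soe_invK// zactNK. Qed.

Lemma theta_img k x : domk k x -> imgk k (theta (step k) x).
Proof.
move=> dx; have [h1 h2 h3] := domkP dx; move: dx h1 h2 h3.
rewrite /domk /imgk /step; case: (unpickle k) => //= gh _ h1 h2 h3.
split=> //; last by rewrite thetaK.
by rewrite /theta zactN; exact: soe_map_img.
Qed.

Lemma eta_dom k y : imgk k y -> domk k (eta (step k) y).
Proof.
move=> dx; have [h1 h2 h3] := imgkP dx; move: dx h1 h2 h3.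
rewrite /domk /imgk /step; case: (unpickle k) => //= gh _ h1 h2 h3.
split=> //; last by rewrite etaK.
by rewrite /eta zactNK; exact: soe_inv_dom.
Qed.

Lemma mpred_theta gh B : measurable B -> mpred (fun x => U (T gh.1 x) /\ B (theta gh x)).
Proof.
move=> mB; apply: (mpred_act T (P := fun x => U x /\ B (S gh.2 (f x))) gh.1).
exact: (mpred_soe_map Phi (mpred_act S gh.2 mB)).
Qed.

Lemma mpred_eta gh A : measurable A -> mpred (fun y => V (S (- gh.2) y) /\ A (eta gh y)).
Proof.
move=> mA.
apply: (mpred_act S (P := fun y => V y /\ A (T (- gh.1) (fi y))) (- gh.2)).
exact: (mpred_soe_inv Phi (mpred_act T (- gh.1) mA)).
Qed.

Lemma measurable_remaining k : measurable (remaining k).1 /\ measurable (remaining k).2.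
Proof.
elim: k => [|k [mA mB]] /=; first by split; exact: measurableT.
case: (unpickle k) => [gh|//]; split; apply: measurableD => //.
  apply: (mpred_ext (P := fun x => (remaining k).1 x /\
    (U (T gh.1 x) /\ (remaining k).2 (theta gh x)))).
    by move=> x; split=> [[? [? ?]]|[? ? ?]].
  by apply: mpred_and => //; exact: mpred_theta.
apply: (mpred_ext (P := fun y => (remaining k).2 y /\
  (V (S (- gh.2) y) /\ (remaining k).1 (eta gh y)))).
  by move=> x; split=> [[? [? ?]]|[? ? ?]].
by apply: mpred_and => //; exact: mpred_eta.
Qed.

Lemma measurable_domk k : measurable (domk k).
Proof.
have [mA mB] := measurable_remaining k.
rewrite /domk; case: (unpickle k) => [gh|]; last exact: measurable0.
apply: (mpred_ext (P := fun x => (remaining k).1 x /\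
  (U (T gh.1 x) /\ (remaining k).2 (theta gh x)))).
  by move=> x; split=> [[? [? ?]]|[? ? ?]].
by apply: mpred_and => //; exact: mpred_theta.
Qed.

Lemma measurable_imgk k : measurable (imgk k).
Proof.
have [mA mB] := measurable_remaining k.
rewrite /imgk; case: (unpickle k) => [gh|]; last exact: measurable0.
apply: (mpred_ext (P := fun y => (remaining k).2 y /\
  (V (S (- gh.2) y) /\ (remaining k).1 (eta gh y)))).
  by move=> x; split=> [[? [? ?]]|[? ? ?]].
by apply: mpred_and => //; exact: mpred_eta.
Qed.

Definition matched : set X := [set x | exists k, domk k x].
Definition covered : set Y := [set y | exists k, imgk k y].

Definition dom_index x := xget 0%N [set k | domk k x].
Definition img_index y := xget 0%N [set k | imgk k y].

Definition Theta x := theta (step (dom_index x)) x.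
Definition Eta y := eta (step (img_index y)) y.

Lemma dom_indexP x k : domk k x -> dom_index x = k.
Proof.
move=> dx; rewrite /dom_index; case: xgetP => [j _ dj|/(_ k)//].
exact: domk_uniq dj dx.
Qed.

Lemma img_indexP y k : imgk k y -> img_index y = k.
Proof.
move=> dy; rewrite /img_index; case: xgetP => [j _ dj|/(_ k)//].
exact: imgk_uniq dj dy.
Qed.

Lemma matchedP x : matched x -> domk (dom_index x) x.
Proof. by move=> [k dk]; rewrite (dom_indexP dk). Qed.

Lemma coveredP y : covered y -> imgk (img_index y) y.
Proof. by move=> [k dk]; rewrite (img_indexP dk). Qed.

Lemma Theta_covered x : matched x -> covered (Theta x) /\ Eta (Theta x) = x.
Proof.
move=> /matchedP dx; have iT := theta_img dx.
split; first by exists (dom_index x).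
rewrite /Eta /Theta (img_indexP iT) thetaK//.
by have [] := domkP dx.
Qed.

Lemma Eta_matched y : covered y -> matched (Eta y) /\ Theta (Eta y) = y.
Proof.
move=> /coveredP dy; have iT := eta_dom dy.
split; first by exists (img_index y).
rewrite /Eta /Theta (dom_indexP iT) etaK//.
by have [] := imgkP dy.
Qed.

Lemma mdisc_dom_index : mdisc dom_index.
Proof.
apply: mdisc_xget; first by move=> k; exact: measurable_domk.
by move=> x i j; exact: domk_uniq.
Qed.

Lemma measurable_matched : measurable matched.
Proof. by apply: mpred_ex => k; exact: measurable_domk. Qed.

Lemma measurable_covered : measurable covered.
Proof. by apply: mpred_ex => k; exact: measurable_imgk. Qed.

Lemma mpred_Theta B : measurable B -> mpred (fun x => matched x /\ B (Theta x)).
Proof.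
move=> mB; apply: (mpred_ext (P := fun x => exists k,
    domk k x /\ (U (T (step k).1 x) /\ B (theta (step k) x)))).
  move=> x; split=> [[k [dk [_ Bk]]]|[mx Bx]].
    by split; [exists k|rewrite /Theta (dom_indexP dk)].
  exists (dom_index x); have dx := matchedP mx; split=> //; split=> //.
  by have [] := domkP dx.
apply: mpred_ex => k; apply: mpred_and; first exact: measurable_domk.
exact: mpred_theta.
Qed.

Lemma mpred_Eta A : measurable A -> mpred (fun y => covered y /\ A (Eta y)).
Proof.
move=> mA; apply: (mpred_ext (P := fun y => exists k,
    imgk k y /\ (V (S (- (step k).2) y) /\ A (eta (step k) y)))).
  move=> y; split=> [[k [dk [_ Bk]]]|[my Ay]].
    by split; [exists k|rewrite /Eta (img_indexP dk)].
  exists (img_index y); have dy := coveredP my; split=> //; split=> //.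
  by have [] := imgkP dy.
apply: mpred_ex => k; apply: mpred_and; first exact: measurable_imgk.
exact: mpred_eta.
Qed.

Lemma domk_scale k (C : set Y) : measurable C -> C `<=` imgk k ->
  nu C = (c%:E * mu (domk k `&` [set x | C (theta (step k) x)]))%E.
Proof.
move=> mC Ck; pose C' := [set y | C (S (step k).2 y)].
have mC' : measurable C' by exact: (mpred_act S (step k).2 mC).
have C'V : C' `<=` V.
  by move=> y /Ck /imgkP[_]; rewrite zactN.
rewrite -(mu_act S (step k).2 mC) (soe_scale mC' C'V); congr (_ * _)%E.
have mE : measurable (U `&` f @^-1` C') by exact: mpred_soe_map.
rewrite -(mu_act T (step k).1 mE); congr (mu _).
apply/seteqP; split=> x.
  move=> [Ux Cx]; split=> //; have := eta_dom (Ck _ Cx).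
  by rewrite -[S _ _]/(theta (step k) x) thetaK.
by move=> [/domkP[_ Ux _] Cx]; split.
Qed.

Lemma Theta_scale (C : set Y) : measurable C -> C `<=` covered ->
  nu C = (c%:E * mu [set x | matched x /\ C (Theta x)])%E.
Proof.
move=> mC Cc.
have CE : C = \bigcup_k (C `&` imgk k).
  apply/seteqP; split=> [y Cy|y [k _ []]//].
  by have [k hk] := Cc y Cy; exists k.
have DE : [set x | matched x /\ C (Theta x)] =
    \bigcup_k (domk k `&` [set x | (C `&` imgk k) (theta (step k) x)]).
  apply/seteqP; split=> [x [mx Cx]|x [k _ [dk [Ck ik]]]].
    have dx := matchedP mx; exists (dom_index x) => //; split=> //; split=> //.
    exact: theta_img.
  by split; [exists k|rewrite /Theta (dom_indexP dk)].
have mCk k : measurable (C `&` imgk k).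
  by apply: measurableI => //; exact: measurable_imgk.
have mDk k : measurable (domk k `&` [set x | (C `&` imgk k) (theta (step k) x)]).
  apply: (mpred_ext (P := fun x => domk k x /\
    (U (T (step k).1 x) /\ (C `&` imgk k) (theta (step k) x)))).
    by move=> x; split=> [[? [? ?]]|[/[dup] ? /domkP[? ? ?] ?]].
  by apply: mpred_and; [exact: measurable_domk|exact: mpred_theta].
rewrite {1}CE DE measure_bigcup//; last first.
  apply/trivIsetP => i j _ _ ij; apply/seteqP; split=> // y [[_ yi] [_ yj]].
  by rewrite (imgk_uniq yi yj) eqxx in ij.
rewrite measure_bigcup//; last first.
  apply/trivIsetP => i j _ _ ij; apply/seteqP; split=> // y [[yi _] [yj _]].
  by rewrite (domk_uniq yi yj) eqxx in ij.
rewrite -nneseriesZl//; apply: eq_eseriesr => k _.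
by apply: domk_scale => // y [].
Qed.

(** Otherwise x and y, both free at the stage of the pair (g, h), would have been matched there. *)
Lemma leftover g h x y : ~ matched x -> ~ covered y -> U (T g x) ->
  S h (f (T g x)) <> y.
Proof.
move=> nx ny Ug E; apply: (nx); exists (pickle (g, h)).
rewrite /domk pickleK; split=> //.
  by apply/remaining_domE => j _ dj; apply: nx; exists j.
by rewrite /theta /= E; apply/remaining_imgE => j _ dj; apply: ny; exists j.
Qed.

End matching.

(** * An equivalence with full domain *)

Lemma measure_arith (R : realType) (e a b c : R) : 0 < e -> a <= b + (0 + c) ->
  c <= e / 4 -> 1 - e / 2 < a -> 1 - e < b.
Proof. lra. Qed.

Lemma half_arith (R : realType) (e r k : R) : 4 * r < k * e -> r + r <= e / 2 * k.
Proof. lra. Qed.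

Section full_domain.
Context (R : realType) (dX dY : measure_display).
Context (X : measurableType dX) (Y : measurableType dY).
Context (mu : probability X R) (nu : probability Y R) (m n : nat).
Context (T : zsystem mu m) (S : zsystem nu n) (Phi : soe T S).
Hypotheses (T_free : zfree T) (S_free : zfree S).
Hypotheses (T_ergodic : zergodic T) (S_ergodic : zergodic S).
Hypothesis n_gt0 : (0 < n)%N.
Hypothesis ratio_le1 : soe_ratio Phi <= 1.
Local Notation G := 'cV[int]_m.
Local Notation H := 'cV[int]_n.
Local Notation U := (soe_dom Phi).
Local Notation V := (soe_img Phi).
Local Notation f := (soe_map Phi).
Local Notation fi := (soe_inv Phi).
Local Notation c := (soe_ratio Phi).
Local Notation matched := (matched Phi).
Local Notation covered := (covered Phi).
Local Notation Theta := (Theta Phi).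
Local Notation Eta := (Eta Phi).

Let mmatched : measurable matched := measurable_matched Phi.
Let mcovered : measurable covered := measurable_covered Phi.

(** If both leftovers had positive measure, ergodicity of T and S would give a point x of U with T^g
    x and S^h (f x) unmatched, which [leftover] excludes. *)
Lemma matched_or_covered : mu (~` matched) = 0%E \/ nu (~` covered) = 0%E.
Proof.
have [|mu0] := eqVneq (mu (~` matched)) 0%E; first by left.
have [|nu0] := eqVneq (nu (~` covered)) 0%E; first by right.
exfalso.
have mA : measurable (~` matched) by exact: measurableC.
have mB : measurable (~` covered) by exact: measurableC.
have A0 : (0 < mu (~` matched))%E by rewrite lt_neqAle eq_sym mu0 measure_ge0.
have B0 : (0 < nu (~` covered))%E by rewrite lt_neqAle eq_sym nu0 measure_ge0.
have h1 := ergodic_sweep T_ergodic mA A0.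
have h2 := soe_ae_pullback Phi (ergodic_sweep S_ergodic mB B0).
have [C [mC C0 CP]] := ae_conull (ae_and h1 h2).
have [x [Ux /CP[[g Ag] /(_ Ux)[h Bh]]]] :=
  nonnull_meets_conull (soe_dom_measurable Phi) mC (soe_dom_gt0 Phi) C0.
apply: (leftover (g := - g) (h := h) Ag Bh); first by rewrite zactN.
by rewrite zactN.
Qed.

(** If instead Y is exhausted, scaling gives 1 = ratio * mu(matched), and a ratio of at most 1
    forces mu(matched) = 1. *)
Lemma unmatched_null : mu (~` matched) = 0%E.
Proof.
have [//|nu0] := matched_or_covered.
have nu1 : nu covered = 1%E by exact: conull1.
have fm : mu matched \is a fin_num by rewrite fin_num_measure.
have E : (1%E = c%:E * mu matched)%E.
  rewrite -nu1 (Theta_scale mcovered (fun y => id)); congr (_ * mu _)%E.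
  apply/seteqP; split=> [x []//|x mx]; split=> //.
  by have [] := Theta_covered mx.
have m1 : (1 <= mu matched)%E.
  move: E; rewrite -(fineK fm) -EFinM => -[E]; rewrite lee_fin E.
  by rewrite ger_pMl// lt_neqAle fine_ge0// andbT; apply/eqP => e0; move: E;
    rewrite -e0 mulr0 => /eqP; rewrite oner_eq0.
rewrite probability_setC//.
have -> : mu matched = 1%E.
  by apply/eqP; rewrite eq_le m1 andbT; exact: probability_le1.
by rewrite subee.
Qed.

Section with_null_set.
Variables (J : X -> Y) (K : Y -> X) (Z : set Y).
Hypotheses (mJ : measurable_fun setT J) (mK : measurable_fun setT K).
Hypotheses (JK : cancel J K) (mZ : measurable Z) (Z0 : nu Z = 0%E).
Hypotheses (JZ : forall x, Z (J x)) (ZS : forall h y, Z y -> Z (S h y)).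

Definition regular : set X := [set x | matched x /\ (~` Z) (Theta x)].

Definition full_map x := if pselect (regular x) then Theta x else J x.

(** The range of [J] is expressed as the fixed points of [J \o K], which shows at once that it is
    measurable. Membership in [Z] tells the two parts apart, so [full_inv] knows which inverse to
    use. *)
Definition full_img : set Y := [set y | (covered y /\ ~ Z y) \/
  (Z y /\ J (K y) = y /\ ~ regular (K y))].

Definition full_inv y := if pselect (Z y) then K y else Eta y.

Lemma measurable_regular : measurable regular.
Proof. by apply: mpred_Theta; exact: measurableC. Qed.

Lemma regular_conull : mu (~` regular) = 0%E.
Proof.
have mZc : measurable (Z `&` covered) by exact: measurableI.
have mTZ : measurable [set x | matched x /\ (Z `&` covered) (Theta x)].
  exact: mpred_Theta.
have TZ0 : mu [set x | matched x /\ (Z `&` covered) (Theta x)] = 0%E.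
  have := Theta_scale mZc (@subIsetr _ _ _).
  have -> : nu (Z `&` covered) = 0%E by apply: (measure0S mZc mZ) => // y [].
  move/esym/eqP; rewrite mule_eq0 eqe gt_eqF ?soe_ratio_gt0//=.
  by move/eqP.
have mr : measurable (~` regular) by apply: measurableC; exact: measurable_regular.
have mm : measurable (~` matched) by exact: measurableC.
apply: (measure0S mr (measurableU _ _ mm mTZ)).
  move=> x nr; have [mx|] := pselect (matched x); last by left.
  right; split=> //; split; last by have [] := Theta_covered mx.
  by apply: contrapT => nZ; apply: nr.
by apply: measure0U => //; exact: unmatched_null.
Qed.

Lemma full_map_img x : full_img (full_map x).
Proof.
rewrite /full_map; case: pselect => rx.
  by left; have [mx nZ] := rx; have [] := Theta_covered mx.
by right; split; [exact: JZ|rewrite JK].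
Qed.

Lemma full_mapK x : full_inv (full_map x) = x.
Proof.
rewrite /full_map; case: pselect => rx; rewrite /full_inv.
  by have [mx nZ] := rx; case: pselect => // hz; have [] := Theta_covered mx.
by case: pselect => [hz|nZ]; [rewrite JK|case: nZ; exact: JZ].
Qed.

Lemma full_invK y : full_img y -> full_map (full_inv y) = y.
Proof.
move=> [[cy nZ]|[Zy [Jy nr]]]; rewrite /full_inv; case: pselect => // hz.
  have [me te] := Eta_matched cy; rewrite /full_map; case: pselect => // nr.
  by case: nr; split=> //; rewrite te.
by rewrite /full_map; case: pselect.
Qed.

Lemma mpred_full_map B : measurable B -> mpred (fun x => B (full_map x)).
Proof.
move=> mB; apply: (mpred_ext (P := fun x =>
  (matched x /\ (B `&` ~` Z) (Theta x)) \/ (~ regular x /\ B (J x)))).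
  move=> x; rewrite /full_map; case: pselect => rx; split.
  - by case=> [[_ []]//|[]//].
  - by move=> Bx; left; have [mx nZ] := rx.
  - by case=> [[mx [_ nZ]]|[]//]; case: rx.
  - by right.
apply: mpred_or.
  by apply: mpred_Theta; apply: measurableI => //; exact: measurableC.
apply: mpred_and; first by apply: mpred_not; exact: measurable_regular.
exact: (mpred_preimage mJ mB).
Qed.

Lemma measurable_full_map : measurable_fun setT full_map.
Proof. by apply: measurable_funTP => B; exact: mpred_full_map. Qed.

Lemma measurable_full_img : measurable full_img.
Proof.
have [rY] := standard_borelP point (zsystem_standard S).
apply: mpred_or; first by apply: mpred_and => //; exact: mpred_not.
apply: mpred_and => //; apply: mpred_and.
  by apply: (mpred_eq rY); [exact: measurableT_comp|exact: measurable_id].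
apply: mpred_not; exact: (mpred_preimage mK measurable_regular).
Qed.

Lemma full_bij : set_bij setT full_img full_map.
Proof.
split=> [x _|x y _ _ E|y Fy]; first exact: full_map_img.
  by rewrite -(full_mapK x) E full_mapK.
by exists (full_inv y) => //; exact: full_invK.
Qed.

Lemma full_pinv y : full_img y -> pinv setT full_map y = full_inv y.
Proof.
move=> Fy; rewrite -{1}(full_invK Fy) pinvKV ?inE//.
exact: set_bij_inj full_bij.
Qed.

Lemma measurable_full_inv : measurable_fun full_img (pinv setT full_map).
Proof.
apply: (eq_measurable_fun full_inv).
  by move=> y; rewrite inE => Fy; rewrite full_pinv.
move=> _ A mA.
apply: (mpred_ext (P := fun y => (full_img y /\ ~ Z y /\ (covered y /\ A (Eta y)))
    \/ (full_img y /\ Z y /\ A (K y)))).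
  move=> y; rewrite /full_inv; split=> [[[Fy [nZ [_ Ay]]]|[Fy [Zy Ay]]]|[Fy /=]].
  - by split=> //=; case: pselect.
  - by split=> //=; case: pselect.
  - case: pselect => [Zy Ay|nZ Ay]; first by right.
    left; split=> //; split=> //; split=> //.
    by case: Fy => [[]//|[]].
have mF := measurable_full_img.
apply: mpred_or; apply: mpred_and => //; apply: mpred_and => //.
- exact: mpred_not.
- exact: mpred_Eta.
- exact: (mpred_preimage mK mA).
Qed.

Lemma full_scale (A : set Y) : measurable A -> A `<=` full_img ->
  nu A = (c%:E * mu (full_map @^-1` A))%E.
Proof.
move=> mA AF.
have mAZ : measurable (A `&` ~` Z) by apply: measurableI => //; exact: measurableC.
have -> : nu A = nu (A `&` ~` Z).
  apply/eqP; rewrite eq_le; apply/andP; split; last first.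
    by apply: le_measure; rewrite ?inE// => y [].
  apply: (@le_trans _ _ (nu ((A `&` ~` Z) `|` Z))).
    apply: le_measure; rewrite ?inE//; first exact: measurableU.
    by move=> y Ay; have [Zy|nZ] := pselect (Z y); [right|left].
  have Z0' : (nu Z <= 0)%E by rewrite Z0.
  apply: le_trans (measureU2 _ mAZ mZ) _; rewrite -[leRHS]adde0.
  by apply: leeD; [exact: lexx|exact: Z0'].
have AZc : A `&` ~` Z `<=` covered by move=> y [/AF [[]//|[? _]] nZ].
rewrite (Theta_scale mAZ AZc).
congr (_ * _)%E.
have mAT : measurable [set x | matched x /\ (A `&` ~` Z) (Theta x)].
  exact: mpred_Theta.
have mAF : measurable (full_map @^-1` A) by exact: mpred_full_map.
have mr : measurable (~` regular) by apply: measurableC; exact: measurable_regular.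
apply/eqP; rewrite eq_le; apply/andP; split.
  apply: le_measure; rewrite ?inE// => x [mx [Ax nZ]] /=.
  by rewrite /full_map; case: pselect => // nr; case: nr.
apply: (@le_trans _ _ (mu ([set x | matched x /\ (A `&` ~` Z) (Theta x)] `|` ~` regular))).
  apply: le_measure; rewrite ?inE//; first exact: measurableU.
  move=> x /=; rewrite /full_map; case: pselect => rx Ax; last by right.
  by left; have [mx nZ] := rx.
have r0 : (mu (~` regular) <= 0)%E by rewrite regular_conull.
apply: le_trans (measureU2 _ mAT mr) _; rewrite -[leRHS]adde0.
by apply: leeD; [exact: lexx|exact: r0].
Qed.

Lemma full_img_measure : nu full_img = c%:E.
Proof.
rewrite full_scale//; last exact: measurable_full_img.
have -> : full_map @^-1` full_img = setT.
  by apply/seteqP; split=> // x _; exact: full_map_img.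
by rewrite probability_setT mule1.
Qed.

Lemma full_img_gt0 : (0 < nu full_img)%E.
Proof. by rewrite full_img_measure lte_fin soe_ratio_gt0. Qed.

Lemma full_measure (A : set Y) : measurable A -> A `<=` full_img ->
  fine (mu (setT `&` full_map @^-1` A)) / fine (mu setT) = fine (nu A) / fine (nu full_img).
Proof.
move=> mA AF; rewrite setTI full_img_measure.
have -> : fine (mu setT) = 1 by rewrite probability_setT.
have mAF : measurable (full_map @^-1` A) by exact: mpred_full_map.
have fA : mu (full_map @^-1` A) \is a fin_num by rewrite fin_num_measure.
rewrite (full_scale mA AF) fineM// /= divr1 [c * _]mulrC mulfK//.
by rewrite gt_eqF// soe_ratio_gt0.
Qed.

Lemma Theta_shape x : matched x -> exists g h, U (T g x) /\ Theta x = S h (f (T g x)).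
Proof.
move=> /matchedP /domkP[_ Ug _].
by exists (step m n (dom_index Phi x)).1, (step m n (dom_index Phi x)).2.
Qed.

Lemma full_orbit : {ae mu, forall x, setT x ->
  full_map @` (zorbit T x `&` setT) = zorbit S (full_map x) `&` full_img}.
Proof.
have aer : {ae mu, forall x, regular x}.
  by apply: (conull_ae measurable_regular); first exact: regular_conull.
have [X0 gX0 X0r] := soe_good_ex Phi T_free S_free T_ergodic aer.
apply: (conull_ae (good_measurable gX0) (good_conull gX0)) => x x0 _.
have X0T := good_invariant gX0.
have rx := X0r x x0; have [mx nZx] := rx.
have FE z : regular z -> full_map z = Theta z.
  by move=> rz; rewrite /full_map; case: pselect.
rewrite setIT; apply/seteqP; split=> y.
  move=> [_ [k _ <-] <-]; split; last exact: full_map_img.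
  have rk := X0r _ (X0T k x x0); rewrite (FE _ rk) (FE _ rx).
  have [g [h [Ug ->]]] := Theta_shape mx.
  have [g' [h' [Ug' ->]]] := Theta_shape rk.1.
  have E : T g' (T k x) = T (g' + k - g) (T g x) by rewrite -!zactD subrK.
  rewrite E (alphaP gX0 (X0T g x x0) Ug) -?E//.
  exists (h' + soe_alpha Phi (g' + k - g) (T g x) - h) => //.
  by rewrite -!zactD subrK.
move=> [[h0 _ yE] Fy].
(* By invariance of [Z], the orbit of a regular image never meets the points used for the
   exceptional set. *)
have nZy : ~ Z y.
  move=> Zy; apply: nZx; rewrite -(FE x rx).
  by rewrite -[full_map x](zactN S h0) yE; exact: ZS.
have [cy _] : covered y /\ ~ Z y by case: Fy => [//|[]].
have [mEy TEy] := Eta_matched cy.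
have rEy : regular (Eta y) by split=> //; rewrite TEy.
have [g [h [Ug hE]]] := Theta_shape mx.
have [g1 [h1 [Ug1 h1E]]] := Theta_shape mEy.
(* Both x and [Eta y] are moved into U, where the original equivalence links their orbits. *)
have : (zorbit S (f (T g x)) `&` V) (f (T g1 (Eta y))).
  split; last exact: soe_map_img.
  exists (- h1 + h0 + h) => //.
  rewrite !zactD -hE -(FE x rx).
  by rewrite yE -{1}TEy h1E zactN.
rewrite -(good_orbit gX0 (X0T g x x0) Ug) => -[u [[k _ <-] Uu] fu].
have {fu} uE : T k (T g x) = T g1 (Eta y) by exact: (soe_map_inj Uu Ug1 fu).
exists (Eta y); last by rewrite FE.
by exists (- g1 + k + g) => //; rewrite !zactD uE zactN.
Qed.

Definition full_soe : soe T S :=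
  @SOE _ _ _ _ _ _ _ _ _ T S setT full_img full_map measurableT measurable_full_img
    ltac:(by rewrite probability_setT lte01) full_img_gt0 full_bij
    measurable_full_map measurable_full_inv full_measure full_orbit.

(** * The cocycle of the full-domain equivalence *)

Section cocycle.
Variables (sigma : G -> X -> H) (M : 'M[R]_(n, m)).
Hypothesis sigma_cocycle : full_cocycle T sigma.
Hypothesis sigmaE : forall g, {ae mu, forall x, (U `&` T g @^-1` U) x ->
  sigma g x = soe_alpha Phi g x}.
Hypothesis sigmaM : asym_linear T sigma M.

Let p x : G := (step m n (dom_index Phi x)).1.
Let q x : H := (step m n (dom_index Phi x)).2.
(** [Theta x] is S^q f(T^p x). If x were in U this would be S^{q + alpha(p, x)} f(x); the full
    cocycle sigma gives the exponent a meaning for x outside U. *)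
Definition twist x : H := q x + sigma (p x) x.

Lemma mdisc_twist : mdisc twist.
Proof.
have ms g : mdisc (sigma g) by move=> h; exact: sigma_cocycle.1.
apply: (mdisc_ex (F := fun k x => (step m n k).2 + sigma (step m n k).1 x)
  (mdisc_dom_index Phi)) => k.
by apply: (@mdisc_comp _ _ _ _ _ (fun h : H => (step m n k).2 + h)); exact: ms.
Qed.

Lemma full_alpha_ae : {ae mu, forall x, forall v,
  soe_alpha full_soe v x = twist (T v x) - twist x + sigma v x}.
Proof.
have aer : {ae mu, forall x, regular x}.
  by apply: (conull_ae measurable_regular); first exact: regular_conull.
have [X0 gX0 X0r] := soe_good_ex Phi T_free S_free T_ergodic
  (ae_and aer (ae_all sigmaE)).
apply: (conull_ae (good_measurable gX0) (good_conull gX0)) => x x0 v.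
have X0T := good_invariant gX0.
have sD := sigma_cocycle.2.
have FE z : X0 z -> U (T (p z) z) /\ full_map z = S (q z) (f (T (p z) z)).
  move=> z0; have [[mz nz] _] := X0r z z0.
  have /domkP[_ Uz _] := matchedP mz; split=> //.
  by rewrite /full_map; case: pselect => // nr; case: nr.
have [Ux Fx] := FE x x0; have [Uvx Fvx] := FE (T v x) (X0T v x x0).
set u := T (p x) x in Ux Fx.
(* Both [u] and [T k u] lie in U, so sigma and alpha agree on this return; the cocycle identity then
   carries the value back to x. *)
pose k := p (T v x) + v - p x.
have uE : T (p (T v x)) (T v x) = T k u by rewrite /k /u -!zactD subrK.
have u0 : X0 u by exact: X0T.
have Uk : U (T k u) by rewrite -uE.
have sk : sigma k u = soe_alpha Phi k u by apply: (X0r u u0).2.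
have sE : sigma k u = sigma (p (T v x)) (T v x) + sigma v x - sigma (p x) x.
  have := sD k (p x) x; rewrite -/u /k subrK sD => ->.
  by rewrite addrK.
have E : full_map (T v x) = S (twist (T v x) - twist x + sigma v x) (full_map x).
  rewrite Fvx uE (alphaP gX0 u0 Ux Uk) -sk Fx -!zactD; congr (S _ (f u)).
  rewrite sE /twist opprD.
  move: (sigma _ (T v x)) (sigma v x) (sigma (p x) x) (q x) (q (T v x)).
  by move=> a1 a2 a3 a4 a5; apply/matrixP => i j; rewrite !mxE; ring.
have inj : injective (fun h => S h (full_map x)).
  move=> h h'; rewrite /= Fx -!zactD => /(good_free_img gX0 u0 Ux).
  exact: addIr.
apply: inj; rewrite /= -E /soe_alpha /transfer.
by case: xgetP => [h _ /=|/(_ _ E)//].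
Qed.

Lemma full_asym_linear : asym_linear T (soe_alpha full_soe) M.
Proof.
move=> e e0; have e20 : 0 < e / 2 by rewrite divr_gt0.
have [N [A [mA eA hA]]] := sigmaM e20.
pose b x : R := (norm1 (twist x))%:R.
have mb : measurable_fun setT b.
  exact: (measurable_fun_discE (fun h : H => (norm1 h)%:R : R) mdisc_twist).
have e40 : 0 < e / 4 by rewrite divr_gt0.
have [r [r0 hr]] := mu_norm_gt_small mu mb e40.
have [B [mB B0 BP]] := ae_conull full_alpha_ae.
pose C := [set x | r < `|b x|].
have mC : measurable C.
  apply: mpred_lt; first exact: measurable_cst.
  exact: measurableT_comp.
(* Off [C] the twists at the two ends contribute at most [2 r], which is below [e / 2 * |v|] from
   this length on. *)
exists (maxn N (Num.truncn (4 * r / e)).+1), ((A `&` B) `\` C).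
have mAB : measurable (A `&` B) by exact: measurableI.
have mABC : measurable ((A `&` B) `\` C) by exact: measurableD.
split=> //.
  have mBc : measurable (~` B) by exact: measurableC.
  have fin D : measurable D -> mu D \is a fin_num by move=> mD; rewrite fin_num_measure.
  have key : fine (mu A) <= fine (mu ((A `&` B) `\` C)) + (fine (mu (~` B)) + fine (mu C)).
    rewrite -lee_fin !EFinD !fineK ?fin//.
    apply: (@le_trans _ _ (mu (((A `&` B) `\` C) `|` (~` B `|` C)))).
      apply: le_measure; rewrite ?inE//.
        by apply: measurableU => //; exact: measurableU.
      move=> x Ax; have [Cx|nC] := pselect (C x); first by right; right.
      by have [Bx|nB] := pselect (B x); [left|right; left].
    apply: le_trans (measureU2 _ mABC (measurableU _ _ mBc mC)) _.
    by apply: leeD; [exact: lexx|exact: measureU2].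
  have fB : fine (mu (~` B)) = 0 by rewrite B0.
  have fC : fine (mu C) <= e / 4 by rewrite -lee_fin fineK ?fin.
  have fA : 1 - e / 2 < fine (mu A) by rewrite -lte_fin fineK ?fin.
  rewrite -(fineK (fin _ mABC)) lte_fin.
  by rewrite fB in key; exact: measure_arith key fC fA.
move=> v x; rewrite zlenE ler_nat geq_max => /andP[Nv rv] [[[Ax Bx] nCx] [[Avx Bvx] nCvx]].
have bx : b x <= r by rewrite leNgt; apply/negP => h; apply: nCx; rewrite /C/= ger0_norm.
have bvx : b (T v x) <= r.
  by rewrite leNgt; apply/negP => h; apply: nCvx; rewrite /C/= ger0_norm.
have -> : real_vec R (soe_alpha full_soe v x) - M *m real_vec R v =
    real_vec R (twist (T v x) - twist x) + (real_vec R (sigma v x) - M *m real_vec R v).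
  rewrite BP// addrA; congr (_ - _).
  by apply/matrixP => i j; rewrite !mxE !intrD.
apply: le_trans (l1normD _ _) _.
have h1 : l1norm (real_vec R (sigma v x) - M *m real_vec R v) <= e / 2 * (norm1 v)%:R.
  by rewrite -zlenE; apply: hA; [rewrite zlenE ler_nat|split].
have h2 : l1norm (real_vec R (twist (T v x) - twist x)) <= r + r.
  rewrite -/(zlen R _) zlenE; apply: (@le_trans _ _ (b (T v x) + b x)); last exact: lerD.
  by rewrite /b -natrD ler_nat -(norm1N (twist x)) norm1D.
have h3 : r + r <= e / 2 * (norm1 v)%:R.
  have : 4 * r / e < (norm1 v)%:R.
    by apply: lt_le_trans (truncnS_gt _) _; rewrite ler_nat.
  by rewrite ltr_pdivrMr//; exact: half_arith.
apply: le_trans (lerD h2 h1) _; apply: le_trans (lerD h3 (lexx _)) _.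
by rewrite -mulrDl -splitr.
Qed.
End cocycle.
End with_null_set.
End full_domain.

(** * Conclusion *)

Section kakutani.
Context (R : realType) (dX dY : measure_display).
Context (X : measurableType dX) (Y : measurableType dY).
Context (mu : probability X R) (nu : probability Y R).

Lemma asym_linear_ex m n (T : zsystem mu m) (U : set X)
    (a : 'cV[int]_m -> X -> 'cV[int]_n) :
  zergodic T -> integrable_extension T U a ->
  exists sigma (M : 'M[R]_(n, m)), [/\ full_cocycle T sigma,
    forall g, {ae mu, forall x, (U `&` T g @^-1` U) x -> sigma g x = a g x} &
    asym_linear T sigma M].
Proof.
move=> T_ergodic [sigma [sc sa si]]; exists sigma, (drift mu sigma); split=> //.
by move=> e e0; exact: cocycle_linear.
Qed.

Lemma M_kakutani_ratio_le1 n (T : zsystem mu n) (S : zsystem nu n) (Phi : soe T S)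
    (M : 'M[R]_n) sigma : (0 < n)%N ->
  zfree T -> zfree S -> zergodic T -> zergodic S -> soe_ratio Phi <= 1 ->
  full_cocycle T sigma ->
  (forall g, {ae mu, forall x, (soe_dom Phi `&` T g @^-1` soe_dom Phi) x ->
     sigma g x = soe_alpha Phi g x}) ->
  asym_linear T sigma M -> M_kakutani M T S.
Proof.
move=> n0 T_free S_free T_ergodic S_ergodic ratio sc sE sM.
have [J [K [Z0 [mJ mK JK mZ0 [Z00 JZ0]]]]] := null_embedding (nu := nu) point point
  (zsystem_standard T) (zsystem_standard S) (zfree_atomless n0 S_free).
(* Saturating the Cantor set under the countable group makes it invariant and keeps it null. *)
pose Z := [set y | exists h, Z0 (S h y)].
have mZ : measurable Z by apply: mpred_ex => h; exact: mpred_act.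
have nZ : nu Z = 0%E.
  apply: (measure0_bigcup (A := fun h => [set y | Z0 (S h y)])) => h.
    exact: mpred_act.
  by rewrite mu_act.
have JZ x : Z (J x) by exists 0; rewrite zact0.
have ZS h y : Z y -> Z (S h y).
  by move=> [k Zk]; exists (k - h); rewrite -zactD subrK.
exists (full_soe T_free S_free T_ergodic S_ergodic ratio mJ mK JK mZ nZ JZ ZS).
split=> // e e0.
by have := full_asym_linear T_free S_free T_ergodic S_ergodic ratio mJ mK JK mZ nZ JZ ZS
  sc sE sM e0.
Qed.

End kakutani.

Theorem theoremB (R : realType) (dX dY : measure_display)
    (X : measurableType dX) (Y : measurableType dY)
    (mu : probability X R) (nu : probability Y R) (d D : nat)
    (d_gt0 : (0 < d)%N) (D_gt0 : (0 < D)%N)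
    (T : zsystem mu d) (S : zsystem nu D)
    (T_free : zfree T) (T_ergodic : zergodic T)
    (S_free : zfree S) (S_ergodic : zergodic S) :
  ((exists Phi : soe T S, soe_infty Phi) ->
     exists Phi : soe T S, ssoe_one Phi) /\
  ((exists Phi : soe T S, ssoe_one Phi) ->
     exists e : d = D, kakutani_equivalent (ecast n (zsystem mu n) e T) S).
Proof.
split=> [[Phi [C [hT hS]]]|[Phi oPhi]].
  exists Phi; split; first exact: lipschitz_extension T_free S_free T_ergodic _ hT.
  exact: (lipschitz_extension (Phi := soe_sym Phi) S_free T_free S_ergodic hS).
have [extT extS] := oPhi.
have [_ extT'] := ssoe_one_sym oPhi.
have [sigma [M [sc sE sM]]] := asym_linear_ex T_ergodic extT.
have [tau [M' [tc tE tM]]] := asym_linear_ex S_ergodic extS.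
(* The inverse equivalence is stated with its own [soe_beta], which equals alpha only almost
   everywhere on returns; hence a separate extension. *)
have [sigma' [M2 [_ sE' sM']]] := asym_linear_ex T_ergodic extT'.
have dD : d = D.
  apply/eqP; rewrite eqn_leq; apply/andP; split.
    (* A product equal to the identity of size d that factors through dimension D forces d <= D; the
       inverse equivalence gives D <= d. *)
    exact: mulmx1_min (drift_inverse T_free S_free T_ergodic sE tE sM tM).
  exact: mulmx1_min (drift_inverse (Phi := soe_sym Phi) S_free T_free S_ergodic tE sE' tM sM').
(* The dimension occurs in the types, so everything depending on it is generalized before D is
   replaced by d. *)
move: dD S S_free S_ergodic D_gt0 Phi oPhi extT extS extT' sigma M sc sE sM
  tau M' tc tE tM sigma' M2 sE' sM'.
case: D / => S S_free S_ergodic D_gt0 Phi oPhi _ _ _ sigma M sc sE sM tau M' tc tE tM _ _ _ _.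
exists erefl; have [le1|gt1] := lerP (soe_ratio Phi) 1.
  by exists M; left; exact: (M_kakutani_ratio_le1 (Phi := Phi) d_gt0) sE sM.
exists M'; right.
have ratio' : soe_ratio (soe_sym Phi) <= 1.
  have -> : soe_ratio (soe_sym Phi) = (soe_ratio Phi)^-1 by rewrite /soe_ratio invf_div.
  by rewrite invf_le1 ?ltW// (lt_trans ltr01).
exact: (M_kakutani_ratio_le1 (Phi := soe_sym Phi) d_gt0) tE tM.
Qed.
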